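(* Let $U=\{z\in\mathbb{C}:|z|<1\}$, let $f:U\to\mathscr{R}(f)$ be a meromorphic function, where $\mathscr{R}(f)$ is the Riemann surface over the $w$-plane onto which $f$ maps $U$, and let $z_1,z_2\in U$ be points satisfying $f'(z_k)\neq 0$, $k=1,2$, and such that the projections $w_k=\mathrm{pr}\,f(z_k)$ satisfy $w_1\neq w_2$ and $w_k\neq\infty$, $k=1,2$. Let $\Gamma(w_1,w_2)$ be the collection of all circles in the $w$-plane passing through $w_1$ and $w_2$. Suppose that for any pair of non-intersecting Jordan curves $\gamma_1,\gamma_2\subset\mathscr{R}(f)$ that do not pass through the ramification points of $\mathscr{R}(f)$, lie over the same circle from $\Gamma(w_1,w_2)$, and satisfy $f(z_k)\in\gamma_k$, $k=1,2$, the set $\gamma_1\cup\gamma_2$ is one-sheeted. Then $$ \left|(1-|z_1|^2)f'(z_1)\,(1-|z_2|^2)f'(z_2)\right|\tanh^2(d(z_1,z_2))\le |w_1-w_2|^2, $$ where $d(z_1,z_2)$ is the hyperbolic distance in $U$. This inequality is sharp, i.e. equality is attained for some $f,z_1,z_2$ satisfying the hypotheses.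
   Context: Riemann surface of $f$: a (nonconstant) meromorphic function on $U$ with values in $\overline{\mathbb{C}}_w$ (the extended $w$-plane) is regarded as a conformal bijection $f:U\to\mathscr{R}(f)$ onto its Riemann surface $\mathscr{R}(f)$ spread over the $w$-plane, equipped with the projection $\mathrm{pr}:\mathscr{R}(f)\to\overline{\mathbb{C}}_w$; the composition $\mathrm{pr}\circ f$ is the given meromorphic function in the usual sense. Each point of $\mathscr{R}(f)$ has a neighborhood that is either a univalent disk or a finite-sheeted disk with a unique ramification point at its center; the ramification points are the images of the points of $U$ at which $\mathrm{pr}\circ f$ is not locally injective. The derivative $f'$ denotes the derivative of $\mathrm{pr}\circ f$. A curve on $\mathscr{R}(f)$ ''lies over'' a circle $\gamma$ if its projection under $\mathrm{pr}$ is contained in $\gamma$. Jordan curves are simple curves on $\mathscr{R}(f)$, not necessarily closed (arcs are allowed). One-sheeted: a set $\Lambda\subset\mathscr{R}(f)$ is one-sheeted if different points of $\Lambda$ have different projections, i.e. $W',W''\in\Lambda$, $W'\neq W''$ implies $\mathrm{pr}\,W'\neq\mathrm{pr}\,W''$. Hyperbolic distance: normalized so that $\tanh d(z_1,z_2)=\left|\dfrac{z_1-z_2}{1-\overline{z}_1z_2}\right|$. *)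

(* Defs.v *)
From HB Require Import structures.
From mathcomp Require Import all_boot all_order all_algebra.
From mathcomp Require Import complex.
From mathcomp Require Import all_classical all_reals all_analysis.
From mathcomp Require Import ring lra.

Set Implicit Arguments.
Unset Strict Implicit.
Unset Printing Implicit Defensive.

Import Order.TTheory GRing.Theory Num.Theory.
Import numFieldNormedType.Exports.

Local Open Scope classical_set_scope.
Local Open Scope ring_scope.

(* [R[i]^o], and not [R[i]], is the type that the library equips with the
   topology and the normed-module structure given by the complex modulus; a
   derivative over it is therefore a complex derivative. *)
Notation Cplane R := (R[i]^o) (only parsing).

Definition cabs (R : realType) (z : Cplane R) : R := ComplexField.Normc.normc z.

Definition unit_disk (R : realType) : set (Cplane R) := [set z | cabs z < 1].

(* [Some w] is the finite point [w] and [None] is the point at infinity. *)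
Notation sphere R := (one_point_compactification (Cplane R)).

(* The two standard charts of the sphere are [affine_part], on the complement of
   infinity, and [affine_part (sphere_inv p)], on the complement of 0; the value
   of [affine_part] at infinity is junk. *)
Definition affine_part (R : realType) (p : sphere R) : Cplane R :=
  if p is Some w then w else 0.

Definition sphere_inv (R : realType) (p : sphere R) : sphere R :=
  if p is Some w then (if w == 0 then None else Some w^-1) else Some 0.

(* A nonconstant meromorphic function on the unit disk, as a nonconstant
   holomorphic map to the sphere. The values outside the disk are irrelevant. *)
Definition meromorphic_on_disk (R : realType) (g : Cplane R -> sphere R) :=
  (forall z, unit_disk z ->
    [/\ {for z, continuous g},
        g z <> None -> derivable (fun u => affine_part (g u)) z 1
      & g z <> Some 0 -> derivable (fun u => affine_part (sphere_inv (g u))) z 1])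
  /\ (exists z z', [/\ unit_disk z, unit_disk z' & g z <> g z']).

(* [S], with projection [pr], is the Riemann surface of a nonconstant
   meromorphic function on the unit disk, and [f] is that function regarded as
   a bijection of the disk onto [S]. The conformal structure of [S] is the only
   one making [pr] meromorphic, so that a homeomorphism [f] is conformal exactly
   when [pr \o f] is meromorphic. *)
Definition maps_disk_onto_surface (R : realType) (S : topologicalType)
    (pr : S -> sphere R) (f : Cplane R -> S) :=
  [/\ set_bij (@unit_disk R) setT f,
      forall z, unit_disk z -> {for z, continuous f},
      forall A, A `<=` @unit_disk R -> open A -> open (f @` A)
    & meromorphic_on_disk (pr \o f)].

(* The derivative of [pr \o f]; meaningful where [pr \o f] is finite. *)
Definition surface_deriv (R : realType) (S : Type)
    (pr : S -> sphere R) (f : Cplane R -> S) (z : Cplane R) : Cplane R :=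
  derive1 (fun u => affine_part (pr (f u))) z.

Definition locally_injective_at (T : topologicalType) (V : Type)
    (g : T -> V) (x : T) := exists2 N, nbhs x N & set_inj N g.

Definition ramification_points (R : realType) (S : Type)
    (pr : S -> sphere R) (f : Cplane R -> S) : set S :=
  f @` [set z | unit_disk z /\ ~ locally_injective_at (pr \o f) z].

(* A simple arc, or a simple closed curve when [g 0 = g 1]. *)
Definition jordan_curve (R : realType) (S : topologicalType) (gamma : set S) :=
  exists g : R -> S,
    [/\ {within `[0, 1], continuous g},
        forall s t, 0 <= s -> s < t -> t <= 1 -> g s = g t -> s = 0 /\ t = 1
      & gamma = g @` `[0, 1]].

Definition one_sheeted (R : realType) (S : Type) (pr : S -> sphere R)
    (L : set S) := forall W' W'', L W' -> L W'' -> W' <> W'' -> pr W' <> pr W''.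

Definition circle (R : realType) (c : Cplane R) (r : R) : set (Cplane R) :=
  [set w | cabs (w - c) = r].

(* Circles of the finite plane: the straight line through [w1] and [w2] is not a
   member. *)
Definition circles_through (R : realType) (w1 w2 : Cplane R) :
    set (set (Cplane R)) :=
  [set C | exists c r, [/\ 0 < r, C = circle c r, C w1 & C w2]].

Definition lies_over (R : realType) (S : Type) (pr : S -> sphere R)
    (gamma : set S) (C : set (Cplane R)) := pr @` gamma `<=` Some @` C.

Definition disjoint_lifts_one_sheeted (R : realType) (S : topologicalType)
    (pr : S -> sphere R) (f : Cplane R -> S) (z1 z2 w1 w2 : Cplane R) :=
  forall (gamma1 gamma2 : set S) (C : set (Cplane R)),
    jordan_curve R gamma1 -> jordan_curve R gamma2 ->
    gamma1 `&` gamma2 = set0 ->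
    gamma1 `&` ramification_points pr f = set0 ->
    gamma2 `&` ramification_points pr f = set0 ->
    circles_through w1 w2 C -> lies_over pr gamma1 C -> lies_over pr gamma2 C ->
    gamma1 (f z1) -> gamma2 (f z2) ->
    one_sheeted pr (gamma1 `|` gamma2).

Definition tanh (R : realType) (x : R) : R :=
  (expR x - expR (- x)) / (expR x + expR (- x)).

(* [hyp_dist] is the hyperbolic distance of curvature -4, that is, [artanh] of
   [pseudo_hyp_dist]; see [tanh_hyp_dist]. *)
Definition pseudo_hyp_dist (R : realType) (z1 z2 : Cplane R) : R :=
  cabs ((z1 - z2) / (1 - (z1 : R[i])^*%C * z2)).

Definition hyp_dist (R : realType) (z1 z2 : Cplane R) : R :=
  2^-1 * ln ((1 + pseudo_hyp_dist z1 z2) / (1 - pseudo_hyp_dist z1 z2)).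

Lemma cabsE (R : realType) (z : R[i]) :
  cabs z = Num.sqrt (complex.Re z ^+ 2 + complex.Im z ^+ 2).
Proof. by case: z. Qed.

Lemma tanh_hyp_dist (R : realType) (z1 z2 : Cplane R) :
  unit_disk z1 -> unit_disk z2 -> tanh (hyp_dist z1 z2) = pseudo_hyp_dist z1 z2.
Proof.
move=> z1U z2U.
have r0 : 0 <= pseudo_hyp_dist z1 z2 by rewrite /pseudo_hyp_dist cabsE sqrtr_ge0.
have r1 : pseudo_hyp_dist z1 z2 < 1.
  have hs x : 0 <= x -> Num.sqrt x < 1 -> x < 1 :> R.
    move=> x0; by rewrite -[X in _ < X]sqrtr1 ltr_sqrt.
  rewrite /pseudo_hyp_dist /cabs ComplexField.Normc.normcM ComplexField.Normc.normcV.
  move: z1U z2U {r0}; rewrite /unit_disk/= /cabs; case: z1 => a b; case: z2 => c d /=.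
  move=> /hs; rewrite addr_ge0 ?sqr_ge0// => /(_ isT) ab.
  move=> /hs; rewrite addr_ge0 ?sqr_ge0// => /(_ isT) cd.
  have key : (a - c) ^+ 2 + (b - d) ^+ 2 <
      (1 - (a * c - - b * d)) ^+ 2 + (0 - (a * d + - b * c)) ^+ 2.
    have : 0 < (1 - (a^+2+b^+2)) * (1 - (c^+2+d^+2)) by rewrite mulr_gt0// subr_gt0.
    by nra.
  have p : 0 < (1 - (a * c - - b * d)) ^+ 2 + (0 - (a * d + - b * c)) ^+ 2.
    by apply: le_lt_trans key; rewrite addr_ge0 ?sqr_ge0.
  by rewrite ltr_pdivrMr ?sqrtr_gt0// mul1r ltr_sqrt.
rewrite /hyp_dist; set r := pseudo_hyp_dist _ _ in r0 r1 *.
set q := (1 + r) / (1 - r).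
have q0 : 0 < q by rewrite divr_gt0; lra.
set x := 2^-1 * ln q.
have ex : expR x * expR x = q.
  by rewrite -expRD -[RHS]lnK ?posrE//; congr expR; rewrite /x; lra.
have ep := expR_gt0 x.
rewrite /tanh expRN.
have -> : (expR x - (expR x)^-1) / (expR x + (expR x)^-1) = (q - 1) / (q + 1).
  have h1 : expR x != 0 by rewrite gt_eqF.
  have h2 : expR x * expR x + 1 != 0 by rewrite gt_eqF// addr_gt0// mulr_gt0.
  by rewrite -ex; field; rewrite ?h1 ?h2 ?expr2 ?h2.
by rewrite /q; field; rewrite ?gt_eqF//=; lra.
Qed.

(* Main.v *)
(* Let g = pr o f and F = (g - w1) / (g - w2), so that F(z1) = 0 and F(z2) =
   oo; the circles through w1 and w2 are, away from the excluded line, the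
   pairs of opposite rays of the F-plane. The inverse branch of F at z1 is
   continued along the rays from 0, and the one at z2 along the rays from
   oo, which gives two maximal lifts sigma1 and sigma2 of zeta |-> exp zeta,
   defined on open sets O1 and O2 closed under moving left, respectively
   right. If both are defined at zeta, the images under f of the two rays
   ending there are arcs over one circle with a common end projection; the
   hypothesis then forces sigma1 zeta = sigma2 zeta.

   This is played against the Blaschke quotient G = B1 / B2 of z1 and z2,
   which is univalent on the disk and has modulus 1 on its boundary. For all
   but finitely many heights y either the two lifts meet over the line Im
   zeta = y, or both leave every compact subset of the disk, and |G| -> 1
   there. So one can cut sigma1 at some a and sigma2 at some b >= a on that
   line such that |G o sigma1| at a is, up to a small error, at least |G o
   sigma2| at b. The parts kept have disjoint images; the area of these
   under log G is at least the integral over y of 2 (increase of log |G o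
   sigma|) - length, because |q|^2 >= 2 Re q - 1, and at most 2 pi times the
   logarithmic width of an annulus containing them. The expansions of log |G
   o sigma1| at 0 and of log |G o sigma2| at oo turn this into the asserted
   inequality.

   Equality holds for g(z) = z / (1 - z^2) at the points -1/2 and 1/2. *)
From HB Require Import structures.
Require Import Defs.
From mathcomp Require Import all_boot all_order all_algebra.
From mathcomp Require Import complex.
From mathcomp Require Import all_classical all_reals all_analysis.
From mathcomp Require Import measurable_realfun.
From mathcomp Require Import ring lra.

Set Implicit Arguments.
Unset Strict Implicit.
Unset Printing Implicit Defensive.

Import Order.TTheory GRing.Theory Num.Theory.
Import numFieldNormedType.Exports.

Local Open Scope classical_set_scope.
Local Open Scope ring_scope.


(** * Modulus of complex numbers *)

Section Modulus.
Variable R : realType.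
Implicit Types z w : R[i].

(** The constant comes out right because log |G| is asymptotic to Re zeta + c1 along the first lift
    and to Re zeta - c2 along the second, where exp (- c1 - c2) is the left side of the inequality
    divided by the right one. Between abscissas x0 and x1 both the increase of log |G| and the width
    of the annulus are x1 - x0 - c1 - c2 up to small errors, so that 2 * increase - length <= width
    reads c1 + c2 >= 0. The cuts a and b depend on the height with no regularity whatever. Areas are
    therefore bounded by subdivision: on a short interval of heights the cuts of a single height
    serve for all, by openness and continuity, and exceptional heights cost arbitrarily little. The
    two lifts are one construction: the second is the lift for 1 / F at z2, in the variable - zeta,
    and the convention 0^-1 = 0 makes 1 / F an honest function. The function theory rests on
    Goursat's theorem and the maximum principle; Schwarz-type bounds for functions with prescribed
    zeros take the place of Cauchy's formula and of power series. *)

Lemma cabs0 : cabs (0 : R[i]) = 0. Proof. exact: ComplexField.Normc.normc0. Qed.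
Lemma cabs1 : cabs (1 : R[i]) = 1. Proof. exact: ComplexField.Normc.normc1. Qed.
Lemma cabsM z w : cabs (z * w) = cabs z * cabs w.
Proof. exact: ComplexField.Normc.normcM. Qed.
Lemma cabsV z : cabs z^-1 = (cabs z)^-1.
Proof. exact: ComplexField.Normc.normcV. Qed.
Lemma cabsX z n : cabs (z ^+ n) = cabs z ^+ n.
Proof. by elim: n => [|n IH]; rewrite ?expr0 ?cabs1// !exprS cabsM IH. Qed.
Lemma cabsN z : cabs (- z) = cabs z. Proof. exact: normcN. Qed.
Lemma cabsB z w : cabs (z - w) = cabs (w - z). Proof. by rewrite -cabsN opprB. Qed.
Lemma cabs_ge0 z : 0 <= cabs z. Proof. by rewrite cabsE sqrtr_ge0. Qed.
Lemma ler_cabsD z w : cabs (z + w) <= cabs z + cabs w. Proof. exact: le_normcD. Qed.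
Lemma cabs_eq0 z : (cabs z == 0) = (z == 0).
Proof.
by apply/eqP/eqP => [/ComplexField.Normc.eq0_normc//|->]; rewrite cabs0.
Qed.
Lemma cabs_gt0 z : (0 < cabs z) = (z != 0).
Proof. by rewrite lt_neqAle cabs_ge0 andbT eq_sym cabs_eq0. Qed.
Lemma ler_cabsB z w : cabs (z - w) <= cabs z + cabs w.
Proof. by rewrite -(cabsN w) ler_cabsD. Qed.
Lemma cabs_triangle z w v : cabs (z - v) <= cabs (z - w) + cabs (w - v).
Proof. by rewrite -[in leLHS](subrK w z) -addrA ler_cabsD. Qed.
Lemma ler_sub_cabs z w : cabs z - cabs w <= cabs (z - w).
Proof. by rewrite lerBlDr -{1}(subrK w z) ler_cabsD. Qed.
Lemma cabsR (x : R) : cabs (x%:C%C) = `|x|.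
Proof. by rewrite cabsE /= expr0n addr0 sqrtr_sqr. Qed.
Lemma sqr_cabs z : cabs z ^+ 2 = complex.Re z ^+ 2 + complex.Im z ^+ 2.
Proof. by rewrite cabsE sqr_sqrtr// addr_ge0 ?sqr_ge0. Qed.
Lemma ler_Re_cabs z : `|complex.Re z| <= cabs z.
Proof. by rewrite cabsE -sqrtr_sqr ler_sqrt ?addr_ge0 ?sqr_ge0// lerDl sqr_ge0. Qed.
Lemma ler_Im_cabs z : `|complex.Im z| <= cabs z.
Proof. by rewrite cabsE -sqrtr_sqr ler_sqrt ?addr_ge0 ?sqr_ge0// lerDr sqr_ge0. Qed.
Lemma cabs_leD z : cabs z <= `|complex.Re z| + `|complex.Im z|.
Proof.
rewrite cabsE -(ger0_norm (addr_ge0 (normr_ge0 (complex.Re z)) (normr_ge0 _))).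
rewrite -sqrtr_sqr ler_sqrt ?sqr_ge0// sqrrD !real_normK ?num_real//.
by rewrite -addrA [_ *+ 2 + _]addrC addrA lerDl mulrn_wge0 ?mulr_ge0.
Qed.
Lemma cabs_sub_eq0 z w : cabs (z - w) = 0 -> z = w.
Proof. by move/eqP; rewrite cabs_eq0 subr_eq0 => /eqP. Qed.

End Modulus.

(** * Complex differentiability *)

Section Differentiability.
Variable R : realType.
Local Notation C := R[i].
Implicit Types (f g : C -> C) (z d : C).

(** The derivative in Frechet form: there is no quotient, and the non-strict bound admits
    [u = z]. *)
Definition dif f z d := forall e : R, 0 < e -> exists2 r : R, 0 < r &
  forall u, cabs (u - z) < r -> cabs (f u - f z - d * (u - z)) <= e * cabs (u - z).

Definition ccont f z := forall e : R, 0 < e -> exists2 r : R, 0 < r &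
  forall u, cabs (u - z) < r -> cabs (f u - f z) < e.

Lemma dif_weak f z d (K : R) : 0 < K ->
  (forall e : R, 0 < e -> exists2 r : R, 0 < r &
    forall u, cabs (u - z) < r ->
      cabs (f u - f z - d * (u - z)) <= K * e * cabs (u - z)) ->
  dif f z d.
Proof.
move=> K0 H e e0; have [|r r0 Hr] := H (e / K); first exact: divr_gt0.
exists r => // u /Hr; rewrite mulrCA mulfV ?mulr1//; exact: lt0r_neq0.
Qed.

Lemma dif_quad f z d (K r : R) : 0 < r ->
  (forall u, cabs (u - z) < r ->
      cabs (f u - f z - d * (u - z)) <= K * cabs (u - z) ^+ 2) -> dif f z d.
Proof.
move=> r0 H e e0; pose K' := `|K| + 1.
have K'0 : 0 < K' by rewrite /K' ltr_wpDl.
exists (Num.min r (e / K')); first by rewrite lt_min r0 divr_gt0.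
move=> u; rewrite lt_min => /andP[/H h1 h2].
apply: le_trans h1 _; rewrite expr2 mulrA ler_wpM2r ?cabs_ge0//.
move: h2; rewrite ltr_pdivlMr// => h2; apply: le_trans (ltW h2).
by rewrite mulrC ler_wpM2l ?cabs_ge0// (le_trans (ler_norm K))// lerDl.
Qed.

Lemma dif_local f g z d (r : R) : 0 < r ->
  (forall u, cabs (u - z) < r -> f u = g u) -> dif f z d -> dif g z d.
Proof.
move=> r0 fg H e /H[s s0 Hs]; exists (Num.min r s); first by rewrite lt_min r0.
move=> u; rewrite lt_min => /andP[/fg <- /Hs].
by rewrite -(fg z)// subrr cabs0.
Qed.

Lemma dif_lip f z d : dif f z d -> exists2 r : R, 0 < r &
  forall u, cabs (u - z) < r -> cabs (f u - f z) <= (cabs d + 1) * cabs (u - z).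
Proof.
move=> /(_ 1 ltr01)[r r0 H]; exists r => // u /H h.
rewrite -[f u - f z](subrK (d * (u - z))) (le_trans (ler_cabsD _ _))//.
by rewrite cabsM mulrDl addrC lerD2l.
Qed.

Lemma dif_cont f z d : dif f z d -> ccont f z.
Proof.
move=> /dif_lip[r r0 H] e e0.
have K0 : 0 < cabs d + 1 by rewrite ltr_wpDl ?cabs_ge0.
exists (Num.min r (e / (cabs d + 1))); first by rewrite lt_min r0 divr_gt0.
move=> u; rewrite lt_min => /andP[/H h1]; rewrite ltr_pdivlMr// => h2.
by apply: le_lt_trans h1 _; rewrite mulrC.
Qed.

Lemma dif_cst (c : C) z : dif (fun=> c) z 0.
Proof.
by move=> e e0; exists 1 => // u _; rewrite subrr mul0r subrr cabs0 mulr_ge0 ?cabs_ge0 ?ltW.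
Qed.

Lemma dif_id z : dif id z 1.
Proof.
by move=> e e0; exists 1 => // u _; rewrite mul1r subrr cabs0 mulr_ge0 ?cabs_ge0 ?ltW.
Qed.

Lemma difD f g z d d' : dif f z d -> dif g z d' -> dif (fun u => f u + g u) z (d + d').
Proof.
move=> Hf Hg; apply: (@dif_weak _ _ _ 2) => // e e0.
have [r r0 H1] := Hf e e0; have [s s0 H2] := Hg e e0.
exists (Num.min r s); first by rewrite lt_min r0.
move=> u; rewrite lt_min => /andP[/H1 h1 /H2 h2].
have -> : f u + g u - (f z + g z) - (d + d') * (u - z) =
  (f u - f z - d * (u - z)) + (g u - g z - d' * (u - z)) by ring.
by apply: le_trans (ler_cabsD _ _) _; lra.
Qed.

Lemma difM f g z d d' : dif f z d -> dif g z d' ->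
  dif (fun u => f u * g u) z (d * g z + f z * d').
Proof.
move=> Hf Hg; have [r1 r10 L1] := dif_lip Hf; have [r2 r20 L2] := dif_lip Hg.
set A := cabs d + 1 in L1; set B := cabs d' + 1 in L2.
have A0 : 0 < A by rewrite ltr_wpDl ?cabs_ge0.
have B0 : 0 < B by rewrite ltr_wpDl ?cabs_ge0.
apply: (@dif_weak _ _ _ (A * B + cabs (f z) + cabs (g z))).
  by rewrite -addrA ltr_pwDl ?mulr_gt0// addr_ge0 ?cabs_ge0.
move=> e e0; have [r r0 H1] := Hf e e0; have [s s0 H2] := Hg e e0.
exists (Num.min e (Num.min (Num.min r s) (Num.min r1 r2))).
  by rewrite !lt_min e0 r0 s0 r10 r20.
move=> u; rewrite !lt_min => /and3P[he /andP[/H1 h1 /H2 h2] /andP[/L1 l1 /L2 l2]].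
have -> : f u * g u - f z * g z - (d * g z + f z * d') * (u - z) =
  (f u - f z) * (g u - g z) + f z * (g u - g z - d' * (u - z))
  + g z * (f u - f z - d * (u - z)) by ring.
have -> : (A * B + cabs (f z) + cabs (g z)) * e * cabs (u - z) =
  A * B * e * cabs (u - z) + cabs (f z) * (e * cabs (u - z))
  + cabs (g z) * (e * cabs (u - z)) by ring.
apply: le_trans (ler_cabsD _ _) _; apply: lerD; last by rewrite cabsM ler_wpM2l ?cabs_ge0.
apply: le_trans (ler_cabsD _ _) _; apply: lerD; last by rewrite cabsM ler_wpM2l ?cabs_ge0.
rewrite cabsM; apply: le_trans (ler_pM (cabs_ge0 _) (cabs_ge0 _) l1 l2) _.
have -> : A * cabs (u - z) * (B * cabs (u - z)) = A * B * cabs (u - z) * cabs (u - z) by ring.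
by rewrite ler_wpM2r ?cabs_ge0// ler_wpM2l ?ltW// mulr_gt0.
Qed.

Lemma dif_comp f g z d d' : dif g z d -> dif f (g z) d' ->
  dif (fun u => f (g u)) z (d' * d).
Proof.
move=> Hg Hf; have [r1 r10 L1] := dif_lip Hg.
set A := cabs d + 1 in L1; have A0 : 0 < A by rewrite ltr_wpDl ?cabs_ge0.
apply: (@dif_weak _ _ _ (A + cabs d')); first by rewrite ltr_pwDl ?cabs_ge0.
move=> e e0; have [r r0 H1] := Hf e e0; have [s s0 H2] := Hg e e0.
exists (Num.min (r / A) (Num.min s r1)).
  by rewrite !lt_min s0 r10 divr_gt0.
move=> u; rewrite !lt_min => /and3P[hr /H2 h2 /L1 l1].
have hr' : cabs (g u - g z) < r.
  by apply: le_lt_trans l1 _; rewrite mulrC -ltr_pdivlMr.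
have h1 := H1 _ hr'.
have -> : f (g u) - f (g z) - d' * d * (u - z) =
  (f (g u) - f (g z) - d' * (g u - g z)) + d' * (g u - g z - d * (u - z)) by ring.
have -> : (A + cabs d') * e * cabs (u - z) =
  e * (A * cabs (u - z)) + cabs d' * (e * cabs (u - z)) by ring.
apply: le_trans (ler_cabsD _ _) _; apply: lerD.
  by apply: le_trans h1 _; rewrite ler_wpM2l// ltW.
by rewrite cabsM ler_wpM2l ?cabs_ge0.
Qed.

Lemma dif_inv w : w != 0 -> dif (fun u => u^-1) w (- w ^- 2).
Proof.
move=> w0; have W0 : 0 < cabs w by rewrite cabs_gt0.
apply: (@dif_quad _ _ _ (2 / cabs w ^+ 3) (cabs w / 2)); first by rewrite divr_gt0.
move=> u hu; have hw : cabs w / 2 <= cabs u.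
  have := cabs_triangle w u 0; rewrite !subr0 cabsB; lra.
have U0 : 0 < cabs u by lra.
have u0 : u != 0 by rewrite -cabs_gt0.
have -> : u^-1 - w^-1 - - w ^- 2 * (u - w) = (u - w) ^+ 2 * (u^-1 * w ^- 2).
  by field; rewrite u0 w0.
rewrite cabsM cabsX [leRHS]mulrC ler_wpM2l ?sqr_ge0// cabsM !cabsV cabsX.
have -> : 2 / cabs w ^+ 3 = (cabs w / 2)^-1 * (cabs w ^+ 2)^-1.
  by field; rewrite gt_eqF.
rewrite ler_wpM2r ?invr_ge0 ?exprn_ge0 ?cabs_ge0//.
by rewrite lef_pV2 ?posrE ?divr_gt0.
Qed.

Lemma difV f z d : f z != 0 -> dif f z d -> dif (fun u => (f u)^-1) z (- f z ^- 2 * d).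
Proof. by move=> f0 H; apply: dif_comp H (dif_inv f0). Qed.

Lemma difZ (c : C) f z d : dif f z d -> dif (fun u => c * f u) z (c * d).
Proof. by move=> H; have := difM (dif_cst c z) H; rewrite mul0r add0r. Qed.

Lemma difN f z d : dif f z d -> dif (fun u => - f u) z (- d).
Proof.
move=> /(difZ (-1)); rewrite mulN1r; apply: dif_local ltr01 _ => u _.
by rewrite mulN1r.
Qed.

Lemma difB f g z d d' : dif f z d -> dif g z d' -> dif (fun u => f u - g u) z (d - d').
Proof. by move=> Hf Hg; apply: difD Hf _; apply: difN. Qed.

Lemma difX n f z d : dif f z d ->
  exists d', dif (fun u => f u ^+ n) z d'.
Proof.
move=> H; elim: n => [|n [d' IH]]; first by exists 0; exact: dif_cst.
by eexists; under eq_fun do rewrite exprS; apply: difM H IH.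
Qed.

Lemma dif_unique f z d d' : dif f z d -> dif f z d' -> d = d'.
Proof.
move=> H1 H2; apply/cabs_sub_eq0/eqP; rewrite eq_le cabs_ge0 andbT.
apply/ler_addgt0Pl => e e0; rewrite addr0.
have e20 : 0 < e / 2 by rewrite divr_gt0.
have [r r0 h1] := H1 _ e20; have [s s0 h2] := H2 _ e20.
pose t := Num.min r s / 2; have t0 : 0 < t by rewrite divr_gt0// lt_min r0.
have tlt : t < Num.min r s by rewrite /t ltr_pdivrMr// ltr_pMr ?lt_min ?r0// ltr1n.
have ct : cabs (z + t%:C%C - z) = t by rewrite addrC addKr cabsR gtr0_norm.
move: tlt; rewrite lt_min => /andP[tr ts].
have := h1 (z + t%:C%C); have := h2 (z + t%:C%C); rewrite ct => /(_ ts) k2 /(_ tr) k1.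
rewrite -(ler_pM2r t0) -[in leLHS]ct -cabsM.
have -> : (d - d') * (z + t%:C%C - z) =
  (f (z + t%:C%C) - f z - d' * (z + t%:C%C - z))
  - (f (z + t%:C%C) - f z - d * (z + t%:C%C - z)) by ring.
by apply: le_trans (ler_cabsB _ _) _; lra.
Qed.

End Differentiability.

(** * Goursat's theorem and the maximum principle *)

Section Subdivision.
Variable R : realType.

(** The left ends increase and stay below every right end, so their supremum lies in all the
    intervals. *)
Lemma nested_itv (w : R) (x : nat -> R) : 0 <= w ->
  (forall n, x n <= x n.+1 /\ x n.+1 + 2^-1 ^+ n.+1 * w <= x n + 2^-1 ^+ n * w) ->
  exists c : R, forall n, x n <= c <= x n + 2^-1 ^+ n * w.
Proof.
move=> w0 H.
have mono n k : x n <= x (n + k)%N /\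
    x (n + k)%N + 2^-1 ^+ (n + k) * w <= x n + 2^-1 ^+ n * w.
  elim: k => [|k [I1 I2]]; first by rewrite addn0.
  rewrite addnS; have [h1 h2] := H (n + k)%N; split; lra.
have p n : 0 <= 2^-1 ^+ n * w by rewrite mulr_ge0// exprn_ge0.
have ub n m : x m <= x n + 2^-1 ^+ n * w.
  case: (leqP n m) => [nm|/ltnW mn].
    have [_] := mono n (m - n)%N; rewrite subnKC//; have := p m; lra.
  have [+ _] := mono m (n - m)%N; rewrite subnKC//; have := p n; lra.
have hs : has_sup (range x).
  split; first by exists (x 0%N), 0%N.
  by exists (x 0%N + 2^-1 ^+ 0 * w) => _ [m _ <-].
exists (sup (range x)) => n; apply/andP; split.
  by apply: sup_upper_bound => //; exists n.
by apply: ge_sup; [exists (x 0%N), 0%N | move=> _ [m _ <-]].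
Qed.

Lemma half_expn_lt (e : R) : 0 < e -> exists n, 2^-1 ^+ n < e :> R.
Proof.
move=> e0; have [n _ /(_ n (leqnn _))/=] := near_infty_natSinv_expn_lt (PosNum e0).
by rewrite div1r => h; exists n; rewrite exprVn.
Qed.

(* Cousin's lemma: otherwise repeated halving shrinks to a point where the local
   hypothesis fails. The small rectangles are only those similar to the whole. *)
Lemma rect_induction (P : R -> R -> R -> R -> Prop) (a b c d : R) :
  a < b -> c < d ->
  (forall x0 x1 x2 y0 y1, a <= x0 -> x0 < x1 -> x1 < x2 -> x2 <= b ->
    c <= y0 -> y0 < y1 -> y1 <= d ->
    P x0 x1 y0 y1 -> P x1 x2 y0 y1 -> P x0 x2 y0 y1) ->
  (forall x0 x1 y0 y1 y2, a <= x0 -> x0 < x1 -> x1 <= b ->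
    c <= y0 -> y0 < y1 -> y1 < y2 -> y2 <= d ->
    P x0 x1 y0 y1 -> P x0 x1 y1 y2 -> P x0 x1 y0 y2) ->
  (forall x y, a <= x <= b -> c <= y <= d -> exists2 r, 0 < r &
    forall l x0 y0, 0 < l -> l < r ->
      a <= x0 -> x0 <= x -> x <= x0 + l * (b - a) -> x0 + l * (b - a) <= b ->
      c <= y0 -> y0 <= y -> y <= y0 + l * (d - c) -> y0 + l * (d - c) <= d ->
      P x0 (x0 + l * (b - a)) y0 (y0 + l * (d - c))) ->
  P a b c d.
Proof.
move=> ab cd Hx Hy Hloc; apply: contrapT => nP.
set w := b - a; set h := d - c.
have w0 : 0 < w by rewrite subr_gt0.
have h0 : 0 < h by rewrite subr_gt0.
pose l n : R := 2^-1 ^+ n.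
have l0 n : 0 < l n by rewrite exprn_gt0.
have lS n : l n = 2 * l n.+1 by rewrite /l exprS mulrA mulfV ?mul1r.
pose Bad n (p : R * R) := [/\ a <= p.1, p.1 + l n * w <= b, c <= p.2,
  p.2 + l n * h <= d & ~ P p.1 (p.1 + l n * w) p.2 (p.2 + l n * h)].
pose Sub n (p q : R * R) := [/\ p.1 <= q.1, q.1 + l n.+1 * w <= p.1 + l n * w,
  p.2 <= q.2 & q.2 + l n.+1 * h <= p.2 + l n * h].
(* Some quarter of a bad rectangle is bad, since gluing four good ones would make the whole good.
   The implication under the existential makes the statement total, as [choice] requires. *)
have step (np : nat * (R * R)) : exists q, Bad np.1 np.2 -> Bad np.1.+1 q /\ Sub np.1 np.2 q.
  case: np => n [x y] /=; apply: contrapT => nq.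
  have [B nE] : Bad n (x, y) /\ forall q, ~ (Bad n.+1 q /\ Sub n (x, y) q).
    split; first by apply: contrapT => nB; apply: nq; exists (0, 0).
    by move=> q Hq; apply: nq; exists q.
  case: B => /= B1 B2 B3 B4; apply.
  set lw := l n.+1 * w; set lh := l n.+1 * h.
  have lw0 : 0 < lw by rewrite mulr_gt0.
  have lh0 : 0 < lh by rewrite mulr_gt0.
  have elw : l n * w = 2 * lw by rewrite lS /lw; ring.
  have elh : l n * h = 2 * lh by rewrite lS /lh; ring.
  have Q q1 q2 : x <= q1 -> q1 + lw <= x + 2 * lw -> y <= q2 -> q2 + lh <= y + 2 * lh ->
      P q1 (q1 + lw) q2 (q2 + lh).
    move=> k1 k2 k3 k4; apply: contrapT => np; apply: (nE (q1, q2)).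
    rewrite elw elh in B2 B4.
    by split; [split=> //=; rewrite -/lw -/lh; lra|split => //=; rewrite -/lw -/lh ?elw ?elh].
  rewrite elw elh in B2 B4 *.
  apply: (Hy _ _ _ (y + lh)); try lra.
    apply: (Hx _ (x + lw)); try lra; first by apply: Q; lra.
    have -> : x + 2 * lw = (x + lw) + lw by lra.
    by apply: Q; lra.
  have -> : y + 2 * lh = (y + lh) + lh by lra.
  apply: (Hx _ (x + lw)); try lra; first by apply: Q; lra.
  have -> : x + 2 * lw = (x + lw) + lw by lra.
  by apply: Q; lra.
have [F HF] := choice step.
pose s := fix s n := if n is m.+1 then F (m, s m) else (a, c).
have Bs n : Bad n (s n).
  elim: n => [|n IH]; last by case: (HF (n, s n) IH).
  split => //=; rewrite /l expr0 ?mul1r /w /h ?[a + _]addrC ?[c + _]addrC ?subrK//.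
have Ss n : Sub n (s n) (s n.+1) by case: (HF (n, s n) (Bs n)).
have [x Hxx] := @nested_itv w (fun n => (s n).1) (ltW w0)
  (fun n => let: And4 h1 h2 _ _ := Ss n in conj h1 h2).
have [y Hyy] := @nested_itv h (fun n => (s n).2) (ltW h0)
  (fun n => let: And4 _ _ h1 h2 := Ss n in conj h1 h2).
have xI : a <= x <= b.
  have := Hxx 0%N; rewrite /= expr0 mul1r /w; lra.
have yI : c <= y <= d.
  have := Hyy 0%N; rewrite /= expr0 mul1r /h; lra.
have [r r0 Hr] := Hloc x y xI yI.
have [n ln] := half_expn_lt r0.
case: (Bs n) => b1 b2 b3 b4; apply.
have /andP[x1 x2] := Hxx n; have /andP[y1 y2] := Hyy n.
exact: Hr.
Qed.

(** The one-dimensional case, with an idle second side. If [P s t] is an equivalence between a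
    property at [s] and the same property at [t], this is a connectedness argument. *)
Lemma itv_induction (P : R -> R -> Prop) (a b : R) : a < b ->
  (forall x y z, a <= x -> x < y -> y < z -> z <= b -> P x y -> P y z -> P x z) ->
  (forall x, a <= x <= b -> exists2 r, 0 < r &
    forall s t, a <= s -> s <= x -> x <= t -> t <= b -> s < t -> t - s < r -> P s t) ->
  P a b.
Proof.
move=> ab H Hloc.
apply: (@rect_induction (fun x0 x1 _ _ => P x0 x1) a b 0 1) => //.
- by move=> x0 x1 x2 y0 y1 *; apply: (H _ x1).
- move=> x y /Hloc[r r0 Hr] _; exists (r / (b - a)); first by rewrite divr_gt0// subr_gt0.
  move=> l x0 y0 l0 lr; have p : 0 < l * (b - a) by rewrite mulr_gt0// subr_gt0.
  move: lr; rewrite ltr_pdivlMr ?subr_gt0// => lr *; apply: Hr => //; lra.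
Qed.

End Subdivision.

(** * Integrals of continuous functions over intervals *)

Section IntervalIntegral.
Variable R : realType.
Implicit Types (a b : R) (f g : R -> R).

Definition rcont a b f := forall x, a <= x <= b -> forall e : R, 0 < e ->
  exists2 r : R, 0 < r &
    forall y, a <= y <= b -> `|y - x| < r -> `|f y - f x| < e.

Definition rint a b f : R := (\int[lebesgue_measure]_(x in `[a, b]) f x)%R.

Lemma rcont_integrable a b f : rcont a b f ->
  (@lebesgue_measure R).-integrable `[a, b] (EFin \o f).
Proof.
move=> cf; apply: continuous_compact_integrable; first exact: segment_compact.
apply/subspace_continuousP => x /=; rewrite in_itv/= => xI.
apply/cvgrPdist_lt => e e0; have [r r0 H] := cf x xI e e0.
exists r => //= y; rewrite /ball/= distrC => xy; rewrite in_itv/= => yI.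
by rewrite distrC; apply: H.
Qed.

Lemma rcontS a b a' b' f : a <= a' -> b' <= b -> rcont a b f -> rcont a' b' f.
Proof.
move=> aa bb cf x /andP[h1 h2] e e0.
have [|r r0 H] := cf x _ e e0; first by rewrite (le_trans aa)// (le_trans h2).
by exists r => // y /andP[k1 k2] ?; apply: H => //; rewrite (le_trans aa)// (le_trans k2).
Qed.

Lemma rcont_cst a b (k : R) : rcont a b (fun=> k).
Proof. by move=> x _ e e0; exists 1 => // y _ _; rewrite subrr normr0. Qed.

Lemma rcontD a b f g : rcont a b f -> rcont a b g -> rcont a b (fun x => f x + g x).
Proof.
move=> cf cg x xI e e0; have e2 : 0 < e / 2 by rewrite divr_gt0.
have [r r0 H1] := cf x xI _ e2; have [s s0 H2] := cg x xI _ e2.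
exists (Num.min r s); first by rewrite lt_min r0.
move=> y yI; rewrite lt_min => /andP[/(H1 y yI) h1 /(H2 y yI) h2].
have -> : f y + g y - (f x + g x) = (f y - f x) + (g y - g x) by ring.
by apply: le_lt_trans (ler_normD _ _) _; lra.
Qed.

Lemma rcontZ a b f (k : R) : rcont a b f -> rcont a b (fun x => k * f x).
Proof.
move=> cf x xI e e0; have K0 : 0 < `|k| + 1 by rewrite ltr_wpDl.
have [r r0 H] := cf x xI (e / (`|k| + 1)) (divr_gt0 e0 K0).
exists r => // y yI /(H y yI); rewrite -mulrBr normrM ltr_pdivlMr//.
by have := normr_ge0 (f y - f x); nra.
Qed.

Lemma rcontB a b f g : rcont a b f -> rcont a b g -> rcont a b (fun x => f x - g x).
Proof.
move=> cf /(rcontZ (-1)) cg; have := rcontD cf cg.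
by congr rcont; apply/funext => x; rewrite mulN1r.
Qed.

Lemma rint_split a b f x : a <= x -> x <= b -> rcont a b f ->
  rint a b f = rint a x f + rint x b f.
Proof.
move=> ax xb cf; have := @Rintegral_itvB R f (BLeft a) (BRight b) x (rcont_integrable cf).
rewrite !bnd_simp => /(_ ax xb) h; rewrite /rint.
suff -> : (\int[lebesgue_measure]_(x0 in `[x, b]) f x0)%R =
  (\int[lebesgue_measure]_(x0 in `]x, b]) f x0)%R by rewrite -h addrCA subrr addr0.
rewrite -Rintegral_itv_obnd_cbnd//.
apply: integrableS (rcont_integrable cf) => //.
by apply: subset_itv; rewrite bnd_simp.
Qed.

Lemma rintB a b f g : rcont a b f -> rcont a b g ->
  rint a b (fun x => f x - g x) = rint a b f - rint a b g.
Proof. by move=> cf cg; apply: RintegralB => //; exact: rcont_integrable. Qed.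

Lemma rint_cst a b (k : R) : a <= b -> rint a b (fun=> k) = k * (b - a).
Proof.
move=> ab; rewrite /rint Rintegral_cst//.
suff h : lebesgue_measure (`[a, b]%classic : set R) = (b - a)%:E by rewrite [X in fine X]h.
  rewrite lebesgue_measure_itv/= lte_fin; case: ltP => // ba.
  by rewrite (_ : b - a = 0)//; apply/eqP; rewrite subr_eq0 eq_le ba ab.

Qed.

Lemma rint_le a b f g : rcont a b f -> rcont a b g ->
  (forall x, a <= x <= b -> f x <= g x) -> rint a b f <= rint a b g.
Proof.
by move=> cf cg fg; apply: le_Rintegral => //; exact: rcont_integrable.
Qed.

Lemma eq_rint a b f g : (forall x, a <= x <= b -> f x = g x) -> rint a b f = rint a b g.
Proof.
move=> fg; apply: eq_Rintegral => x; rewrite inE/= in_itv/=; exact: fg.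
Qed.

Lemma rint_dist a b f (k e : R) : a <= b -> rcont a b f ->
  (forall x, a <= x <= b -> `|f x - k| <= e) -> `|rint a b f - k * (b - a)| <= e * (b - a).
Proof.
move=> ab cf H; rewrite ler_distl -mulrDl -mulrBl -!(rint_cst _ ab).
by apply/andP; split; apply: rint_le => //; try exact: rcont_cst;
   move=> x /H; rewrite ler_distl => /andP[].
Qed.

End IntervalIntegral.


(** * Goursat's theorem for rectangles *)

Section Goursat.
Variable R : realType.
Local Notation C := R[i].
Implicit Types (f : C -> C).

Definition cplx (x y : R) : C := (x +i* y)%C.

Lemma cplxB (x y x' y' : R) : cplx x y - cplx x' y' = cplx (x - x') (y - y').
Proof. by []. Qed.

Lemma cReE (x y : R) : complex.Re (cplx x y) = x. Proof. by []. Qed.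
Lemma cImE (x y : R) : complex.Im (cplx x y) = y. Proof. by []. Qed.
Lemma cReB (z w : C) : complex.Re (z - w) = complex.Re z - complex.Re w.
Proof. by case: z w => [? ?] [? ?]. Qed.
Lemma cImB (z w : C) : complex.Im (z - w) = complex.Im z - complex.Im w.
Proof. by case: z w => [? ?] [? ?]. Qed.
Lemma cReD (z w : C) : complex.Re (z + w) = complex.Re z + complex.Re w.
Proof. by case: z w => [? ?] [? ?]. Qed.
Lemma cImD (z w : C) : complex.Im (z + w) = complex.Im z + complex.Im w.
Proof. by case: z w => [? ?] [? ?]. Qed.
Lemma cReM (z w : C) : complex.Re (z * w) =
  complex.Re z * complex.Re w - complex.Im z * complex.Im w.
Proof. by case: z w => [? ?] [? ?]. Qed.
Lemma cImM (z w : C) : complex.Im (z * w) =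
  complex.Re z * complex.Im w + complex.Im z * complex.Re w.
Proof. by case: z w => [? ?] [? ?]. Qed.

Lemma cReZ (x : R) (z : C) : complex.Re (x%:C%C * z) = x * complex.Re z.
Proof. by rewrite cReM mul0r subr0. Qed.

Lemma ccont_vert f (x c d : R) : (forall y, c <= y <= d -> ccont f (cplx x y)) ->
  rcont c d (fun y => complex.Re (f (cplx x y))) /\
  rcont c d (fun y => complex.Im (f (cplx x y))).
Proof.
move=> cf; split => y yI e e0; have [r r0 H] := cf y yI e e0; exists r => // y' _ hy;
  have {H}h : cabs (f (cplx x y') - f (cplx x y)) < e by apply: H;
    apply: le_lt_trans (cabs_leD _) _; rewrite cplxB/= subrr normr0 add0r.
- by apply: le_lt_trans h; rewrite -cReB ler_Re_cabs.
- by apply: le_lt_trans h; rewrite -cImB ler_Im_cabs.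
Qed.

Lemma ccont_hor f (y a b : R) : (forall x, a <= x <= b -> ccont f (cplx x y)) ->
  rcont a b (fun x => complex.Re (f (cplx x y))) /\
  rcont a b (fun x => complex.Im (f (cplx x y))).
Proof.
move=> cf; split => x xI e e0; have [r r0 H] := cf x xI e e0; exists r => // x' _ hy;
  have {H}h : cabs (f (cplx x' y) - f (cplx x y)) < e by apply: H;
    apply: le_lt_trans (cabs_leD _) _; rewrite cplxB/= subrr normr0 addr0.
- by apply: le_lt_trans h; rewrite -cReB ler_Re_cabs.
- by apply: le_lt_trans h; rewrite -cImB ler_Im_cabs.
Qed.

(* The difference of the two sides is additive under subdivision, and it is
   o(area) near each point because the identity is exact for affine functions. *)
Lemma goursat f (a b c d : R) : a < b -> c < d ->
  (forall x y, a <= x <= b -> c <= y <= d -> exists k, dif f (cplx x y) k) ->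
  rint c d (fun y => complex.Re (f (cplx b y)) - complex.Re (f (cplx a y))) =
  rint a b (fun x => complex.Im (f (cplx x d)) - complex.Im (f (cplx x c))).
Proof.
move=> ab cd Hf.
have cf x y : a <= x <= b -> c <= y <= d -> ccont f (cplx x y).
  by move=> hx hy; have [k /dif_cont] := Hf x y hx hy.
have cv x y0 y1 : a <= x <= b -> c <= y0 -> y1 <= d ->
    rcont y0 y1 (fun y => complex.Re (f (cplx x y))).
  move=> xI h0 h1; apply: (rcontS h0 h1).
  by have [] := @ccont_vert f x c d (fun y hy => cf x y xI hy).
have ch y x0 x1 : c <= y <= d -> a <= x0 -> x1 <= b ->
    rcont x0 x1 (fun x => complex.Im (f (cplx x y))).
  move=> yI h0 h1; apply: (rcontS h0 h1).
  by have [] := @ccont_hor f y a b (fun x hx => cf x y hx yI).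
(* [J] is the imaginary part of the contour integral of [f] along the boundary of the rectangle. *)
pose J a b c d := rint c d (fun y => complex.Re (f (cplx b y)) - complex.Re (f (cplx a y)))
  - rint a b (fun x => complex.Im (f (cplx x d)) - complex.Im (f (cplx x c))).
have JE x0 x1 y0 y1 : a <= x0 <= b -> a <= x1 <= b -> c <= y0 <= d -> c <= y1 <= d ->
    J x0 x1 y0 y1 = rint y0 y1 (fun y => complex.Re (f (cplx x1 y)))
      - rint y0 y1 (fun y => complex.Re (f (cplx x0 y)))
      - (rint x0 x1 (fun x => complex.Im (f (cplx x y1)))
      - rint x0 x1 (fun x => complex.Im (f (cplx x y0)))).
  move=> h1 h2 h3 h4; have /andP[? ?] := h1; have /andP[? ?] := h2.
  have /andP[? ?] := h3; have /andP[? ?] := h4.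
  by rewrite /J !rintB//; (apply: cv || apply: ch).
have mid (p q r s : R) : p <= q -> q < r -> r <= s -> (p <= q <= s) * (p <= r <= s).
  move=> pq qr rs; have pr := le_trans pq (ltW qr); have qs := le_trans (ltW qr) rs.
  by rewrite pq qs pr rs.
apply/eqP; rewrite -subr_eq0 -normr_eq0 eq_le normr_ge0 andbT -/(J a b c d).
apply/ler_addgt0Pl => e e0; rewrite addr0.
set w := b - a; set h := d - c.
have w0 : 0 < w by rewrite subr_gt0.
have h0 : 0 < h by rewrite subr_gt0.
pose eta := e / (w * h).
have eta0 : 0 < eta by rewrite divr_gt0// mulr_gt0.
suff : `|J a b c d| <= eta * ((b - a) * (d - c)).
  by rewrite -/w -/h /eta mulfVK// mulf_neq0// gt_eqF.
apply: (@rect_induction _ (fun x0 x1 y0 y1 =>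
  `|J x0 x1 y0 y1| <= eta * ((x1 - x0) * (y1 - y0))) a b c d) => //.
- move=> x0 x1 x2 y0 y1 ax0 x01 x12 x2b cy0 y01 y1d.
  have [x0I x2I] := mid _ _ _ _ ax0 (lt_trans x01 x12) x2b.
  have [_ x1I] := mid _ _ _ _ ax0 x01 (le_trans (ltW x12) x2b).
  have [y0I y1I] := mid _ _ _ _ cy0 y01 y1d.
  have -> : J x0 x2 y0 y1 = J x0 x1 y0 y1 + J x1 x2 y0 y1.
    have s y : c <= y <= d -> rint x0 x2 (fun x => complex.Im (f (cplx x y))) =
        rint x0 x1 (fun x => complex.Im (f (cplx x y))) +
        rint x1 x2 (fun x => complex.Im (f (cplx x y))).
      by move=> hy; apply: rint_split; [exact: ltW|exact: ltW|exact: ch].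
    rewrite !JE// !s//; ring.
  by move=> P1 P2; apply: le_trans (ler_normD _ _) _; apply: le_trans (lerD P1 P2) _; lra.
- move=> x0 x1 y0 y1 y2 ax0 x01 x1b cy0 y01 y12 y2d.
  have [x0I x1I] := mid _ _ _ _ ax0 x01 x1b.
  have [y0I y2I] := mid _ _ _ _ cy0 (lt_trans y01 y12) y2d.
  have [_ y1I] := mid _ _ _ _ cy0 y01 (le_trans (ltW y12) y2d).
  have -> : J x0 x1 y0 y2 = J x0 x1 y0 y1 + J x0 x1 y1 y2.
    have s x : a <= x <= b -> rint y0 y2 (fun y => complex.Re (f (cplx x y))) =
        rint y0 y1 (fun y => complex.Re (f (cplx x y))) +
        rint y1 y2 (fun y => complex.Re (f (cplx x y))).
      by move=> hx; apply: rint_split; [exact: ltW|exact: ltW|exact: cv].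
    rewrite !JE// !s//; ring.
  by move=> P1 P2; apply: le_trans (ler_normD _ _) _; apply: le_trans (lerD P1 P2) _; lra.
move=> x y xI yI; have [k Hk] := Hf x y xI yI.
(* On a rectangle of scale [l] the two side integrals are off by [2 * E] times the half-perimeter,
   that is by [2 * ee * (l * (w + h)) ^+ 2]; with this [ee] it is exactly [eta] times the area. *)
pose ee := eta * (w * h) / (2 * (w + h) ^+ 2).
have wh0 : 0 < w + h by rewrite addr_gt0.
have ee0 : 0 < ee by apply: divr_gt0; [exact: mulr_gt0 (mulr_gt0 w0 h0)|exact: mulr_gt0 (exprn_gt0 _ _)].
have [r r0 Hr] := Hk ee ee0.
exists (r / (w + h)); first by rewrite divr_gt0.
move=> l x0 y0 l0; rewrite ltr_pdivlMr// => lr h1 h2 h3 h4 h5 h6 h7 h8.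
set x1 := x0 + _ in h3 h4 *; set y1 := y0 + _ in h7 h8 *.
have lw : 0 < l * w by rewrite mulr_gt0.
have lh : 0 < l * h by rewrite mulr_gt0.
have near s t : x0 <= s <= x1 -> y0 <= t <= y1 ->
    `|complex.Re (f (cplx s t)) - complex.Re (f (cplx x y))
      - (complex.Re k * (s - x) - complex.Im k * (t - y))| <= ee * (l * (w + h)) /\
    `|complex.Im (f (cplx s t)) - complex.Im (f (cplx x y))
      - (complex.Re k * (t - y) + complex.Im k * (s - x))| <= ee * (l * (w + h)).
  move=> sI tI; have D : cabs (cplx s t - cplx x y) <= l * (w + h).
    apply: le_trans (cabs_leD _) _; rewrite /= mulrDr lerD// ler_norml.
      by move: sI h2 h3; rewrite /x1 -/w; lra.
    by move: tI h6 h7; rewrite /y1 -/h; lra.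
  have := Hr (cplx s t) (le_lt_trans D lr) => H.
  have {}H := le_trans H (ler_wpM2l (ltW ee0) D).
  split; apply: le_trans H.
    by apply: le_trans (ler_Re_cabs _); rewrite !cReB cReM.
  by apply: le_trans (ler_Im_cabs _); rewrite !cImB cImM.
have x01 : x0 <= x1 by rewrite /x1 -/w lerDl ltW.
have y01 : y0 <= y1 by rewrite /y1 -/h lerDl ltW.
set E := ee * (l * (w + h)) in near.
have lx0 : x0 <= x0 <= x1 by rewrite lexx.
have lx1 : x0 <= x1 <= x1 by rewrite lexx x01.
have ly0 : y0 <= y0 <= y1 by rewrite lexx.
have ly1 : y0 <= y1 <= y1 by rewrite lexx y01.
have x0I : a <= x0 <= b by rewrite h1 (le_trans x01).
have x1I : a <= x1 <= b by rewrite (le_trans h1).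
have y0I : c <= y0 <= d by rewrite h5 (le_trans y01).
have y1I : c <= y1 <= d by rewrite (le_trans h5).
have B1 : `|rint y0 y1 (fun t => complex.Re (f (cplx x1 t)) - complex.Re (f (cplx x0 t)))
   - complex.Re k * (x1 - x0) * (y1 - y0)| <= 2 * E * (y1 - y0).
  apply: rint_dist => //; first by apply: rcontB; exact: cv.
  move=> t tI; have [/ler_normlP[+ +] _] := near x1 t lx1 tI.
  have [/ler_normlP[+ +] _] := near x0 t lx0 tI.
  clear => ? ? ? ?; apply/ler_normlP; split; lra.
have B2 : `|rint x0 x1 (fun s => complex.Im (f (cplx s y1)) - complex.Im (f (cplx s y0)))
   - complex.Re k * (y1 - y0) * (x1 - x0)| <= 2 * E * (x1 - x0).
  apply: rint_dist => //; first by apply: rcontB; exact: ch.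
  move=> s sI; have [_ /ler_normlP[+ +]] := near s y1 sI ly1.
  have [_ /ler_normlP[+ +]] := near s y0 sI ly0.
  clear => ? ? ? ?; apply/ler_normlP; split; lra.
have {B1}/ler_normlP[B1 B1'] := B1; have {B2}/ler_normlP[B2 B2'] := B2.
have -> : eta * ((x1 - x0) * (y1 - y0)) = 2 * E * (y1 - y0) + 2 * E * (x1 - x0).
  rewrite /E /ee /x1 /y1 -/w -/h; field; by rewrite gt_eqF.
clear -B1 B1' B2 B2'; rewrite /J; apply/ler_normlP; split; lra.
Qed.

End Goursat.

(** * Compactness of closed discs *)

Section DiscCompactness.
Variable R : realType.
Local Notation C := R[i].

(** Heine-Borel as an induction principle, so that no subcover has to be handled. It is bisection of
    a square around the disc; the half-side [r + 1] keeps the square nondegenerate for [r = 0]. *)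
Lemma closed_disc_induction (P : set C -> Prop) (a : C) (r : R) : 0 <= r ->
  (forall A B, A `<=` B -> P B -> P A) ->
  (forall A B, P A -> P B -> P (A `|` B)) ->
  (forall p, cabs (p - a) <= r -> exists2 s, 0 < s & P [set u | cabs (u - p) < s]) ->
  P [set u | cabs (u - a) <= r].
Proof.
move=> r0 PS PU Ploc.
pose Q x0 x1 y0 y1 := P [set u | cabs (u - a) <= r /\
  (x0 <= complex.Re u <= x1 /\ y0 <= complex.Im u <= y1)].
have H : Q (complex.Re a - (r + 1)) (complex.Re a + (r + 1)) (complex.Im a - (r + 1)) (complex.Im a + (r + 1)).
  apply: rect_induction; [lra|lra| | |].
  - move=> x0 x1 x2 y0 y1 _ _ _ _ _ _ _ P1 P2; apply: PS (PU _ _ P1 P2) => u [ur [/andP[h1 h2] h3]].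
    by case: (leP (complex.Re u) x1) => h; [left|right]; split => //; split => //; apply/andP; split => //; exact: ltW.
  - move=> x0 x1 y0 y1 y2 _ _ _ _ _ _ _ P1 P2; apply: PS (PU _ _ P1 P2) => u [ur [h3 /andP[h1 h2]]].
    by case: (leP (complex.Im u) y1) => h; [left|right]; split => //; split => //; apply/andP; split => //; exact: ltW.
  move=> x y _ _; pose p := cplx x y.
  have [s s0 Hs] : exists2 s, 0 < s & P [set u | cabs (u - a) <= r /\ cabs (u - p) < s].
    have [pr|pr] := leP (cabs (p - a)) r.
      have [s s0 Hs] := Ploc p pr; exists s => //; apply: PS Hs => u [_ //].
    (* Off the disc the local set is empty, and [P] of the empty set follows from [P] near [a]. *)
    exists (cabs (p - a) - r); first by rewrite subr_gt0.
    have [s s0 Hs] := Ploc a ltac:(by rewrite subrr cabs0).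
    apply: PS Hs => u [h1 h2]; exfalso; have := cabs_triangle p u a.
    by rewrite (cabsB p u); lra.
  set W := complex.Re a + (r + 1) - (complex.Re a - (r + 1)); set H := complex.Im a + (r + 1) - (complex.Im a - (r + 1)).
  have W0 : 0 < W by rewrite /W; lra.
  have H0 : 0 < H by rewrite /H; lra.
  exists (s / (W + H)); first by rewrite divr_gt0// addr_gt0.
  have WH0 : 0 < W + H by rewrite addr_gt0.
  move=> l x0 y0 l0 ls _ h1 h2 _ _ h3 h4 _.
  move: ls; rewrite (ltr_pdivlMr _ _ WH0) mulrDr => ls.
  apply: PS Hs => u [ur [/andP[k1 k2] /andP[k3 k4]]]; split => //.
  apply: le_lt_trans (cabs_leD _) _; apply: le_lt_trans ls.
  rewrite cReB cImB [complex.Re p]/= [complex.Im p]/=; clear -h1 h2 h3 h4 k1 k2 k3 k4.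
  by apply: lerD; apply/ler_normlP; split; lra.
apply: PS H => u ur; split => //.
have h1 := le_trans (ler_Re_cabs _) ur; have h2 := le_trans (ler_Im_cabs _) ur.
move: h1 h2; rewrite cReB cImB => /ler_normlP[h1 h1'] /ler_normlP[h2 h2'].
by split; apply/andP; split; lra.
Qed.

Lemma closed_disc_max (phi : C -> R) (a : C) (r : R) : 0 <= r ->
  (forall p, cabs (p - a) <= r -> forall e, 0 < e -> exists2 s, 0 < s &
    forall u, cabs (u - p) < s -> `|phi u - phi p| < e) ->
  exists2 p, cabs (p - a) <= r & forall u, cabs (u - a) <= r -> phi u <= phi p.
Proof.
move=> r0 cphi.
pose P (A : set C) := exists2 p, cabs (p - a) <= r &
  forall u, A u -> cabs (u - a) <= r -> phi u <= phi p.
have [||p pr|p pr H] := @closed_disc_induction P a r r0.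
- by move=> A B AB [p pr Hp]; exists p => // u /AB; apply: Hp.
- move=> A B [p pr Hp] [q qr Hq]; case: (leP (phi p) (phi q)) => h; [exists q|exists p] => //.
    by move=> u [uA|uB] ur; [apply: le_trans (Hp u uA ur) h|exact: Hq].
  by move=> u [uA|uB] ur; [exact: Hp|apply: le_trans (Hq u uB ur) (ltW h)].
(* Either some [q] exceeds [p], and then by continuity all points near [p], or [p] is already a
   maximum. *)
- have [[q qr pq]|nq] := pselect (exists2 q, cabs (q - a) <= r & phi p < phi q).
    have [|s s0 Hs] := cphi p pr (phi q - phi p); first by rewrite subr_gt0.
    exists s => //; exists q => // u /Hs /ltr_normlP[_] h _; lra.
  exists 1 => //; exists p => // u _ ur; rewrite leNgt; apply/negP => h.
  by apply: nq; exists u.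
by exists p => // u ur; apply: H.
Qed.

End DiscCompactness.

(** * The complex exponential *)

Section ComplexExponential.
Variable R : realType.
Local Notation C := R[i].

Definition cexp (z : C) : C :=
  cplx (expR (complex.Re z) * cos (complex.Im z)) (expR (complex.Re z) * sin (complex.Im z)).

Lemma cexpD z w : cexp (z + w) = cexp z * cexp w.
Proof.
case: z w => [x y] [s t]; rewrite /cexp /cplx /= expRD cosD sinD.
by apply/eqP; rewrite eq_complex /=; apply/andP; split; apply/eqP; ring.
Qed.

Lemma cexp0 : cexp 0 = 1.
Proof. by rewrite /cexp /= expR0 cos0 sin0 mulr1 mulr0. Qed.

Lemma cabs_cexp z : cabs (cexp z) = expR (complex.Re z).
Proof.
by rewrite cabsE /= !exprMn -mulrDr cos2Dsin2 mulr1 sqrtr_sqr ger0_norm// expR_ge0.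
Qed.

Lemma cexp_neq0 z : cexp z != 0.
Proof. by rewrite -cabs_gt0 cabs_cexp expR_gt0. Qed.

Lemma cexpN z : cexp (- z) = (cexp z)^-1.
Proof.
by apply: (mulfI (cexp_neq0 z)); rewrite -cexpD subrr cexp0 mulfV// cexp_neq0.
Qed.

Lemma cexpB z w : cexp (z - w) = cexp z / cexp w.
Proof. by rewrite cexpD cexpN. Qed.

Lemma cexp_period x y : cexp (cplx x (y + pi *+ 2)) = cexp (cplx x y).
Proof. by rewrite /cexp /= cosD2pi sinD2pi. Qed.

Lemma is_derive_eps (f : R -> R) (x d : R) : is_derive x 1 f d ->
  forall e : R, 0 < e -> exists2 r : R, 0 < r &
  forall h, `|h| < r -> `|f (x + h) - f x - d * h| <= e * `|h|.
Proof.
move=> Hd e e0; have [dv Hv] := (@ex_derive _ _ _ _ _ _ _ Hd, @derive_val _ _ _ _ _ _ _ Hd).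
have := dv; rewrite /derivable => /cvg_ex[l Hl].
have ld : l = d by rewrite -Hv; symmetry; apply/cvg_lim.
move: Hl; rewrite ld => /cvgrPdist_le /(_ e e0).
rewrite near_withinE => -[r /= r0 Hr]; exists r => // h hr.
have [->|h0] := eqVneq h 0; first by rewrite addr0 subrr mulr0 subrr normr0 mulr0.
have := Hr h; rewrite /ball/= sub0r normrN => /(_ hr h0).
rewrite distrC /GRing.scale/= mulr1 => H.
have -> : f (x + h) - f x - d * h = (h^-1 * (f (h + x) - f x) - d) * h.
  by rewrite [h + x]addrC; field.
by rewrite normrM ler_wpM2r.
Qed.

Lemma dif_cexp0 : dif cexp 0 1.
Proof.
apply: (@dif_weak _ _ _ _ 10) => // e e0.
have [r1 r10 H1] := @is_derive_eps (@expR R) 0 _ (is_derive_expR 0) e e0.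
have [r2 r20 H2] := @is_derive_eps (@cos R) 0 _ (is_derive_cos 0) e e0.
have [r3 r30 H3] := @is_derive_eps (@sin R) 0 _ (is_derive_sin 0) e e0.
have [r4 r40 H4] := @is_derive_eps (@expR R) 0 _ (is_derive_expR 0) 1 ltr01.
exists (Num.min (Num.min (Num.min r1 r2) (Num.min r3 r4)) (Num.min (e / 2) 2^-1)).
  rewrite !lt_min r10 r20 r30 r40 /=; apply/andP; split; lra.
move=> u; rewrite !lt_min subr0.
move=> /andP[/andP[/andP[u1 u2] /andP[u3 u4]] /andP[ue u5]].
have := ler_Re_cabs u; have := ler_Im_cabs u.
rewrite cexp0; rewrite mul1r; have := cabs_leD (cexp u - 1 - u).
rewrite !cReB !cImB [complex.Re 1]/= [complex.Im 1]/= /cexp [complex.Re (cplx _ _)]/= [complex.Im (cplx _ _)]/=.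
move: u1 u2 u3 u4 ue u5; rewrite subr0.
set x := complex.Re u; set y := complex.Im u; set N := cabs u.
move=> u1 u2 u3 u4 ue u5 + Iy Rx.
have := H1 x (le_lt_trans Rx u1); rewrite add0r expR0 mul1r.
have := H2 y (le_lt_trans Iy u2); rewrite add0r cos0 sin0 oppr0 mul0r subr0.
have := H3 y (le_lt_trans Iy u3); rewrite add0r sin0 cos0 mul1r subr0.
have := H4 x (le_lt_trans Rx u4); rewrite add0r expR0 mul1r.
have cm := cos_max y.
have N0 : 0 <= N by exact: cabs_ge0.
clear H1 H2 H3 H4 u1 u2 u3 u4 r10 r20 r30 r40 r1 r2 r3 r4.
set E := expR x => h4 h3 h2 h1 LL.
have E1 : `|E - 1| <= 2 * N.
  by have := ler_normD (E - 1 - x) x; rewrite subrK; clear -h4 Rx; lra.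
have E2 : `|E| <= 2.
  by have := ler_normD (E - 1) 1; rewrite subrK normr1; clear -E1 u5; lra.
apply: le_trans LL _.
have -> : E * cos y - 1 - x = (E - 1 - x) * cos y + (1 + x) * (cos y - 1) by ring.
have -> : E * sin y - y = E * (sin y - y) + (E - 1) * y by ring.
have eN : 0 <= e * N by rewrite mulr_ge0// ltW.
have e1 : e * `|x| <= e * N by rewrite ler_wpM2l// ltW.
have e2 : e * `|y| <= e * N by rewrite ler_wpM2l// ltW.
have a1 : `|(E - 1 - x) * cos y| <= e * N.
  rewrite normrM -[leRHS]mulr1; apply: ler_pM => //; exact: le_trans e1.
have a2 : `|(1 + x) * (cos y - 1)| <= 2 * (e * N).
  rewrite normrM; apply: ler_pM => //; last exact: le_trans e2.
  by apply: le_trans (ler_normD _ _) _; rewrite normr1; lra.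
have a3 : `|E * (sin y - y)| <= 2 * (e * N).
  rewrite normrM; apply: ler_pM => //; exact: le_trans e2.
have a4 : `|(E - 1) * y| <= e * N.
  rewrite normrM; apply: ler_pM => //; lra.
have := ler_normD ((E - 1 - x) * cos y) ((1 + x) * (cos y - 1)).
have := ler_normD (E * (sin y - y)) ((E - 1) * y).
by clear -a1 a2 a3 a4 eN; lra.
Qed.

Lemma dif_cexp z : dif cexp z (cexp z).
Proof.
apply: (@dif_weak _ _ _ _ (cabs (cexp z))); first by rewrite cabs_gt0 cexp_neq0.
move=> e e0; have [r r0 H] := dif_cexp0 e0; exists r => // u ur.
have := H (u - z); rewrite subr0 cexp0 mul1r => /(_ ur) h.
have -> : cexp u - cexp z - cexp z * (u - z) = cexp z * (cexp (u - z) - 1 - (u - z)).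
  by rewrite cexpB; have := cexp_neq0 z; move=> ?; field.
by rewrite cabsM -mulrA ler_wpM2l ?cabs_ge0.
Qed.

End ComplexExponential.

(** * Mean value property and maximum principle *)

Section MaximumModulus.
Variable R : realType.
Local Notation C := R[i].
Implicit Types (f h : C -> C).

Definition hol f (a : C) (r : R) := forall u, cabs (u - a) < r -> exists k, dif f u k.

(* Goursat's theorem for [f (a + exp zeta)] on the rectangles with sides at real
   parts [s] and [x], as [s] tends to -oo. *)
Lemma mean_value f (a : C) (r x : R) : hol f a r -> expR x < r ->
  rint 0 (pi *+ 2) (fun t => complex.Re (f (a + cexp (cplx x t)))) =
  complex.Re (f a) * (pi *+ 2).
Proof.
move=> Hf xr; set T := pi *+ 2 : R.
have T0 : 0 < T by rewrite pmulrn_rgt0// pi_gt0.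
pose g z := f (a + cexp z).
have Hg s t : s <= x -> exists k, dif g (cplx s t) k.
  move=> sx; have [|k Hk] := Hf (a + cexp (cplx s t)).
    by rewrite addrAC subrr add0r cabs_cexp /=; apply: le_lt_trans xr; rewrite ler_expR.
  by exists (k * (0 + cexp (cplx s t))); exact: (dif_comp (difD (dif_cst a _) (dif_cexp _)) Hk).
have cg s : s <= x -> rcont 0 T (fun t => complex.Re (g (cplx s t))).
  move=> sx; have [] := @ccont_vert _ g s 0 T => // y _.
  by have [k /dif_cont] := Hg s y sx.
(* The horizontal sides, a period apart, cancel; this leaves equal integrals over the two vertical
   sides. *)
have E s : s < x -> rint 0 T (fun t => complex.Re (g (cplx x t))) =
                    rint 0 T (fun t => complex.Re (g (cplx s t))).
  move=> sx; have Z : rint s x (fun p => complex.Im (g (cplx p T)) - complex.Im (g (cplx p 0))) = 0.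
    transitivity (rint s x (fun=> 0)); last by rewrite rint_cst ?mul0r// ltW.
    by apply: eq_rint => p _; rewrite /g -[T]add0r cexp_period subrr.
  apply/eqP; rewrite -subr_eq0 -(rintB (cg x (lexx x)) (cg s (ltW sx))); apply/eqP.
  by apply: etrans Z; apply: goursat => // p q /andP[_ px] _; exact: Hg.
apply/eqP; rewrite -subr_eq0 -normr_eq0 eq_le normr_ge0 andbT.
apply/ler_addgt0Pl => e e0; rewrite addr0 -/T.
have [|k /dif_cont cfa] := Hf a.
  by rewrite subrr cabs0; apply: lt_trans xr; exact: expR_gt0.
have eT : 0 < e / T by rewrite divr_gt0.
have [d d0 Hd] := cfa _ eT.
pose s := Num.min (x - 1) (ln (d / 2)).
have sx : s < x by rewrite /s gt_min gtrBl ltr01.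
have sd : expR s < d.
  apply: (@le_lt_trans _ _ (d / 2)); last by rewrite ltr_pdivrMr// ltr_pMr// ltr1n.
  by rewrite -[leRHS]lnK ?posrE ?divr_gt0// ler_expR /s ge_min lexx orbT.
have := E s sx; rewrite {1}/g => ->.
have -> : e = e / T * (T - 0) by rewrite subr0 mulfVK// gt_eqF.
rewrite -{2}[T]subr0; apply: rint_dist; [exact: ltW|exact: cg (ltW sx)|].
move=> t _; rewrite -cReB; apply: le_trans (ler_Re_cabs _) _; apply/ltW/Hd.
by rewrite addrAC subrr add0r cabs_cexp.
Qed.

(* [`|h| ^+ 2 + e * `|u - a| ^+ 2] has, by the mean value property, no interior
   maximum where [h] is holomorphic; at a zero of [h] the bound is trivial. *)
Lemma max_modulus h (a : C) (r M : R) : 0 < r ->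
  (forall u, cabs (u - a) <= r -> ccont h u) ->
  (forall u, cabs (u - a) < r -> h u != 0 -> exists2 s, 0 < s & hol h u s) ->
  (forall u, cabs (u - a) = r -> cabs (h u) <= M) ->
  forall u, cabs (u - a) <= r -> cabs (h u) <= M.
Proof.
move=> r0 ch Hh Hb u0 u0r.
have M0 : 0 <= M.
  by apply: le_trans (cabs_ge0 _) (Hb (a + r%:C%C) _); rewrite addrAC subrr add0r cabsR gtr0_norm.
suff S e : 0 < e -> cabs (h u0) ^+ 2 <= M ^+ 2 + e * r ^+ 2.
  rewrite -(@ler_pXn2r _ 2) ?nnegrE ?cabs_ge0//.
  apply/ler_addgt0Pr => e e0; have := S (e / r ^+ 2) ltac:(by rewrite divr_gt0// exprn_gt0).
  by rewrite mulfVK// gt_eqF// exprn_gt0.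
move=> e0; pose phi u := cabs (h u) ^+ 2 + e * cabs (u - a) ^+ 2.
have [|p pr Hp] := @closed_disc_max _ phi a r (ltW r0).
  move=> p pr d d0.
  have sq (x y : R) (b d' : R) : 0 <= x -> `|y - x| <= b -> b <= 1 ->
      b * (2 * x + 1) <= d' -> `|y ^+ 2 - x ^+ 2| <= d'.
    move=> x0 xb b1 bd; apply: le_trans bd; rewrite subr_sqr normrM.
    apply: ler_pM => //; have := ler_normD (y - x) (2 * x).
    have -> : y - x + 2 * x = y + x by ring.
    by rewrite (ger0_norm (mulr_ge0 _ x0))//; lra.
  pose b1 := Num.min 1 (d / 3 / (2 * cabs (h p) + 1)).
  pose b2 := Num.min 1 (d / (3 * e) / (2 * cabs (p - a) + 1)).
  have k1 : 0 < 2 * cabs (h p) + 1 by rewrite ltr_wpDl// mulr_ge0 ?cabs_ge0.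
  have k2 : 0 < 2 * cabs (p - a) + 1 by rewrite ltr_wpDl// mulr_ge0 ?cabs_ge0.
  have b10 : 0 < b1 by rewrite lt_min ltr01 !divr_gt0.
  have b20 : 0 < b2 by rewrite lt_min ltr01 !divr_gt0// mulr_gt0.
  have [s s0 Hs] := ch p pr _ b10.
  exists (Num.min s b2); first by rewrite lt_min s0.
  move=> u; rewrite lt_min => /andP[/Hs h1 h2].
  have A : `|cabs (h u) ^+ 2 - cabs (h p) ^+ 2| <= d / 3.
    apply: (sq _ _ b1); first exact: cabs_ge0.
    - rewrite ler_norml; have := ler_sub_cabs (h u) (h p); have := ler_sub_cabs (h p) (h u).
      by rewrite [cabs (h p - _)]cabsB; clear -h1; lra.
    - by rewrite ge_min lexx.
    - by rewrite -ler_pdivlMr// ge_min lexx orbT.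
  have B : `|cabs (u - a) ^+ 2 - cabs (p - a) ^+ 2| <= d / (3 * e).
    apply: (sq _ _ b2); first exact: cabs_ge0.
    - rewrite ler_norml; have := cabs_triangle u p a; have := cabs_triangle p u a.
      by rewrite [cabs (p - u)]cabsB; clear -h2; lra.
    - by rewrite ge_min lexx.
    - by rewrite -ler_pdivlMr// ge_min lexx orbT.
  have -> : phi u - phi p = cabs (h u) ^+ 2 - cabs (h p) ^+ 2
      + e * (cabs (u - a) ^+ 2 - cabs (p - a) ^+ 2) by rewrite /phi; ring.
  apply: le_lt_trans (ler_normD _ _) _; rewrite normrM (gtr0_norm e0).
  apply: (@le_lt_trans _ _ (d / 3 + e * (d / (3 * e)))).
    by apply: lerD => //; rewrite ler_wpM2l// ltW.
  have -> : e * (d / (3 * e)) = d / 3 by field; rewrite gt_eqF.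
  by clear -d0; lra.
apply: (@le_trans _ _ (phi u0)); first by rewrite lerDl mulr_ge0 ?(ltW e0)// sqr_ge0.
apply: le_trans (Hp u0 u0r) _; rewrite /phi.
move: (pr); rewrite le_eqVlt => /orP[/eqP pe|plt].
  by rewrite pe lerD2r ler_pXn2r ?nnegrE ?cabs_ge0// Hb.
have [hp0|hp0] := eqVneq (h p) 0.
  rewrite hp0 cabs0 expr0n add0r; apply: ler_wpDl; first exact: sqr_ge0.
  by rewrite ler_pM2l// ler_pXn2r ?nnegrE ?cabs_ge0 ?(ltW r0).
exfalso; have [s s0 Hs] := Hh p plt hp0.
pose rho := Num.min s (r - cabs (p - a)).
have rho0 : 0 < rho by rewrite lt_min s0 subr_gt0.
pose x := ln (rho / 2).
have ex : expR x = rho / 2 by rewrite lnK// posrE divr_gt0.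
have exr : expR x < rho by rewrite ex ltr_pdivrMr// ltr_pMr// ltr1n.
(* The function [k] linearises [phi] at its maximum [p]. By [2 * Re (q * h v) <= |h p| ^+ 2 + |h v|
   ^+ 2] and [phi v <= phi p], its real part on a small circle about [p] is at most
   [c - e * expR x ^+ 2 / 2], whereas its mean there is [Re (k p) = c]. *)
pose q := (h p)^*%C; pose b := (p - a)^*%C.
pose k v := q * h v + e%:C%C * b * (v - p).
have Hk : hol k p s.
  move=> v /Hs[d Hd]; exists (q * d + e%:C%C * b * (1 - 0)).
  by apply: difD; [exact: difZ|apply: difZ; apply: difB (dif_id _) (dif_cst _ _)].
have := mean_value Hk (lt_le_trans exr _); rewrite ge_min lexx => /(_ isT).
have qh v : complex.Re (q * h v) <= (cabs (h p) ^+ 2 + cabs (h v) ^+ 2) / 2.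
  rewrite /q cReM !sqr_cabs; case: (h p) => α β /=; case: (h v) => γ δ /=.
  have := sqr_ge0 (α - γ); have := sqr_ge0 (β - δ); rewrite !sqrrB; lra.
have -> : complex.Re (k p) = cabs (h p) ^+ 2.
  rewrite /k subrr mulr0 addr0 /q cReM sqr_cabs; case: (h p) => α β /=; ring.
set T := pi *+ 2 : R; have T0 : 0 < T by rewrite pmulrn_rgt0// pi_gt0.
set c := cabs (h p) ^+ 2 => Eq.
have : rint 0 T (fun t => complex.Re (k (p + cexp (cplx x t)))) <=
       rint 0 T (fun=> c - e * expR x ^+ 2 / 2).
  apply: rint_le; [|exact: rcont_cst|].
    have [] := @ccont_vert _ (fun z => k (p + cexp z)) x 0 T => // y _.
    have [|d Hd] := Hk (p + cexp (cplx x y)).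
      rewrite addrAC subrr add0r cabs_cexp /=; apply: lt_le_trans exr _.
      by rewrite ge_min lexx.
    have : dif (fun z => p + cexp z) (cplx x y) (0 + cexp (cplx x y)).
      by apply: difD (dif_cst _ _) (dif_cexp _).
    by move=> /dif_comp/(_ Hd)/dif_cont.
  move=> t _; set w := cexp (cplx x t); set v := p + w.
  have cw : cabs w = expR x by rewrite cabs_cexp.
  have va : cabs (v - a) <= r.
    have := ler_cabsD (p - a) w; have -> : p - a + w = v - a by rewrite /v; ring.
    move: exr; rewrite lt_min cw => /andP[_ + +]; clear; lra.
  have {va} := Hp v va; rewrite /phi -/c => H.
  have := qh v; rewrite -/c => H2.
  have H3 : cabs (v - a) ^+ 2 = cabs (p - a) ^+ 2 + 2 * complex.Re (b * w) + expR x ^+ 2.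
    have -> : v - a = (p - a) + w by rewrite /v; ring.
    rewrite -cw !sqr_cabs cReM cReD cImD.
    have -> : complex.Re b = complex.Re (p - a) by rewrite /b; case: (p - a).
    have -> : complex.Im b = - complex.Im (p - a) by rewrite /b; case: (p - a).
    ring.
  have -> : complex.Re (k v) = complex.Re (q * h v) + e * complex.Re (b * w).
    rewrite /k (_ : e%:C%C * b * (v - p) = e%:C%C * (b * w)); last by rewrite /v; ring.
    by rewrite cReD cReZ.
  move: H; rewrite H3 mulrDr mulrDr; move: H2; clear; lra.
rewrite Eq rint_cst ?(ltW T0)// subr0 ler_pM2r//.
have : 0 < e * expR x ^+ 2 by rewrite mulr_gt0// exprn_gt0// expR_gt0.
clear; lra.
Qed.

End MaximumModulus.

(** * Local theory of holomorphic functions *)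

Section HolomorphicEstimates.
Variable R : realType.
Local Notation C := R[i].
Implicit Types (f h : C -> C) (a b z u w : C).

Lemma bernoulli_ineq (d : R) n : 0 <= d -> 1 + n%:R * d <= (1 + d) ^+ n.
Proof.
move=> d0; elim: n => [|n IH]; first by rewrite mul0r addr0 expr0.
rewrite exprS; apply: (@le_trans _ _ ((1 + d) * (1 + n%:R * d))).
  rewrite -natr1 -subr_ge0.
  have -> : (1 + d) * (1 + n%:R * d) - (1 + (n%:R + 1) * d) = n%:R * d ^+ 2 by ring.
  by rewrite mulr_ge0// sqr_ge0.
by rewrite ler_wpM2l// addr_ge0.
Qed.

(** Taking n-th roots, the constants [c] and [K] disappear in the limit; Bernoulli's inequality
    replaces the roots. *)
Lemma root_bound (x L c K : R) : 0 <= x -> 0 <= L -> 0 < c ->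
  (forall n, x ^+ n * c <= L ^+ n * K) -> x <= L.
Proof.
move=> x0 L0 c0 H; rewrite leNgt; apply/negP => Lx.
have xp : 0 < x by exact: le_lt_trans Lx.
(* A positive number with [L <= y < x], also when [L = 0]. *)
pose y := Num.max L (x / 2).
have y0 : 0 < y by rewrite lt_max divr_gt0// orbT.
have yx : y < x by rewrite gt_max Lx ltr_pdivrMr// ltr_pMr// ltr1n.
have Ly : L <= y by rewrite le_max lexx.
pose d := x / y - 1; have d0 : 0 < d by rewrite subr_gt0 ltr_pdivlMr// mul1r.
have xE : x = y * (1 + d) by rewrite /d addrCA subrr addr0 mulrCA mulfV ?mulr1// gt_eqF.
have K0 : 0 <= K by have := H 0%N; rewrite !expr0 !mul1r; apply: le_trans; exact: ltW.
have [n Hn] : exists n : nat, K / c / d < n%:R.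
  exists (Num.trunc (K / c / d)).+1; exact: truncnS_gt.
have : (1 + d) ^+ n * c <= K.
  have := H n; rewrite {1}xE exprMn -mulrA => h.
  rewrite -(ler_pM2l (exprn_gt0 n y0)); apply: le_trans h _.
  by rewrite ler_wpM2r// lerXn2r// nnegrE// ltW.
apply/negP; rewrite -ltNge -ltr_pdivrMr//.
apply: lt_le_trans (bernoulli_ineq n (ltW d0)).
by move: Hn; rewrite ltr_pdivrMr// => h; apply: ltr_wpDl.
Qed.

Definition rootprod (bs : seq C) z : C := \prod_(b <- bs) (z - b).

Lemma rootprod_eq0 bs z : (rootprod bs z == 0) = (z \in bs).
Proof.
elim: bs => [|b bs IH]; first by rewrite /rootprod big_nil oner_eq0.
by rewrite /rootprod big_cons mulf_eq0 subr_eq0 in_cons; congr orb.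
Qed.

Lemma rootprod_dif bs z : exists k, dif (rootprod bs) z k.
Proof.
elim: bs => [|b bs [k IH]].
  exists 0; apply: dif_local ltr01 _ (dif_cst 1 z) => u _; by rewrite /rootprod big_nil.
exists ((1 - 0) * rootprod bs z + (z - b) * k).
apply: dif_local ltr01 _ (difM (difB (dif_id z) (dif_cst b z)) IH) => u _.
by rewrite /rootprod big_cons.
Qed.

(* The maximum principle is applied to [(f / p) ^+ n * p], where [p] is
   [rootprod bs]: this tends to 0 at the points of [bs], and the extra factor [p]
   is removed by letting [n] tend to infinity. So no removable-singularity
   theorem is needed. *)
Lemma zeros_bound f a (r s L : R) (bs : seq C) : 0 < r -> r < s -> hol f a s ->
  uniq bs -> {in bs, forall b, cabs (b - a) < r /\ f b = 0} ->
  (forall u, cabs (u - a) = r -> cabs (f u) <= L * cabs (rootprod bs u)) ->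
  forall z, cabs (z - a) <= r -> cabs (f z) <= L * cabs (rootprod bs z).
Proof.
move=> r0 rs Hf ub Hb Hc z zr.
pose p := rootprod bs.
have rc : cabs (a + r%:C%C - a) = r by rewrite addrAC subrr add0r cabsR gtr0_norm.
have L0 : 0 <= L.
  have := Hc _ rc; set v := a + r%:C%C => h.
  have p0 : 0 < cabs (p v).
    rewrite cabs_gt0 rootprod_eq0; apply/negP => /Hb[+ _]; by rewrite rc ltxx.
  by rewrite -(pmulr_lge0 _ p0); apply: le_trans h; exact: cabs_ge0.
have [zb|zb] := boolP (z \in bs).
  by have [_ ->] := Hb z zb; rewrite cabs0 mulr_ge0// cabs_ge0.
have pz : 0 < cabs (p z) by rewrite cabs_gt0 rootprod_eq0.
rewrite -/(p z) -ler_pdivrMr// -cabsV -cabsM.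
have [pm _ Hpm] := @closed_disc_max R (fun u => cabs (p u)) a r (ltW r0)
  ltac:(move=> q _ e e0; have [k /dif_cont Hk] := rootprod_dif bs q;
    have [t t0 Ht] := Hk e e0; exists t => // u /Ht; apply: le_lt_trans;
    rewrite ler_norml; have := ler_sub_cabs (p u) (p q); have := ler_sub_cabs (p q) (p u);
    rewrite [cabs (p q - _)]cabsB; clear; lra).
apply: (@root_bound _ _ (cabs (p z)) (cabs (p pm))) => //; first exact: cabs_ge0.
move=> n; pose h u := (f u / p u) ^+ n * p u.
have hd u : cabs (u - a) < s -> u \notin bs -> exists k, dif h u k.
  move=> /Hf[k Hk] ubs; have [k' Hk'] := rootprod_dif bs u.
  have pu : p u != 0 by rewrite rootprod_eq0.
  have [k2 Hk2] := difX n (difM Hk (difV pu Hk')).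
  by eexists; apply: difM Hk2 Hk'.
(* Near a root, [f / p] stays bounded: [f] is of the order of [v - u], and the other factors of [p]
   do not vanish. The extra factor [p] then forces [h] to tend to 0. *)
have hb u : u \in bs -> ccont h u.
  move=> ubs; have [ur fu] := Hb u ubs.
  have [k Hk] := Hf u (lt_trans ur rs); have [t t0 Ht] := dif_lip Hk.
  pose p' := rootprod (rem u bs).
  have pE v : p v = (v - u) * p' v by rewrite /p /p' /rootprod (big_rem u).
  have p'u : 0 < cabs (p' u) by rewrite cabs_gt0 rootprod_eq0 mem_rem_uniq// inE eqxx.
  have [k' /dif_cont Hk'] := rootprod_dif (rem u bs) u.
  have [t' t'0 Ht'] := Hk' (cabs (p' u) / 2) ltac:(by rewrite divr_gt0).
  have [k'' Hk''] := rootprod_dif bs u.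
  move=> e e0; pose K := (cabs k + 1) / (cabs (p' u) / 2).
  have K0 : 0 <= K by rewrite divr_ge0 ?addr_ge0 ?divr_ge0 ?cabs_ge0.
  have Kn : 0 < K ^+ n + 1 by rewrite ltr_wpDl// exprn_ge0.
  have [t3 t30 Ht3] := dif_cont Hk'' (divr_gt0 e0 Kn).
  have pu0 : p u = 0 by apply/eqP; rewrite rootprod_eq0.
  exists (Num.min t (Num.min t' t3)); first by rewrite !lt_min t0 t'0 t30.
  move=> v; rewrite !lt_min => /and3P[/Ht h1 /Ht' h2 /Ht3 h3].
  rewrite /h pu0 mulr0 subr0 cabsM cabsX; move: h3; rewrite -/(p v) -/(p u) pu0 subr0 => h3.
  have [->|vu] := eqVneq v u; first by rewrite pu0 cabs0 mulr0.
  have vu0 : 0 < cabs (v - u) by rewrite cabs_gt0 subr_eq0.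
  have q1 : cabs (f v / p v) <= K.
    have hp : cabs (p' u) / 2 <= cabs (p' v).
      have := ler_sub_cabs (p' u) (p' v); rewrite cabsB.
      move: h2; rewrite -/(p' v) -/(p' u); move: p'u; clear; lra.
    have p'v : 0 < cabs (p' v) by apply: lt_le_trans hp; rewrite divr_gt0.
    rewrite cabsM cabsV pE cabsM ler_pdivrMr ?mulr_gt0//.
    move: h1; rewrite fu subr0 => h1; apply: le_trans h1 _.
    have -> : (cabs k + 1) * cabs (v - u) = K * (cabs (v - u) * (cabs (p' u) / 2)).
      by rewrite /K; field; rewrite gt_eqF.
    by rewrite ler_wpM2l// ler_wpM2l// cabs_ge0.
  apply: (@le_lt_trans _ _ (K ^+ n * cabs (p v))).
    by rewrite ler_wpM2r ?cabs_ge0// lerXn2r// nnegrE ?cabs_ge0.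
  move: h3; rewrite ltr_pdivlMr// => h3; apply: le_lt_trans h3.
  rewrite mulrC ler_wpM2l ?cabs_ge0// lerDl//.
have := @max_modulus R h a r (L ^+ n * cabs (p pm)) r0.
have -> : cabs (f z / p z) ^+ n * cabs (p z) = cabs (h z) by rewrite -cabsX -cabsM.
apply=> //.
- move=> u ur; have [/hb//|ubs] := boolP (u \in bs).
  by have [k /dif_cont] := hd u (le_lt_trans ur rs) ubs.
- move=> u ur hu; have ubs : u \notin bs.
    by apply/negP => ubs; move: hu; rewrite /h mulf_eq0 rootprod_eq0 ubs orbT.
  have [k /dif_cont Hk] := rootprod_dif bs u.
  have pu : 0 < cabs (p u) by rewrite cabs_gt0 rootprod_eq0.
  have [t t0 Ht] := Hk _ pu; have sr : 0 < s - cabs (u - a) by rewrite subr_gt0 (lt_trans ur).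
  exists (Num.min t (s - cabs (u - a))); first by rewrite lt_min t0.
  move=> v; rewrite lt_min => /andP[/Ht h1 h2]; apply: hd.
    have := cabs_triangle v u a; clear -h2; lra.
  apply/negP; rewrite -rootprod_eq0 => /eqP pv0.
  by move: h1; rewrite pv0 sub0r cabsN ltxx.
- move=> u ur; rewrite /h cabsM cabsX; apply: ler_pM.
  + by rewrite exprn_ge0// cabs_ge0.
  + exact: cabs_ge0.
  + rewrite lerXn2r// ?nnegrE ?cabs_ge0// cabsM cabsV ler_pdivrMr ?Hc//.
    rewrite cabs_gt0 rootprod_eq0; apply/negP => /Hb[+ _]; by rewrite ur ltxx.
  + by apply: Hpm; rewrite ur.
Qed.

End HolomorphicEstimates.

(** * Second differences and differentiability of the derivative *)

Section LocalTheory.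
Variable R : realType.
Local Notation C := R[i].
Implicit Types (f g k : C -> C) (a b z u w h : C).

Lemma eq_ler (x y : R) : x = y -> x <= y. Proof. by move->. Qed.

(** A Schwarz lemma: [zeros_bound] for [f - f b] with the single root [b]. On the circle
    [|f u - f b| <= 2 * M] and [|u - b| >= r / 2], whence the constant [4 * M / r]. *)
Lemma hol_lip f a (r s M : R) : 0 < r -> r < s -> hol f a s ->
  (forall u, cabs (u - a) <= r -> cabs (f u) <= M) ->
  forall b z, cabs (b - a) <= r / 2 -> cabs (z - a) <= r ->
    cabs (f z - f b) <= 4 * M / r * cabs (z - b).
Proof.
move=> r0 rs Hf HM b z br zr.
have br' : cabs (b - a) < r by apply: le_lt_trans br _; rewrite ltr_pdivrMr// ltr_pMr// ltr1n.
have rp v : rootprod [:: b] v = v - b by rewrite /rootprod big_seq1.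
rewrite -(rp z); apply: (@zeros_bound R (fun v => f v - f b) a r s) => //.
- by move=> u /Hf[d Hd]; exists (d - 0); apply: difB Hd (dif_cst _ _).
- by move=> c; rewrite inE => /eqP->; rewrite subrr.
move=> u ur; rewrite rp; apply: le_trans (ler_cabsB _ _) _.
have M1 := HM u; rewrite ur lexx in M1; have {}M1 := M1 isT.
have M2 := HM b (ltW br'); have M0 := le_trans (cabs_ge0 _) M1.
have ub : r / 2 <= cabs (u - b).
  have := cabs_triangle u b a; rewrite ur; move: br; clear; lra.
apply: (@le_trans _ _ (4 * M / r * (r / 2))).
  have -> : 4 * M / r * (r / 2) = M + M by field; rewrite gt_eqF.
  exact: lerD.
by rewrite ler_wpM2l// divr_ge0 ?mulr_ge0// ltW.
Qed.

Lemma dq_bound f a (r s M : R) : 0 < r -> r < s -> hol f a s ->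
  (forall u, cabs (u - a) <= r -> cabs (f u) <= M) ->
  forall h, h != 0 -> cabs h <= r / 4 ->
    hol (fun z => (f (z + h) - f z) / h) a (s - r / 4) /\
    forall z, cabs (z - a) <= r / 4 -> cabs ((f (z + h) - f z) / h) <= 4 * M / r.
Proof.
move=> r0 rs Hf HM h h0 hr; split.
  move=> u us; have [d Hd] : exists d, dif f (u + h) d.
    apply: Hf; have := ler_cabsD (u - a) h; rewrite addrAC; move: us hr; clear; lra.
  have [d' Hd'] := Hf u ltac:(move: us r0; clear; lra).
  have D : dif (fun v => v + h) u (1 + 0) by apply: difD (dif_id _) (dif_cst _ _).
  by eexists; apply: difM (difB (dif_comp D Hd) Hd') (dif_cst _ _).
move=> z zr; rewrite cabsM cabsV ler_pdivrMr ?cabs_gt0//.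
have := hol_lip r0 rs Hf HM (b := z) (z := z + h).
rewrite (_ : z + h - z = h); last by ring.
apply; first by move: zr r0; clear; lra.
have := ler_cabsD (z - a) h; rewrite addrAC; move: zr hr r0; clear; lra.
Qed.

(* A second-difference bound, which stands in for a bound on [f'']. *)
Definition dqlip f a (r K : R) := forall b z h,
  cabs (b - a) < r -> cabs (z - a) < r -> cabs h < r ->
  cabs ((f (z + h) - f z) - (f (b + h) - f b)) <= K * cabs (z - b) * cabs h.

(** Two applications of [hol_lip]: the difference quotient is holomorphic and bounded by [4 * M / r]
    on the disc of radius [r / 4], hence Lipschitz with constant [4 * (4 * M / r) / (r / 4)]. *)
Lemma dq_lip f a (r s M : R) : 0 < r -> r < s -> hol f a s ->
  (forall u, cabs (u - a) <= r -> cabs (f u) <= M) ->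
  dqlip f a (r / 8) (64 * M / r ^+ 2).
Proof.
move=> r0 rs Hf HM b z h br zr hr.
have M0 : 0 <= M.
  by apply: le_trans (cabs_ge0 _) (HM a _); rewrite subrr cabs0 ltW.
have [->|h0] := eqVneq h 0.
  by rewrite !addr0 !subrr cabs0 mulr0.
have [] := dq_bound r0 rs Hf HM h0; first by move: hr r0; clear; lra.
move=> H1 H2; have r40 : 0 < r / 4 by rewrite divr_gt0.
have := hol_lip r40 (s := s - r / 4) _ H1 H2 (b := b) (z := z).
move=> /(_ ltac:(move: rs r0; clear; lra) ltac:(move: br r0; clear; lra) ltac:(move: zr r0; clear; lra)).
rewrite -mulrBl cabsM cabsV ler_pdivrMr ?cabs_gt0// => H.
apply: le_trans H _; apply: eq_ler; field; by rewrite gt_eqF.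
Qed.

Lemma hol_bounded f a (s : R) : 0 < s -> hol f a s -> exists r M : R,
  [/\ 0 < r, r < s, 0 < M & forall u, cabs (u - a) <= r -> cabs (f u) <= M].
Proof.
move=> s0 Hf; have [|d /dif_cont /(_ 1 ltr01)[t t0 Ht]] := Hf a; first by rewrite subrr cabs0.
have m0 : 0 < Num.min s t by rewrite lt_min s0.
have : Num.min s t / 2 < Num.min s t by rewrite ltr_pdivrMr// ltr_pMr// ltr1n.
rewrite [_ < Num.min _ _]lt_min => /andP[ms mt].
exists (Num.min s t / 2), (cabs (f a) + 1); split => //; first by rewrite divr_gt0.
  by rewrite ltr_wpDl// cabs_ge0.
move=> u ur; have := Ht u (le_lt_trans ur mt); have := ler_sub_cabs (f u) (f a); clear; lra.
Qed.

Lemma hol_dqlip f a (s : R) : 0 < s -> hol f a s ->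
  exists r K : R, [/\ 0 < r, r < s, 0 <= K & dqlip f a r K].
Proof.
move=> s0 Hf; have [r [M [r0 rs M0 HM]]] := hol_bounded s0 Hf.
exists (r / 8), (64 * M / r ^+ 2); split; [by rewrite divr_gt0|by move: r0 rs; clear; lra| |].
  by rewrite divr_ge0 ?sqr_ge0 ?mulr_ge0// ltW.
exact: dq_lip r0 rs Hf HM.
Qed.

(** Halving the increment changes [2 ^+ n * (f (b + x n) - f b)] by an amount that decreases
    geometrically in [n], by the second-difference bound; these quantities start at
    [f (b + h) - f b] and tend to [d * h]. *)
Lemma dqlip_quad f a (r K : R) : 0 <= K -> dqlip f a r K ->
  forall b h d, cabs (b - a) < r / 2 -> cabs h < r / 2 -> dif f b d ->
    cabs (f (b + h) - f b - d * h) <= K * cabs h ^+ 2.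
Proof.
move=> K0 H b h d br hr Hd.
pose D x := f (b + x) - f b.
pose x n := (2^-1 ^+ n)%:C%C * h.
have cx n : cabs (x n) = 2^-1 ^+ n * cabs h.
  by rewrite cabsM cabsR ger0_norm// exprn_ge0.
have cxh n : cabs (x n) <= cabs h.
  rewrite cx ler_piMl ?cabs_ge0// exprn_ile1//; lra.
have xS n : x n = x n.+1 + x n.+1.
  rewrite /x -mulrDl -rmorphD exprS; congr (_%:C%C * _); lra.
have step n : cabs (D (x n) - 2 * D (x n.+1)) <= K * cabs (x n.+1) ^+ 2.
  have := @H b (b + x n.+1) (x n.+1).
  have h1 : cabs (b - a) < r by move: br hr (cabs_ge0 h); clear; lra.
  have h2 : cabs (b + x n.+1 - a) < r.
    have := ler_cabsD (b - a) (x n.+1); rewrite addrAC.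
    have := cxh n.+1; move: br hr; clear; lra.
  have h3 : cabs (x n.+1) < r.
    have := cxh n.+1; move: hr (cabs_ge0 (b - a)) br; clear; lra.
  move=> /(_ h1 h2 h3); rewrite (_ : b + x n.+1 - b = x n.+1); last by ring.
  rewrite -mulrA -expr2; congr (_ <= _); congr cabs.
  by rewrite /D (xS n) [b + (_ + _)]addrA; ring.
have S n : cabs (D h - (2 ^+ n)%:C%C * D (x n)) <= K * cabs h ^+ 2 * (1 - 2^-1 ^+ n).
  elim: n => [|n IH].
    have -> : x 0%N = h by rewrite /x expr0 mul1r.
    by rewrite !expr0 mul1r subrr cabs0 subrr mulr0.
  have -> : D h - (2 ^+ n.+1)%:C%C * D (x n.+1) =
     (D h - (2 ^+ n)%:C%C * D (x n)) + (2 ^+ n)%:C%C * (D (x n) - 2 * D (x n.+1)).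
    by rewrite exprS rmorphM/= (_ : 2%:C%C = 2 :> C) ?rmorph_nat//; ring.
  apply: le_trans (ler_cabsD _ _) _.
  have p2 : 0 < 2 ^+ n :> R by rewrite exprn_gt0.
  have B : cabs ((2 ^+ n)%:C%C * (D (x n) - 2 * D (x n.+1))) <= K * cabs h ^+ 2 * (2^-1 ^+ n.+1).
    rewrite cabsM cabsR gtr0_norm//.
    apply: (@le_trans _ _ (2 ^+ n * (K * cabs (x n.+1) ^+ 2))); first by rewrite ler_wpM2l ?step// ltW.
    have PE : 2 ^+ n * 2^-1 ^+ n.+1 = 2^-1 :> R.
      by rewrite exprS mulrCA -exprMn mulfV ?pnatr_eq0// expr1n mulr1.
    rewrite cx (_ : _ * _ = K * cabs h ^+ 2 * 2^-1 ^+ n.+1 * (2 ^+ n * 2^-1 ^+ n.+1)); last by ring.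
    rewrite PE ler_piMr ?mulr_ge0 ?sqr_ge0 ?exprn_ge0 ?invr_ge0 ?cabs_ge0//; lra.
  apply: le_trans (lerD IH B) _; rewrite -mulrDr ler_wpM2l ?mulr_ge0 ?exprn_ge0 ?cabs_ge0//.
  rewrite exprS; clear; lra.
apply/ler_addgt0Pr => e e0.
have h1 : 0 < cabs h + 1 by rewrite ltr_wpDl// cabs_ge0.
have [t t0 Ht] := Hd _ (divr_gt0 e0 h1).
have [n Hn] := half_expn_lt (divr_gt0 t0 h1).
have xt : cabs (x n) < t.
  rewrite cx; apply: le_lt_trans (_ : 2^-1 ^+ n * (cabs h + 1) < _).
    by rewrite ler_wpM2l ?exprn_ge0// lerDl.
  by rewrite -ltr_pdivlMr.
have := Ht (b + x n); rewrite (_ : b + x n - b = x n); last by ring.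
move=> /(_ xt); rewrite -/(D (x n)) => Hx.
have p2 : 0 < 2 ^+ n :> R by rewrite exprn_gt0.
have E : (2 ^+ n)%:C%C * x n = h.
  by rewrite /x mulrA -rmorphM/= -exprMn mulfV ?pnatr_eq0// expr1n mul1r.
have -> : f (b + h) - f b - d * h =
   (D h - (2 ^+ n)%:C%C * D (x n)) + (2 ^+ n)%:C%C * (D (x n) - d * x n).
  have -> : d * h = (2 ^+ n)%:C%C * (d * x n) by rewrite -[in LHS]E; ring.
  by rewrite /D; ring.
apply: le_trans (ler_cabsD _ _) _; apply: lerD.
  apply: le_trans (S n) _; apply: ler_piMr; last by rewrite gerBl exprn_ge0.
  by rewrite mulr_ge0 ?exprn_ge0 ?cabs_ge0.
rewrite cabsM cabsR gtr0_norm//.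
apply: (@le_trans _ _ (2 ^+ n * (e / (cabs h + 1) * cabs (x n)))); first by rewrite ler_wpM2l// ltW.
rewrite cx mulrCA [2 ^+ n * _]mulrA -exprMn mulfV ?pnatr_eq0// expr1n mul1r.
by rewrite mulrAC ler_pdivrMr// ler_wpM2l ?(ltW e0)// lerDl.
Qed.

(** Each lower estimate [x n - K * 2^-1 ^+ n] lies below each upper one, so the supremum of the
    lower estimates is the limit. *)
Lemma real_cauchy_half (x : nat -> R) (K : R) :
  (forall n m, `|x n - x m| <= K * (2^-1 ^+ n + 2^-1 ^+ m)) ->
  exists l, forall n, `|x n - l| <= K * 2^-1 ^+ n.
Proof.
move=> H; pose A := range (fun n => x n - K * 2^-1 ^+ n).
have ub n : ubound A (x n + K * 2^-1 ^+ n).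
  by move=> _ [m _ <-]; have := H n m; rewrite ler_norml => /andP[+ _]; lra.
have hs : has_sup A.
  by split; [exists (x 0%N - K * 2^-1 ^+ 0), 0%N|exists (x 0%N + K * 2^-1 ^+ 0); exact: ub].
exists (sup A) => n; rewrite ler_norml.
have h1 : sup A <= x n + K * 2^-1 ^+ n by apply: ge_sup (ub n); case: hs.
have h2 : x n - K * 2^-1 ^+ n <= sup A by apply: sup_upper_bound => //; exists n.
by apply/andP; split; lra.
Qed.

(** The mixed second difference of [f] with steps [x] and [h], divided by [x * h], is within
    [K * |x|] of the difference quotient [m h] of [k], and by symmetry within [K * |h|] of [m x]. So
    [m] is Cauchy as the step tends to 0. *)
Lemma deriv_dif f k a (s : R) : 0 < s ->
  (forall u, cabs (u - a) < s -> dif f u (k u)) -> exists m, dif k a m.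
Proof.
move=> s0 Hk; have Hf : hol f a s by move=> u /Hk; exists (k u).
have [r [M [r0 rs M0 HM]]] := hol_bounded s0 Hf.
have r40 : 0 < r / 4 by rewrite divr_gt0.
pose d h z := (f (z + h) - f z) / h.
pose m h := (k (a + h) - k a) / h.
pose K : R := 64 * (4 * M / r) / (r / 4) ^+ 2.
have K0 : 0 <= K by rewrite divr_ge0 ?sqr_ge0// mulr_ge0 ?divr_ge0 ?mulr_ge0// ltW.
have Q h x : h != 0 -> x != 0 -> cabs h < r / 64 -> cabs x < r / 64 ->
    cabs ((f (a + x + h) - f (a + x) - f (a + h) + f a) / (x * h) - m h) <= K * cabs x.
  move=> h0 x0 hr xr.
  have [|H1 H2] := dq_bound r0 rs Hf HM h0; first by move: hr r0; clear; lra.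
  have L := dq_lip r40 (s := s - r / 4) ltac:(move: rs r0; clear; lra) H1 H2.
  have Da : dif (d h) a (m h).
    have D : dif (fun v => v + h) a (1 + 0) by apply: difD (dif_id _) (dif_cst _ _).
    have D1 : dif f (a + h) (k (a + h)).
      apply: Hk; rewrite addrAC subrr add0r; move: hr r0 rs; clear; lra.
    have D2 : dif f a (k a) by apply: Hk; rewrite subrr cabs0.
    have -> : m h = (k (a + h) * (1 + 0) - k a) * h^-1 + (f (a + h) - f a) * 0.
      by rewrite /m mulr0 addr0; ring.
    exact: difM (difB (dif_comp D D1) D2) (dif_cst h^-1 a).
  have := dqlip_quad K0 L (b := a) (h := x) (d := m h).
  rewrite subrr cabs0 => /(_ ltac:(move: r0; clear; lra) ltac:(move: xr; clear; lra) Da).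
  move=> B; have x0' : 0 < cabs x by rewrite cabs_gt0.
  rewrite -(ler_pM2r x0') -cabsM -mulrA -expr2; apply: le_trans B; apply: eq_ler.
  by congr cabs; rewrite addrAC; field; rewrite x0 h0.
have M2 h x : h != 0 -> x != 0 -> cabs h < r / 64 -> cabs x < r / 64 ->
    cabs (m h - m x) <= K * (cabs h + cabs x).
  move=> h0 x0 hr xr; have A := Q h x h0 x0 hr xr; have B := Q x h x0 h0 xr hr.
  set q := _ / (x * h) in A.
  have E : (f (a + h + x) - f (a + h) - f (a + x) + f a) / (h * x) = q.
    by rewrite /q [h * x]mulrC [a + h + x]addrAC; congr (_ / _); ring.
  rewrite E in B; have -> : m h - m x = (q - m x) - (q - m h) by ring.
  by apply: le_trans (ler_cabsB _ _) _; rewrite mulrDr; exact: lerD.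
have r64 : 0 < r / 64 by rewrite divr_gt0.
pose x n : C := (2^-1 ^+ n * (r / 128))%:C%C.
have cx n : cabs (x n) = 2^-1 ^+ n * (r / 128).
  by rewrite cabsR ger0_norm// mulr_ge0 ?exprn_ge0// divr_ge0// ltW.
have xr n : cabs (x n) < r / 64.
  rewrite cx; apply: (@le_lt_trans _ _ (1 * (r / 128))); last by move: r0; clear; lra.
  by rewrite ler_wpM2r ?divr_ge0 ?(ltW r0)// exprn_ile1//; clear; lra.
have x0 n : x n != 0.
  by rewrite -cabs_gt0 cx mulr_gt0 ?exprn_gt0 ?divr_gt0// invr_gt0.
have Cy n p : cabs (m (x n) - m (x p)) <= K * (r / 128) * (2^-1 ^+ n + 2^-1 ^+ p).
  apply: le_trans (M2 _ _ (x0 n) (x0 p) (xr n) (xr p)) _; rewrite !cx; apply: eq_ler; ring.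
have [l1 Hl1] := @real_cauchy_half (fun n => complex.Re (m (x n))) (K * (r / 128))
  (fun n p => le_trans (eq_ind _ (fun t => `|t| <= _) (ler_Re_cabs _) _ (cReB _ _)) (Cy n p)).
have [l2 Hl2] := @real_cauchy_half (fun n => complex.Im (m (x n))) (K * (r / 128))
  (fun n p => le_trans (eq_ind _ (fun t => `|t| <= _) (ler_Im_cabs _) _ (cImB _ _)) (Cy n p)).
pose l := cplx l1 l2; exists l.
apply: (@dif_quad _ _ _ _ K (r / 64)) => // u ur.
have [->|ua] := eqVneq u a; first by rewrite !subrr mulr0 subrr cabs0 expr0n mulr0.
pose h := u - a; have h0 : h != 0 by rewrite subr_eq0.
have -> : k u - k a - l * (u - a) = (m h - l) * h.
  by rewrite /m /h addrCA subrr addr0; field; rewrite subr_eq0.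
rewrite cabsM expr2 mulrA ler_wpM2r ?cabs_ge0//.
apply/ler_addgt0Pr => e e0.
pose K3 := 3 * (K * (r / 128)) + 1.
have K30 : 0 < K3 by rewrite ltr_wpDl// mulr_ge0// mulr_ge0// divr_ge0// ltW.
have [n Hn] := half_expn_lt (divr_gt0 e0 K30).
have A := M2 h (x n) h0 (x0 n) ur (xr n).
have B : cabs (m (x n) - l) <= K * (r / 128) * 2^-1 ^+ n + K * (r / 128) * 2^-1 ^+ n.
  by apply: le_trans (cabs_leD _) _; rewrite cReB cImB; exact: lerD.
have -> : m h - l = (m h - m (x n)) + (m (x n) - l) by ring.
apply: le_trans (ler_cabsD _ _) _; apply: le_trans (lerD A B) _.
rewrite cx mulrDr -addrA lerD2l.
move: Hn; rewrite ltr_pdivlMr// => /ltW; apply: le_trans.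
have := exprn_ge0 n (_ : 0 <= 2^-1 :> R); rewrite invr_ge0 => /(_ ltac:(by [])).
rewrite /K3; clear; set E := 2^-1 ^+ n; set F := K * (r / 128); move=> E0.
have -> : K * (E * (r / 128)) + (F * E + F * E) = E * (3 * F) by rewrite /F; ring.
by rewrite mulrDr mulr1 lerDl.
Qed.

End LocalTheory.

(** * Identity theorem, open mapping and local inverses *)

Section Zeros.
Variable R : realType.
Local Notation C := R[i].
Implicit Types (f g k : C -> C) (a b z u w h : C).

(** A mean value inequality with arbitrarily small slope [e], which is additive along the
    segment. *)
Lemma zero_deriv_segment f a v :
  (forall t : R, 0 <= t <= 1 -> dif f (a + t%:C%C * v) 0) -> f (a + v) = f a.
Proof.
move=> H; pose p t := a + t%:C%C * v.
suff S (e : R) : 0 < e -> cabs (f (p 1) - f (p 0)) <= e * (1 - 0).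
  move: S; rewrite /p mul1r mul0r addr0 subr0 => S.
  apply/cabs_sub_eq0/eqP; rewrite eq_le cabs_ge0 andbT.
  by apply/ler_addgt0Pl => e /S; rewrite mulr1 addr0.
move=> e0; apply: (@itv_induction _ (fun s t => cabs (f (p t) - f (p s)) <= e * (t - s))) => //.
  move=> x y z _ _ _ _ h1 h2; apply: le_trans (cabs_triangle _ (f (p y)) _) _.
  by move: h1 h2; clear; lra.
move=> x xI; have v1 : 0 < cabs v + 1 by rewrite ltr_wpDl// cabs_ge0.
have [r r0 Hr] := H x xI _ (divr_gt0 e0 v1).
exists (r / (cabs v + 1)); first by rewrite divr_gt0.
have D (s t : R) : p t - p s = (t - s)%:C%C * v by rewrite /p rmorphB /=; ring.
have K t : `|t - x| < r / (cabs v + 1) -> cabs (f (p t) - f (p x)) <= e * `|t - x|.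
  rewrite ltr_pdivlMr// => tr.
  have ct : cabs (p t - p x) <= `|t - x| * (cabs v + 1).
    by rewrite D cabsM cabsR ler_wpM2l// lerDl.
  have := Hr (p t) (le_lt_trans ct tr); rewrite mul0r subr0 => h.
  apply: le_trans h _; apply: le_trans (ler_wpM2l _ ct) _.
    by rewrite divr_ge0// ltW.
  by apply: eq_ler; field; rewrite gt_eqF.
move=> s t _ sx xt _ st tr.
have hs : `|s - x| = x - s by rewrite distrC ger0_norm ?subr_ge0.
have ht : `|t - x| = t - x by rewrite ger0_norm ?subr_ge0.
have := K t; have := K s; rewrite hs ht.
have rs : x - s < r / (cabs v + 1) by move: tr xt; clear; lra.
have rt : t - x < r / (cabs v + 1) by move: tr sx; clear; lra.
move=> /(_ rs) k1 /(_ rt) k2.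
apply: le_trans (cabs_triangle _ (f (p x)) _) _; rewrite [cabs (f (p x) - _)]cabsB.
by move: k1 k2; clear; lra.
Qed.

Lemma zero_deriv_const f a (r : R) : (forall u, cabs (u - a) < r -> dif f u 0) ->
  forall u, cabs (u - a) < r -> f u = f a.
Proof.
move=> H u ur; rewrite -(subrKC a u); apply: zero_deriv_segment => t /andP[t0 t1].
apply: H; rewrite addrAC subrr add0r cabsM cabsR ger0_norm//.
by apply: le_lt_trans ur; rewrite ler_piMl// cabs_ge0.
Qed.

(** With [n] zeros within [r / 4] of [a], [zeros_bound] compares factors of modulus at most [r / 2]
    near [a] with factors at least [3 / 4 * r] on the circle, so [|k u| <= M * (2 / 3) ^+ n] for
    every [n]. *)
Lemma zeros_cluster k a (s : R) : 0 < s -> hol k a s ->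
  (forall e : R, 0 < e -> exists z, [/\ z != a, cabs (z - a) < e & k z = 0]) ->
  exists2 r : R, 0 < r & forall u, cabs (u - a) < r -> k u = 0.
Proof.
move=> s0 Hk Hz; have [r [M [r0 rs M0 HM]]] := hol_bounded s0 Hk.
have Z n : exists bs : seq C, exists2 e : R, 0 < e &
    [/\ size bs = n, uniq bs & {in bs, forall b, [/\ e <= cabs (b - a), cabs (b - a) < r / 4 & k b = 0]}].
  elim: n => [|n [bs [e e0 [sz ub Hb]]]]; first by exists [::], 1.
  have r4 : 0 < r / 4 by rewrite divr_gt0.
  have [|z [za ze kz]] := Hz (Num.min e (r / 4)); first by rewrite lt_min e0.
  move: ze; rewrite lt_min => /andP[ze zr].
  exists (z :: bs), (cabs (z - a)); first by rewrite cabs_gt0 subr_eq0.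
  split => /=; [by rewrite sz| |].
    rewrite ub andbT; apply/negP => /Hb[+ _ _]; by rewrite leNgt ze.
  move=> b; rewrite inE => /orP[/eqP->//|/Hb[h1 h2 h3]]; split=> //.
  by apply: le_trans h1; exact: ltW.
exists (r / 4); first by rewrite divr_gt0.
move=> u ur; apply/eqP; rewrite -cabs_eq0 eq_le cabs_ge0 andbT.
apply/ler_addgt0Pl => e e0; rewrite addr0.
have [n Hn] : exists n : nat, (2 / 3) ^+ n < e / M :> R.
  have [n Hn] := half_expn_lt (divr_gt0 e0 M0); exists (n + n)%N.
  apply: le_lt_trans Hn; rewrite exprD -exprMn lerXn2r// ?nnegrE; lra.
have [bs [d d0 [sz ub Hb]]] := Z n.
have P1 v : cabs (v - a) = r -> (3 / 4 * r) ^+ n <= cabs (rootprod bs v).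
  move=> vr; rewrite -sz; elim: {sz ub} bs Hb => [|b bs IH] Hb.
    by rewrite /rootprod big_nil cabs1 expr0.
  rewrite /rootprod big_cons cabsM [size _]/= exprS; apply: ler_pM.
  - by rewrite mulr_ge0// ltW.
  - by rewrite exprn_ge0// mulr_ge0// ltW.
  - have [|_ h _] := Hb b; first by rewrite inE eqxx.
    have := cabs_triangle v b a; rewrite vr; move: h; clear; lra.
  - by apply: IH => c cb; apply: Hb; rewrite inE cb orbT.
have P2 : cabs (rootprod bs u) <= (r / 2) ^+ n.
  rewrite -sz; elim: {sz ub P1} bs Hb => [|b bs IH] Hb.
    by rewrite /rootprod big_nil cabs1 expr0.
  rewrite /rootprod big_cons cabsM [size _]/= exprS; apply: ler_pM; try exact: cabs_ge0.
  - have [|_ h _] := Hb b; first by rewrite inE eqxx.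
    have := cabs_triangle u a b; rewrite (cabsB a b); move: h ur; clear; lra.
  - by apply: IH => c cb; apply: Hb; rewrite inE cb orbT.
have r34 : 0 < 3 / 4 * r by rewrite mulr_gt0.
have := @zeros_bound R k a r s (M / (3 / 4 * r) ^+ n) bs r0 rs Hk ub.
move=> /(_ _ _ u) H; apply: le_trans (H _ _ _) _.
- move=> b /Hb[_ h1 h2]; split=> //; move: h1 r0; clear; lra.
- move=> v vr; apply: le_trans (HM v _) _; first by rewrite vr.
  by rewrite -mulrA ler_peMr ?(ltW M0)// mulrC ler_pdivlMr ?exprn_gt0// mul1r P1.
- by move: ur r0; clear; lra.
apply: (@le_trans _ _ (M / (3 / 4 * r) ^+ n * (r / 2) ^+ n)).
  by rewrite ler_wpM2l// divr_ge0 ?exprn_ge0 ?ltW.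
rewrite -mulrA [_ * (r / 2) ^+ n]mulrC -expr_div_n.
have -> : r / 2 / (3 / 4 * r) = 2 / 3 by field; rewrite gt_eqF.
by rewrite mulrC -ler_pdivlMr// ltW.
Qed.

Lemma critical_cluster f k a (s : R) : 0 < s ->
  (forall u, cabs (u - a) < s -> dif f u (k u)) ->
  (forall e : R, 0 < e -> exists z, [/\ z != a, cabs (z - a) < e & k z = 0]) ->
  exists2 r : R, 0 < r & forall u, cabs (u - a) < r -> f u = f a.
Proof.
move=> s0 Hk Hz; have [|r r0 Hr] := @zeros_cluster k a s s0 _ Hz.
  move=> u us; apply: (@deriv_dif _ f k u (s - cabs (u - a))); first by rewrite subr_gt0.
  move=> v vs; apply: Hk; have := cabs_triangle v u a; move: vs; clear; lra.
exists (Num.min r s); first by rewrite lt_min r0.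
apply: zero_deriv_const => u; rewrite lt_min => /andP[ur us].
by rewrite -(Hr u ur); exact: Hk.
Qed.

(** If [w] were omitted, the inverse of [f - w] would be holomorphic and larger at the centre than
    on the circle. *)
Lemma hits f c (r s m : R) w : 0 < r -> r < s -> hol f c s ->
  (forall u, cabs (u - c) = r -> m <= cabs (f u - w)) -> cabs (f c - w) < m ->
  exists2 z, cabs (z - c) < r & f z = w.
Proof.
move=> r0 rs Hf Hc Hm; apply: contrapT => N.
have m0 : 0 < m by apply: le_lt_trans Hm; exact: cabs_ge0.
have nz u : cabs (u - c) <= r -> f u - w != 0.
  rewrite le_eqVlt => /orP[/eqP ur|ur].
    by rewrite -cabs_gt0; apply: lt_le_trans m0 (Hc u ur).
  by apply/negP => /eqP/subr0_eq h; apply: N; exists u.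
have D u : cabs (u - c) < s -> exists d, dif (fun u => f u - w) u d.
  by move=> /Hf[d Hd]; exists (d - 0); exact: difB Hd (dif_cst _ _).
have : cabs (f c - w)^-1 <= m^-1.
  apply: (@max_modulus R (fun u => (f u - w)^-1) c r m^-1 r0).
  - move=> u ur; have [d Hd] := D u (le_lt_trans ur rs).
    exact: dif_cont (@difV _ (fun u => f u - w) _ _ (nz u ur) Hd).
  - move=> u ur _; have d0 : 0 < r - cabs (u - c) by rewrite subr_gt0.
    exists (r - cabs (u - c)) => // v vr.
    have vc : cabs (v - c) < r by have := cabs_triangle v u c; move: vr; clear; lra.
    have [d Hd] := D v (lt_trans vc rs).
    by eexists; exact: (@difV _ (fun u => f u - w) _ _ (nz v (ltW vc)) Hd).
  - by move=> u ur; rewrite cabsV lef_pV2 ?posrE ?cabs_gt0 ?nz ?ur// Hc.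
  - by rewrite subrr cabs0 ltW.
rewrite cabsV lef_pV2 ?posrE ?cabs_gt0 ?nz ?subrr ?cabs0 ?(ltW r0)//.
by rewrite leNgt Hm.
Qed.

(** The second-difference bound compares [f z - f z'] with the increment of [f] at [a] by the same
    step, and that increment with [d * (z - z')]; surjectivity then comes from [hits]. *)
Lemma local_inverse f a d (s : R) : 0 < s -> hol f a s -> dif f a d -> d != 0 ->
  exists r e : R, [/\ 0 < r, r < s, 0 < e,
    forall z z', cabs (z - a) < r -> cabs (z' - a) < r ->
      cabs d / 2 * cabs (z - z') <= cabs (f z - f z') &
    forall w, cabs (w - f a) < e -> exists2 z, cabs (z - a) < r & f z = w].
Proof.
move=> s0 Hf Hd d0; have [t [K [t0 ts K0 HK]]] := hol_dqlip s0 Hf.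
have D0 : 0 < cabs d by rewrite cabs_gt0.
have K1 : 0 < K + 1 by rewrite ltr_wpDl.
(* The two comparisons below cost [K * r] and [2 * K * r] times [|h|]; this [r] keeps their sum
   below [|d| / 2]. *)
pose r := Num.min (t / 4) (cabs d / (6 * (K + 1))).
have r0 : 0 < r by rewrite lt_min !divr_gt0// mulr_gt0.
have rt : r <= t / 4 by rewrite ge_min lexx.
have rK : 3 * (K * r) <= cabs d / 2.
  have : r <= cabs d / (6 * (K + 1)) by rewrite ge_min lexx orbT.
  rewrite ler_pdivlMr ?mulr_gt0// => h.
  have : 0 <= r by exact: ltW.
  move: h; clear; lra.
have L z z' : cabs (z - a) < r -> cabs (z' - a) < r ->
    cabs d / 2 * cabs (z - z') <= cabs (f z - f z').
  move=> zr z'r; set h := z - z'.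
  have hr : cabs h < 2 * r.
    by have := cabs_triangle z a z'; rewrite (cabsB a z'); move: zr z'r; clear; lra.
  have ht : cabs h < t / 2 by move: hr rt; clear; lra.
  have Q := dqlip_quad K0 HK (b := a) (h := h) (d := d).
  rewrite subrr cabs0 in Q; have {}Q := Q ltac:(by rewrite divr_gt0) ht Hd.
  have := HK a z' h; rewrite subrr cabs0.
  move=> /(_ t0 ltac:(move: z'r rt t0; clear; lra) ltac:(move: ht t0; clear; lra)).
  rewrite (_ : z' + h = z); last by rewrite /h; ring.
  set X := f (a + h) - f a in Q *; set Y := f z - f z' => P.
  have h1 : cabs (d * h) <= cabs Y + cabs (Y - X) + cabs (X - d * h).
    rewrite {1}(_ : d * h = Y - (Y - X) - (X - d * h)); last by ring.
    by apply: le_trans (ler_cabsB _ _) _; rewrite lerD2r ler_cabsB.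
  have h2 : cabs (Y - X) <= K * r * cabs h.
    by apply: le_trans P _; rewrite ler_wpM2r ?cabs_ge0// ler_wpM2l// ltW.
  have h3 : cabs (X - d * h) <= K * (2 * r) * cabs h.
    apply: le_trans Q _; rewrite expr2 mulrA ler_wpM2r ?cabs_ge0// ler_wpM2l// ltW//.
  have h4 : 3 * (K * r) * cabs h <= cabs d / 2 * cabs h by rewrite ler_wpM2r ?cabs_ge0.
  rewrite cabsM in h1; move: h1 h2 h3 h4; clear; lra.
exists r, (cabs d * r / 8); split=> //.
- by move: rt ts t0; clear; lra.
- by rewrite !mulr_gt0// invr_gt0.
move=> w ww; have r20 : 0 < r / 2 by rewrite divr_gt0.
have rs2 : r / 2 < s.
  by move: rt ts t0; clear; lra.
have [u ur||z zr zw] := @hits f a (r / 2) s (cabs d * r / 8) w r20 rs2 Hf.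
- have := L u a; rewrite subrr cabs0 ur => /(_ ltac:(move: r0; clear; lra) r0) h.
  have := cabs_triangle (f u) w (f a); move: ww h; clear; lra.
- by rewrite cabsB.
by exists z => //; move: zr r0; clear; lra.
Qed.

(** Rouche's argument: on the circle [f] is at distance at least [|q| * r - e] from [w], at the
    centre at most [e]. *)
Lemma affine_hits f c q w (r s e : R) : 0 < r -> r < s -> hol f c s ->
  (forall u, cabs (u - c) <= r -> cabs (f u - w - q * (u - c)) <= e) ->
  2 * e < cabs q * r -> exists2 z, cabs (z - c) < r & f z = w.
Proof.
move=> r0 rs Hf H er.
apply: (@hits f c r s (cabs q * r - e) w r0 rs Hf).
  move=> u ur; have := H u; rewrite ur lexx => /(_ isT).
  have := ler_sub_cabs (q * (u - c)) (- (f u - w - q * (u - c))).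
  rewrite opprK [q * (u - c) + _]addrC subrK cabsN cabsM ur; clear; lra.
have := H c; rewrite subrr cabs0 mulr0 subr0 => /(_ (ltW r0)).
move: er; clear; lra.
Qed.

End Zeros.

(** * Logarithmic area *)

Section PlaneMeasure.
Variable R : realType.
Local Notation mu := (@lebesgue_measure R).
Local Notation T := (measurableTypeR R).
Local Notation TT := (T * T)%type.

Definition mu2 : set TT -> \bar R := (mu \x mu)%E.
HB.instance Definition _ := Measure.on mu2.

Lemma measurable_addr (c : R) : measurable_fun [set: T] (fun t : T => t + c : T).
Proof. exact: measurable_funD. Qed.

Lemma lebesgue_translation (c : R) (A : set T) : measurable A ->
  mu ((fun t => t + c) @^-1` A) = mu A.
Proof.
move=> mA; have mf := measurable_addr c.
symmetry; apply: (@lebesgue_measure_unique R (pushforward mu (fun t : T => t + c : T))) => // X [[a b] _ <-].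
rewrite /pushforward /=.
have E : (fun t => t + c) @^-1` `]a, b] = `]a - c, b - c]%classic.
  by apply/seteqP; split => t /=; rewrite !in_itv/= ltrBlDr lerBrDr.
rewrite [X in _ = mu X]E.
rewrite !lebesgue_measure_itv/= !lte_fin ltrD2r; case: ifP => // _.
by rewrite -!EFinB opprD addrACA subrr addr0.
Qed.

Lemma mu2_ysection (A : set TT) : measurable A -> mu2 A = (mu \x^ mu)%E A.
Proof.
move=> mA; apply: product_measure_unique => //.
by move=> A1 A2 m1 m2; rewrite -product_measure2E.
Qed.

Lemma mu2_rect (a b c d : R) : a <= b -> c <= d ->
  mu2 (`[a, b]%classic `*` `[c, d]%classic) = ((b - a) * (d - c))%:E.
Proof.
move=> ab cd; rewrite /mu2 product_measure1E//= !lebesgue_measure_itv/= !lte_fin.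
case: ltP => [_|ba]; last first.
  by rewrite (_ : a = b) ?subrr ?mul0r ?mul0e//; apply/eqP; rewrite eq_le ab.
case: ltP => [_|dc]; last first.
  by rewrite (_ : c = d) ?subrr ?mulr0 ?mule0//; apply/eqP; rewrite eq_le cd.
by rewrite EFinM.
Qed.

Lemma measurable_shear2 (phi : T -> R) (E : set TT) : measurable_fun [set: T] phi ->
  measurable E -> measurable [set p : TT | E (p.1, p.2 + phi p.1)].
Proof.
move=> mphi mE; rewrite -[X in measurable X]setTI.
have mf : measurable_fun [set: TT] (fun p : TT => (p.1, p.2 + phi p.1) : TT).
  apply: measurable_fun_pair => //; apply: measurable_funD => //.
  by apply: measurableT_comp.
exact: mf.
Qed.

Lemma measurable_shear1 (phi : T -> R) (E : set TT) : measurable_fun [set: T] phi ->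
  measurable E -> measurable [set p : TT | E (p.1 + phi p.2, p.2)].
Proof.
move=> mphi mE; rewrite -[X in measurable X]setTI.
have mf : measurable_fun [set: TT] (fun p : TT => (p.1 + phi p.2, p.2) : TT).
  apply: measurable_fun_pair => //; apply: measurable_funD => //.
  by apply: measurableT_comp.
exact: mf.
Qed.

(** By Fubini, since a shear translates each section. *)
Lemma mu2_shear2 (phi : T -> R) (E : set TT) : measurable_fun [set: T] phi ->
  measurable E -> mu2 [set p : TT | E (p.1, p.2 + phi p.1)] = mu2 E.
Proof.
move=> mphi mE; rewrite /mu2 /product_measure1; apply: eq_integral => x _ /=.
rewrite -(lebesgue_translation (phi x) (measurable_xsection x mE)); congr mu.
Qed.

Lemma mu2_shear1 (phi : T -> R) (E : set TT) : measurable_fun [set: T] phi ->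
  measurable E -> mu2 [set p : TT | E (p.1 + phi p.2, p.2)] = mu2 E.
Proof.
move=> mphi mE; rewrite !mu2_ysection//; last exact: (measurable_shear1 mphi mE).
rewrite /product_measure2; apply: eq_integral => x _ /=.
rewrite -(lebesgue_translation (phi x) (measurable_ysection x mE)); congr mu.
Qed.

End PlaneMeasure.

(** * Areas of tilted rectangles *)

Section TiltedRectangles.
Variable R : realType.
Local Notation mu := (@lebesgue_measure R).
Local Notation T := (measurableTypeR R).
Local Notation TT := (T * T)%type.

Lemma measurable_affine (k c : R) : measurable_fun [set: T] (fun t : T => k * t + c).
Proof. by apply: measurable_funD => //; exact: measurable_funM. Qed.

(** [S] is the rectangle with half-sides [h1] and [h2], multiplied by [a + b i] and centred at
    [(s0, t0)]. As [a > 0], two shears reduce it to an upright rectangle with half-sides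
    [D * h1 / a] and [a * h2]. *)
Lemma tilted_rect (s0 t0 a b h1 h2 : R) : 0 < a -> 0 < h1 -> 0 < h2 ->
  let D := a ^+ 2 + b ^+ 2 in
  let S := [set p : TT | `|a * (p.1 - s0) + b * (p.2 - t0)| < D * h1 /\
                     `|a * (p.2 - t0) - b * (p.1 - s0)| < D * h2] in
  measurable S /\ mu2 S = (4 * D * h1 * h2)%:E.
Proof.
move=> a0 h10 h20 D S.
have D0 : 0 < D by rewrite /D ltr_pwDl ?exprn_gt0// sqr_ge0.
have aN : a != 0 by rewrite gt_eqF. have DN : D != 0 by rewrite gt_eqF.
pose E0 : set TT := `]-(D * h1 / a), D * h1 / a[%classic `*` `]-(a * h2), a * h2[%classic.
pose psi (s : T) : R := - (a * b / D) * s + - t0.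
pose phi (t : T) : R := b / a * t + (- (b / a * t0) - s0).
have mpsi : measurable_fun [set: T] psi by exact: measurable_affine.
have mphi : measurable_fun [set: T] phi by exact: measurable_affine.
have mE0 : measurable E0 by apply: measurableX.
pose E1 := [set p : TT | E0 (p.1, p.2 + psi p.1)].
have mE1 : measurable E1 by exact: (measurable_shear2 mpsi mE0).
have id1 (s t : R) : (s + (b / a * t + (- (b / a * t0) - s0))) * a = a * (s - s0) + b * (t - t0).
  by field.
have id2 (s t : R) : (t + (- (a * b / D) * (s + (b / a * t + (- (b / a * t0) - s0))) + - t0)) * (D / a)
    = a * (t - t0) - b * (s - s0).
  by rewrite /D; field; rewrite aN; have := DN; rewrite /D.
have SE : S = [set p : TT | E1 (p.1 + phi p.2, p.2)].
  apply/seteqP; split => -[s t] /=; rewrite /E1 /E0 /= !in_itv /= -!ltr_norml.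
    move=> [k1 k2]; split.
      rewrite ltr_pdivlMr// -(gtr0_norm a0) -normrM; apply: le_lt_trans k1.
      by apply: eq_ler; congr `|_|; rewrite /phi; first [exact: id1 | symmetry; exact: id1].
    rewrite -(ltr_pM2r (divr_gt0 D0 a0)) -(gtr0_norm (divr_gt0 D0 a0)) -normrM (gtr0_norm (divr_gt0 D0 a0)).
    have -> : a * h2 * (D / a) = D * h2 by field.
    apply: le_lt_trans k2; apply: eq_ler; congr `|_|; exact: id2.
  move=> [k1 k2]; split.
    rewrite ltr_pdivlMr// -(gtr0_norm a0) -normrM in k1; apply: le_lt_trans k1.
    by apply: eq_ler; congr `|_|; rewrite /phi; first [exact: id1 | symmetry; exact: id1].
  rewrite -(ltr_pM2r (divr_gt0 D0 a0)) -(gtr0_norm (divr_gt0 D0 a0)) -normrM (gtr0_norm (divr_gt0 D0 a0)) in k2.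
  have Eh : a * h2 * (D / a) = D * h2 by field.
  rewrite Eh in k2; apply: le_lt_trans k2; apply: eq_ler; congr `|_|; symmetry; exact: id2.
rewrite SE; split; first exact: (measurable_shear1 mphi mE1).
rewrite (mu2_shear1 mphi mE1) (mu2_shear2 mpsi mE0) /mu2 product_measure1E//=.
have p1 : 0 < D * h1 / a by rewrite divr_gt0// mulr_gt0.
have p2 : 0 < a * h2 by rewrite mulr_gt0.
rewrite !lebesgue_measure_itv/= !lte_fin !gtrN// -!EFinB -EFinM; congr EFin; field.
exact: aN.
Qed.

Lemma mu2_vshift (c : R) (E : set TT) : measurable E ->
  measurable [set p : TT | E (p.1, p.2 + c)] /\ mu2 [set p : TT | E (p.1, p.2 + c)] = mu2 E.
Proof.
move=> mE; have mc : measurable_fun [set: T] (fun=> c) by [].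
by split; [exact: (measurable_shear2 mc mE)|exact: (mu2_shear2 mc mE)].
Qed.

(** The parts of [S] outside one period are moved back by [pi *+ 2]. They do not collide with the
    rest because [S] has height less than 2 and the period is at least 4. *)
Lemma wrap_strip (S : set TT) (t0 : R) : measurable S -> 0 <= t0 < pi *+ 2 ->
  (forall p, S p -> `|p.2 - t0| < 1) ->
  exists E : set TT, [/\ measurable E, forall p, E p -> 0 <= p.2 < pi *+ 2,
    forall p, E p -> exists2 t, S (p.1, t) & cexp (cplx p.1 t) = cexp (cplx p.1 p.2) &
    (mu2 S <= mu2 E)%E].
Proof.
move=> mS tI St.
have L4 : 4 <= pi *+ 2 :> R by have := pi_ge2 R; rewrite mulr2n; lra.
have per := @cexp_period R; move: L4 per tI; move: (pi *+ 2) => L L4 per /andP[t00 t01].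
pose H (i : interval R) : set TT := [set: T] `*` [set` i].
have mH i : measurable (H i) by apply: measurableX.
have [A [mA AP]] : exists A : set TT, measurable A /\ forall p, A p <-> S p /\ p.2 < 0.
  exists (S `&` H `]-oo, 0[); split; first exact: measurableI (mH _).
  move=> p; split => [[Sp [_ /=]]|[Sp h]]; first by rewrite in_itv.
  by split=> //; split=> //=; rewrite in_itv.
have [B [mB BP]] : exists B : set TT, measurable B /\ forall p, B p <-> S p /\ 0 <= p.2 < L.
  exists (S `&` H `[0, L[); split; first exact: measurableI (mH _).
  move=> p; split => [[Sp [_ /=]]|[Sp h]]; first by rewrite in_itv.
  by split=> //; split=> //=; rewrite in_itv.
have [C [mC CP]] : exists C : set TT, measurable C /\ forall p, C p <-> S p /\ L <= p.2.
  exists (S `&` H `[L, +oo[); split; first exact: measurableI (mH _).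
  move=> p; split => [[Sp [_ /=]]|[Sp h]]; first by rewrite in_itv/= andbT.
  by split=> //; split=> //=; rewrite in_itv/= andbT.
have [mA' eA] := mu2_vshift (- L) mA.
have [mC' eC] := mu2_vshift L mC.
have [A' [A'P {}mA' {}eA]] : exists A' : set TT,
    [/\ forall p, A' p <-> A (p.1, p.2 - L), measurable A' & mu2 A' = mu2 A].
  by eexists; split; [|exact: mA'|exact: eA] => p; split.
have [C' [C'P {}mC' {}eC]] : exists C' : set TT,
    [/\ forall p, C' p <-> C (p.1, p.2 + L), measurable C' & mu2 C' = mu2 C].
  by eexists; split; [|exact: mC'|exact: eC] => p; split.
have SE : S = A `|` (B `|` C).
  apply/seteqP; split => [p Sp|p [/AP[]|[/BP[]|/CP[]]]]; try by move=> *; assumption.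
  have [h|h] := ltP p.2 0; first by left; apply/AP.
  right; have [k|k] := ltP p.2 L; first by left; apply/BP; rewrite h k.
  by right; apply/CP.
have bB p : B p -> [/\ 0 <= p.2, p.2 < L, p.2 - t0 < 1 & t0 - p.2 < 1].
  by move=> /BP[/St/ltr_normlP[h1 h2] /andP[h3 h4]]; split; lra.
have bA p : A' p -> [/\ L - 1 < p.2, p.2 < L & t0 < 1].
  by move=> /A'P/AP[/St/=/ltr_normlP[h1 h2] h3]; split; lra.
have bC p : C' p -> [/\ 0 <= p.2, p.2 < 1 & L - 1 < t0].
  by move=> /C'P/CP[/St/=/ltr_normlP[h1 h2] h3]; split; lra.
have mAC : measurable (A' `|` C') by exact: measurableU.
exists (B `|` (A' `|` C')); split.
- exact: measurableU.
- by move=> p [/bB[? ? _ _]|[/bA[? ? _]|/bC[? ? _]]]; apply/andP; split; lra.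
- move=> p [/BP[Sp _]|[/A'P/AP[Sp _]|/C'P/CP[Sp _]]].
  + by exists p.2; [case: p Sp|].
  + by exists (p.2 - L); [exact: Sp|rewrite -per subrK].
  + by exists (p.2 + L); [exact: Sp|rewrite per].
have dAC : A' `&` C' = set0.
  by apply/seteqP; split => p // [/bA[? _ _] /bC[_ ? _]]; exfalso; lra.
have dB : B `&` (A' `|` C') = set0.
  apply/seteqP; split => p // [/bB[? ? ? ?] [/bA[? ? ?]|/bC[? ? ?]]]; exfalso; lra.
have -> : mu2 (B `|` (A' `|` C')) = (mu2 B + mu2 (A' `|` C'))%E by exact: measureU.
have -> : mu2 (A' `|` C') = (mu2 A' + mu2 C')%E by exact: measureU.
rewrite eA eC SE.
have mBC : measurable (B `|` C) by exact: measurableU.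
have h1 : (mu2 (A `|` (B `|` C)) <= mu2 A + mu2 (B `|` C))%E by exact: measureU2.
have h2 : (mu2 (B `|` C) <= mu2 B + mu2 C)%E by exact: measureU2.
by apply: le_trans h1 _; rewrite [leRHS]addeCA; exact: leeD2l.
Qed.

End TiltedRectangles.

(** * Logarithms and expansion of the logarithm of the modulus *)

Section LogArea.
Variable R : realType.
Local Notation C := R[i].
Local Notation T := (measurableTypeR R).
Local Notation TT := (T * T)%type.

Lemma polar_angle (c s : R) : c ^+ 2 + s ^+ 2 = 1 ->
  exists2 t : R, 0 <= t < pi *+ 2 & cos t = c /\ sin t = s.
Proof.
move=> cs; have c1 : -1 <= c <= 1.
  rewrite -ler_norml -(@ler_pXn2r _ 2) ?nnegrE// expr1n real_normK ?num_real//.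
  by rewrite -cs lerDl sqr_ge0.
have cI : c \in `[-1, 1] by rewrite in_itv.
have ac := acosK cI; have sa := sin_acos c1.
have se : Num.sqrt (1 - c ^+ 2) = `|s|.
  by rewrite (_ : 1 - c ^+ 2 = s ^+ 2) ?sqrtr_sqr//; move: cs; clear; lra.
have a0 := acos_ge0 c1; have api := acos_lepi c1; have p0 := pi_gt0 R.
have [s0|s0] := leP 0 s.
  exists (acos c); last by rewrite ac sa se ger0_norm.
  by rewrite a0 mulr2n; move: p0 api; clear; lra.
exists (pi *+ 2 - acos c); last first.
  rewrite addrC cosD2pi sinD2pi cosN sinN ac sa se ltr0_norm//; split=> //; exact: opprK.
have an : 0 < acos c.
  rewrite lt_neqAle a0 andbT; apply/negP => /eqP h.
  move: sa; rewrite -h sin0 se => /esym/normr0P/eqP h2; by rewrite h2 ltxx in s0.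
by apply/andP; split; move: an api p0; rewrite mulr2n; clear; lra.
Qed.

Lemma clog_exists (z : C) : z != 0 ->
  exists2 w, cexp w = z & 0 <= complex.Im w < pi *+ 2.
Proof.
rewrite -cabs_gt0 => z0; have zn : cabs z != 0 by rewrite gt_eqF.
have [|t tI [ct st]] := @polar_angle (complex.Re z / cabs z) (complex.Im z / cabs z).
  by rewrite !expr_div_n -mulrDl -sqr_cabs mulfV// expf_neq0.
exists (cplx (ln (cabs z)) t) => //.
rewrite /cexp /= ct st lnK ?posrE// ![cabs z * _]mulrC !mulfVK//.
by case: (z).
Qed.

(** Here [2 * ln |1 + z| = ln (1 + u)] with [u = 2 * Re z + |z| ^+ 2], and [ln (1 + u)] lies between
    [u - 2 * u ^+ 2] and [u]. *)
Lemma ln_cabs_near1 (z : C) : cabs z <= 6^-1 ->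
  `|ln (cabs (1 + z)) - complex.Re z| <= 10 * cabs z ^+ 2.
Proof.
move=> z6; pose u := 2 * complex.Re z + cabs z ^+ 2.
have z0 := cabs_ge0 z; have Rz := ler_Re_cabs z.
have zz : cabs z ^+ 2 <= cabs z * 6^-1 by rewrite expr2 ler_wpM2l.
have z2 : 0 <= cabs z ^+ 2 by rewrite sqr_ge0.
have ub : `|u| <= 3 * cabs z.
  apply: le_trans (ler_normD _ _) _; rewrite normrM normr_nat (ger0_norm z2).
  by move: zz Rz z0 z2; clear; lra.
have uE : cabs (1 + z) ^+ 2 = 1 + u.
  by rewrite /u !sqr_cabs cReD cImD /=; ring.
have u1 : 0 < 1 + u by move: ub z6 => /ler_normlP[]; clear; lra.
have c1 : 0 < cabs (1 + z).
  rewrite lt_neqAle cabs_ge0 andbT; apply/negP => /eqP h.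
  by move: u1; rewrite -uE -h expr0n ltxx.
have lnE : 2 * ln (cabs (1 + z)) = ln (1 + u).
  by rewrite -uE lnXn// mulr_natl.
have l1 : ln (1 + u) <= u.
  have := le_ln1Dx (x := u); apply; move: u1; clear; lra.
have l2 : - ln (1 + u) <= (1 + u)^-1 - 1.
  rewrite -lnV ?posrE//; have := @le_ln1Dx R ((1 + u)^-1 - 1); rewrite subrKC; apply.
  have : 0 < (1 + u)^-1 by rewrite invr_gt0.
  by clear; lra.
have l3 : (1 + u)^-1 - 1 <= - u + 2 * u ^+ 2.
  rewrite lerBlDr -[leLHS]mul1r ler_pdivrMr// -subr_ge0.
  have -> : (- u + 2 * u ^+ 2 + 1) * (1 + u) - 1 = u ^+ 2 * (1 + 2 * u) by ring.
  apply: mulr_ge0; first exact: sqr_ge0.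
  by move: ub z6 => /ler_normlP[]; clear; lra.
have u2 : u ^+ 2 <= 9 * cabs z ^+ 2.
  by rewrite -[u ^+ 2]real_normK ?num_real// (_ : 9 * _ = (3 * cabs z) ^+ 2);
    [rewrite lerXn2r ?nnegrE ?mulr_ge0|ring].
by rewrite ler_norml; move: l1 l2 l3 u2 z2; rewrite -lnE /u; clear; lra.
Qed.

Lemma ln_cabs_dif (g : C -> C) (z0 k : C) : g z0 != 0 -> dif g z0 k ->
  forall e : R, 0 < e -> exists2 r : R, 0 < r & forall z, cabs (z - z0) < r ->
    `|ln (cabs (g z)) - ln (cabs (g z0)) - complex.Re (k / g z0 * (z - z0))|
      <= e * cabs (z - z0).
Proof.
move=> g0 Hk e e0; have G0 : 0 < cabs (g z0) by rewrite cabs_gt0.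
have [r1 r10 H1] := Hk (e / 2 * cabs (g z0)) ltac:(by rewrite mulr_gt0 ?divr_gt0).
have [r2 r20 H2] := dif_lip Hk.
pose L := (cabs k + 1) / cabs (g z0).
have L0 : 0 < L by rewrite divr_gt0// ltr_wpDl// cabs_ge0.
(* The first bound gives [|t| <= 6^-1], the second makes the quadratic error [10 * |t| ^+ 2] at most
   half of [e * |z - z0|]. *)
pose r3 := Num.min (6^-1 / L) (e / 20 / L ^+ 2).
have r30 : 0 < r3.
  rewrite lt_min; apply/andP; split; apply: divr_gt0 => //.
    exact: divr_gt0.
  exact: exprn_gt0.
exists (Num.min r3 (Num.min r1 r2)); first by rewrite lt_min r30 lt_min r10.
move=> z; rewrite lt_min => /andP[]; rewrite lt_min => /andP[d1 d2].
rewrite lt_min => /andP[/H1 h1 /H2 h2].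
pose t := (g z - g z0) / g z0; set D := cabs (z - z0) in d1 d2 h1 h2 *.
have D0 : 0 <= D by exact: cabs_ge0.
have tL : cabs t <= L * D.
  by rewrite /t cabsM cabsV ler_pdivrMr// /L mulrAC mulfVK ?gt_eqF.
have t6 : cabs t <= 6^-1.
  by apply: le_trans tL _; rewrite mulrC -ler_pdivlMr// ltW.
have gE : g z = g z0 * (1 + t) by rewrite /t; field.
have t1 : 0 < cabs (1 + t).
  have := ler_sub_cabs 1 (- t); rewrite cabsN cabs1 opprK; move: t6; clear; lra.
have -> : ln (cabs (g z)) = ln (cabs (g z0)) + ln (cabs (1 + t)).
  by rewrite gE cabsM lnM ?posrE.
rewrite [X in `|X|](_ : _ = (ln (cabs (1 + t)) - complex.Re t)
    + complex.Re (t - k / g z0 * (z - z0))); last by rewrite cReB; ring.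
apply: le_trans (ler_normD _ _) _; rewrite [leRHS](splitr (e * D)) lerD//.
  apply: le_trans (ln_cabs_near1 t6) _.
  apply: (@le_trans _ _ (10 * (L * D) ^+ 2)).
    by rewrite ler_wpM2l// lerXn2r// ?nnegrE ?cabs_ge0// mulr_ge0 ?(ltW L0).
  rewrite ltr_pdivlMr ?exprn_gt0// in d2.
  by have := ler_wpM2r D0 (ltW d2); clear; lra.
apply: le_trans (ler_Re_cabs _) _.
have -> : t - k / g z0 * (z - z0) = (g z - g z0 - k * (z - z0)) / g z0 by rewrite /t; ring.
by rewrite cabsM cabsV ler_pdivrMr//; apply: le_trans h1 _; apply: eq_ler; ring.
Qed.

End LogArea.

(** * Logarithmic area of images of rectangles *)

Section AreaOfImages.
Variable R : realType.
Local Notation C := R[i].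
Local Notation T := (measurableTypeR R).
Local Notation TT := (T * T)%type.
Implicit Types (g : C -> C).

(* [I] has area at least [m] for the metric [|dw / w|]. A measurable set of
   logarithms of points of [I] is exhibited so that [I] need not be measurable. *)
Definition area_ge (I : set C) (m : R) := exists E : set TT,
  [/\ measurable E, forall p, E p -> 0 <= p.2 < pi *+ 2,
    forall p, E p -> I (cexp (cplx p.1 p.2)) & (m%:E <= mu2 E)%E].

Definition orect (a b c d : R) : set C :=
  [set z | a < complex.Re z < b /\ c < complex.Im z < d].

(* By [affine_hits], the image of a small rectangle under [log g] contains a
   slightly shrunk copy of its image under the affine part of [log g]. *)
Lemma tilted_area g (z0 k : C) (s0 w h kappa : R) : 0 < s0 -> hol g z0 s0 ->
  g z0 != 0 -> dif g z0 k -> 0 < complex.Re (k / g z0) -> 0 < w -> 0 < h ->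
  0 < kappa -> kappa < 1 ->
  exists2 r : R, 0 < r & forall l x0 y0, 0 < l -> l < r ->
    x0 <= complex.Re z0 <= x0 + l * w -> y0 <= complex.Im z0 <= y0 + l * h ->
    area_ge (g @` orect x0 (x0 + l * w) y0 (y0 + l * h))
      ((1 - kappa) ^+ 2 * cabs (k / g z0) ^+ 2 * (l * w) * (l * h)).
Proof.
move=> s00 Hg g0 Hk; set q := k / g z0 => a0 w0 h0 k0 k1.
have [W0 eW0 tW0] := clog_exists g0.
have kq : k = g z0 * q by rewrite /q mulrCA mulfV// mulr1.
have qn : q != 0 by apply/eqP => q0; move: a0; rewrite q0 ltxx.
have kn : 0 < cabs k by rewrite cabs_gt0 kq mulf_neq0.
pose N := w + h; have N0 : 0 < N by rewrite addr_gt0.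
pose mn := Num.min w h; have mn0 : 0 < mn by rewrite lt_min w0.
have mnw : mn <= w by rewrite ge_min lexx.
have mnh : mn <= h by rewrite ge_min lexx orbT.
(* Chosen so that [|k| * rho = 8 * (e2 * lN)] for the margin [rho] below, while [affine_hits] needs
   only that it exceed [4 * (e2 * lN)]. *)
pose e2 := cabs k * kappa * mn / (16 * N).
have e20 : 0 < e2 by rewrite divr_gt0 ?mulr_gt0.
have [r2 r20 H2] := Hk e2 e20.
(* The model [cexp (W0 + q * (z - z0))] is tangent to [g] at [z0], and its logarithm is affine. Its
   values on the shrunk rectangle are found as values of [g] within the margin [rho]. *)
have DG : dif (fun z => cexp (W0 + q * (z - z0))) z0 k.
  have D1 : dif (fun z => W0 + q * (z - z0)) z0 (0 + q * (1 - 0)).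
    by apply: difD (dif_cst _ _) _; apply: difZ; apply: difB (dif_id _) (dif_cst _ _).
  have := dif_comp D1 (dif_cexp _); rewrite subrr mulr0 addr0 eW0 add0r subr0 mulr1.
  by rewrite -kq.
have [r3 r30 H3] := DG e2 e20.
(* This keeps the affine image within distance 1 of its base height, as [wrap_strip] requires. *)
pose r4 := (cabs q + 1)^-1.
have Q1 : 0 < cabs q + 1 by rewrite ltr_wpDl// cabs_ge0.
have r40 : 0 < r4 by rewrite invr_gt0.
exists (Num.min (Num.min r2 r3) (Num.min r4 (s0 / 2)) / N).
  by rewrite divr_gt0// !lt_min r20 r30 r40 divr_gt0.
move=> l x0 y0 l0; rewrite ltr_pdivlMr// lt_min => /andP[].
rewrite lt_min => /andP[l2 l3]; rewrite lt_min => /andP[l4 l5] xI yI.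
set lN := l * N in l2 l3 l4 l5.
have lNE : lN = l * w + l * h by rewrite /lN /N mulrDr.
set a := complex.Re q in a0; set b := complex.Im q.
pose h1 := (1 - kappa) * (l * w) / 2; pose h2 := (1 - kappa) * (l * h) / 2.
have lw0 : 0 < l * w by rewrite mulr_gt0.
have lh0 : 0 < l * h by rewrite mulr_gt0.
have k1' : 0 < 1 - kappa by rewrite subr_gt0.
have h10 : 0 < h1 by rewrite !mulr_gt0// invr_gt0.
have h20 : 0 < h2 by rewrite !mulr_gt0// invr_gt0.
pose zc := cplx (x0 + l * w / 2) (y0 + l * h / 2).
pose Wc := W0 + q * (zc - z0).
have [] := @tilted_rect R (complex.Re Wc) (complex.Im Wc) a b h1 h2 a0 h10 h20.
set D := a ^+ 2 + b ^+ 2; set S := [set p | _] => mS eS.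
have DE : D = cabs q ^+ 2 by rewrite sqr_cabs.
have D0 : 0 < D by rewrite DE exprn_gt0// cabs_gt0.
have near z : x0 <= complex.Re z <= x0 + l * w -> y0 <= complex.Im z <= y0 + l * h ->
    cabs (z - z0) <= lN.
  move=> zx zy; apply: le_trans (cabs_leD _) _; rewrite cReB cImB lNE.
  by move: zx xI zy yI; clear => *; apply: lerD; rewrite ler_norml; lra.
have param p : S p -> exists z, [/\ cplx p.1 p.2 = W0 + q * (z - z0),
    `|complex.Re z - (x0 + l * w / 2)| < h1 & `|complex.Im z - (y0 + l * h / 2)| < h2].
  case: p => s t [/=]; set A := a * _ + _; set B := a * _ - _ => S1 S2.
  have DN : D != 0 by rewrite gt_eqF.
  exists (zc + cplx (A / D) (B / D)); split.
  - have -> : W0 + q * (zc + cplx (A / D) (B / D) - z0) = Wc + q * cplx (A / D) (B / D).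
      by rewrite /Wc; ring.
    apply/eqP; rewrite eq_complex; apply/andP; split; apply/eqP.
      rewrite cReD cReM -/a -/b !cReE cImE.
      rewrite (_ : a * (A / D) - b * (B / D) = s - complex.Re Wc) ?subrKC//.
      rewrite /A /B; move: (complex.Re Wc) (complex.Im Wc) DN => u v DN; rewrite /D in DN *.
      by field.
    rewrite cImD cImM -/a -/b !cImE cReE.
    rewrite (_ : a * (B / D) + b * (A / D) = t - complex.Im Wc) ?subrKC//.
    rewrite /A /B; move: (complex.Re Wc) (complex.Im Wc) DN => u v DN; rewrite /D in DN *.
    by field.
  - rewrite cReD !cReE addrAC subrr add0r.
    by rewrite normrM normfV (gtr0_norm D0) ltr_pdivrMr// mulrC.
  - rewrite cImD !cImE addrAC subrr add0r.
    by rewrite normrM normfV (gtr0_norm D0) ltr_pdivrMr// mulrC.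
have h1w : h1 <= l * w / 2.
  rewrite ler_pdivrMr// mulfVK//; apply: ler_piMl; [exact: ltW|by rewrite gerBl ltW].
have h2h : h2 <= l * h / 2.
  rewrite ler_pdivrMr// mulfVK//; apply: ler_piMl; [exact: ltW|by rewrite gerBl ltW].
have inrect z : `|complex.Re z - (x0 + l * w / 2)| < h1 ->
    `|complex.Im z - (y0 + l * h / 2)| < h2 -> cabs (z - z0) <= lN.
  move=> /ltr_normlP[u1 u2] /ltr_normlP[v1 v2]; apply: near.
    by move: u1 u2 h1w; clear; lra.
  by move: v1 v2 h2h; clear; lra.
have [] := @wrap_strip R S (complex.Im W0) mS tW0.
  move=> p /param[z [pE zx zy]]; have zn := inrect z zx zy.
  have -> : p.2 = complex.Im (cplx p.1 p.2) by [].
  rewrite -cImB; apply: le_lt_trans (ler_Im_cabs _) _.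
  rewrite pE addrAC subrr add0r cabsM.
  apply: le_lt_trans (ler_wpM2l (cabs_ge0 _) zn) _.
  move: l4; rewrite /r4 -[X in _ < X]mul1r ltr_pdivlMr// => l4.
  apply: le_lt_trans l4; rewrite mulrC ler_wpM2l ?lerDl// ltW// mulr_gt0//.
move=> E [mE E1 E2 E3]; exists E; split=> //; last first.
  apply: le_trans E3; rewrite eS lee_fin -DE; apply: eq_ler.
  by rewrite /h1 /h2; field.
move=> p Ep; have [t St <-] := E2 p Ep.
have [z [/= -> zx zy]] := param _ St; have zn := inrect z zx zy.
pose rho := kappa * (l * mn) / 2.
have lmn0 : 0 < l * mn by rewrite mulr_gt0.
have rho0 : 0 < rho by rewrite divr_gt0// mulr_gt0.
have rw : rho <= kappa * (l * w) / 2.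
  by rewrite ler_pM2r ?invr_gt0// !ler_pM2l.
have rh : rho <= kappa * (l * h) / 2.
  by rewrite ler_pM2r ?invr_gt0// !ler_pM2l.
have inS z' : cabs (z' - z) <= rho -> x0 <= complex.Re z' <= x0 + l * w /\ y0 <= complex.Im z' <= y0 + l * h.
  move=> zz; have := le_trans (ler_Re_cabs _) zz; have := le_trans (ler_Im_cabs _) zz.
  rewrite cReB cImB => /ler_normlP[+ +] /ler_normlP[+ +]; move: zx zy => /ltr_normlP[+ +] /ltr_normlP[+ +].
  rewrite /h1 /h2; move: rw rh; clear => *; split; apply/andP; split; lra.
have rs : rho < s0 - lN.
  have : rho <= lN by move: rw k1 lw0 lh0; rewrite lNE; clear; nra.
  by have : rho <= kappa * (l * w) / 2 by []; move: l5 rw k1 lw0 lh0 k0; rewrite lNE; clear; nra.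
have Hz : hol g z (s0 - lN).
  move=> u uz; apply: Hg; have := cabs_triangle u z z0; move: uz zn; clear; lra.
have [||z' z'r <-] := @affine_hits R g z k (cexp (W0 + q * (z - z0))) rho (s0 - lN) (2 * (e2 * lN)) rho0 rs Hz.
- move=> u ur; have [ux uy] := inS u ur; have un := near u ux uy.
  have A1 := H2 u (le_lt_trans un l2); have A2 := H3 z (le_lt_trans zn l3).
  rewrite subrr mulr0 addr0 eW0 in A2.
  have -> : g u - cexp (W0 + q * (z - z0)) - k * (u - z) =
    (g u - g z0 - k * (u - z0)) - (cexp (W0 + q * (z - z0)) - g z0 - k * (z - z0)) by ring.
  apply: le_trans (ler_cabsB _ _) _.
  have B1 := ler_wpM2l (ltW e20) un; have B2 := ler_wpM2l (ltW e20) zn.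
  by move: A1 A2 B1 B2; clear; lra.
- have -> : cabs k * rho = 8 * (e2 * lN).
    by rewrite /rho /e2 /lN; field; rewrite gt_eqF.
  have : 0 < e2 * lN by apply: mulr_gt0 => //; exact: mulr_gt0.
  by clear; lra.
have [ux uy] := inS z' (ltW z'r).
exists z' => //; split.
  have := le_lt_trans (ler_Re_cabs _) z'r; rewrite cReB => /ltr_normlP[+ +].
  move: zx => /ltr_normlP[+ +]; rewrite /h1; move: rw; clear => *; apply/andP; split; lra.
have := le_lt_trans (ler_Im_cabs _) z'r; rewrite cImB => /ltr_normlP[+ +].
move: zy => /ltr_normlP[+ +]; rewrite /h2; move: rh; clear => *; apply/andP; split; lra.
Qed.

End AreaOfImages.

Section AreaOfRectangleImages.
Variable R : realType.
Local Notation C := R[i].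
Local Notation T := (measurableTypeR R).
Local Notation TT := (T * T)%type.
Implicit Types (g : C -> C) (I J : set C).

Lemma area_ge_le0 I (m : R) : m <= 0 -> area_ge I m.
Proof.
by move=> m0; exists set0; split=> //; rewrite measure0 lee_fin.
Qed.

Lemma area_geS I J (m n : R) : I `<=` J -> n <= m -> area_ge I m -> area_ge J n.
Proof.
move=> IJ nm [E [h1 h2 h3 h4]]; exists E; split=> //; first by move=> p /h3 /IJ.
by apply: le_trans h4; rewrite lee_fin.
Qed.

Lemma area_geU I J (m n : R) : I `&` J = set0 -> area_ge I m -> area_ge J n ->
  area_ge (I `|` J) (m + n).
Proof.
move=> IJ [E [E1 E2 E3 E4]] [F [F1 F2 F3 F4]].
have EF : E `&` F = set0.
  apply/seteqP; split => // p [/E3 h1 /F3 h2].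
  by have : (I `&` J) (cexp (cplx p.1 p.2)) by []; rewrite IJ.
exists (E `|` F); split.
- exact: measurableU.
- by move=> p [/E2|/F2].
- by move=> p [/E3|/F3]; [left|right].
have -> : mu2 (E `|` F) = (mu2 E + mu2 F)%E by exact: measureU.
by rewrite EFinD; exact: leeD.
Qed.

Lemma area_ge_bound I (m a b : R) : a <= b -> area_ge I m ->
  (forall z, I z -> a <= ln (cabs z) <= b) -> m <= (b - a) * (pi *+ 2).
Proof.
move=> ab [E [E1 E2 E3 E4]] H; have p0 : 0 <= pi *+ 2 :> R by rewrite mulrn_wge0// pi_ge0.
rewrite -lee_fin; apply: le_trans E4 _.
have := mu2_rect ab p0; rewrite subr0 => <-.
apply: le_measure; rewrite ?inE//.
  by apply: measurableX.
move=> p Ep; have := H _ (E3 p Ep); rewrite cabs_cexp expRK => h.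
have /andP[h1 h2] := E2 p Ep.
by split; rewrite /= in_itv/= ?h// h1 ltW.
Qed.

(** Its increment in [x] is the integral of [2 * Re q - 1], where [q] is the logarithmic derivative
    of [g]. *)
Definition logmod g (x y : R) : R := 2 * ln (cabs (g (cplx x y))) - x.

Lemma ln_cabs_cont g z : g z != 0 -> (exists2 s, 0 < s & hol g z s) ->
  forall e : R, 0 < e -> exists2 r : R, 0 < r & forall u, cabs (u - z) < r ->
    `|ln (cabs (g u)) - ln (cabs (g z))| < e.
Proof.
move=> g0 [s s0 Hs] e e0.
have [|k Hk] := Hs z; first by rewrite subrr cabs0.
have [r r0 Hr] := ln_cabs_dif g0 Hk ltr01.
set q := k / g z in Hr; pose L := cabs q + 1.
have L0 : 0 < L by rewrite ltr_wpDl// cabs_ge0.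
exists (Num.min r (e / L)); first by rewrite lt_min r0 divr_gt0.
move=> u; rewrite lt_min => /andP[ur]; rewrite ltr_pdivlMr// => ue.
have h1 := Hr u ur; rewrite mul1r in h1.
have h2 := ler_Re_cabs (q * (u - z)); rewrite cabsM in h2.
rewrite -[X in `|X|](subrK (complex.Re (q * (u - z)))).
apply: le_lt_trans (ler_normD _ _) _; apply: le_lt_trans ue.
by move: h1 h2; rewrite /L; clear; lra.
Qed.

Lemma logmod_cont g (x c d : R) : (forall y, c <= y <= d -> g (cplx x y) != 0 /\
    exists2 s, 0 < s & hol g (cplx x y) s) -> rcont c d (logmod g x).
Proof.
move=> Hg y yI e e0; have [g0 Hs] := Hg y yI.
have [r r0 Hr] := ln_cabs_cont g0 Hs (divr_gt0 e0 (ltr0n R 2)).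
exists r => // y' _ yr; have := Hr (cplx x y').
rewrite cplxB subrr cabsE /= expr0n add0r sqrtr_sqr => /(_ yr) h.
rewrite /logmod opprB addrA subrK -mulrBr normrM normr_nat; move: h; clear; lra.
Qed.

(* On small rectangles [log g] is nearly affine with slope [q], of area factor
   [`|q| ^+ 2 >= 2 * Re q - 1]; both sides are additive under subdivision. *)
Lemma rect_area g (a b c d eta : R) : a < b -> c < d -> 0 < eta ->
  (forall x y, a <= x <= b -> c <= y <= d ->
    g (cplx x y) != 0 /\ exists2 s, 0 < s & hol g (cplx x y) s) ->
  (forall z z', orect a b c d z -> orect a b c d z' -> g z = g z' -> z = z') ->
  area_ge (g @` orect a b c d)
    (rint c d (logmod g b) - rint c d (logmod g a) - eta * ((b - a) * (d - c))).
Proof.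
move=> ab cd eta0 Hg inj.
have cv x y0 y1 : a <= x <= b -> c <= y0 -> y1 <= d -> rcont y0 y1 (logmod g x).
  by move=> xI h0 h1; apply: (rcontS h0 h1); apply: logmod_cont => y; exact: Hg.
apply: (@rect_induction _ (fun x0 x1 y0 y1 => area_ge (g @` orect x0 x1 y0 y1)
  (rint y0 y1 (logmod g x1) - rint y0 y1 (logmod g x0) - eta * ((x1 - x0) * (y1 - y0)))) a b c d) => //.
- move=> x0 x1 x2 y0 y1 ax0 x01 x12 x2b cy0 y01 y1d P1 P2.
  have D : (g @` orect x0 x1 y0 y1) `&` (g @` orect x1 x2 y0 y1) = set0.
    apply/seteqP; split => // _ [[z [zx zy] <-] [z' [zx' zy'] /inj E]].
    suff: z' = z by move=> zz; move: zx zx'; rewrite zz; clear; lra.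
    apply: E; split; move: zx zy zx' zy' ax0 x01 x12 x2b cy0 y01 y1d; clear; lra.
  apply: area_geS (area_geU D P1 P2); last by apply: eq_ler; ring.
  move=> _ [[z [zx zy] <-]|[z [zx zy] <-]]; exists z => //; split=> //;
    move: zx x01 x12; clear; lra.
- move=> x0 x1 y0 y1 y2 ax0 x01 x1b cy0 y01 y12 y2d P1 P2.
  have D : (g @` orect x0 x1 y0 y1) `&` (g @` orect x0 x1 y1 y2) = set0.
    apply/seteqP; split => // _ [[z [zx zy] <-] [z' [zx' zy'] /inj E]].
    suff: z' = z by move=> zz; move: zy zy'; rewrite zz; clear; lra.
    apply: E; split; move: zx zy zx' zy' ax0 x01 x1b y12 cy0 y01 y2d; clear; lra.
  apply: area_geS (area_geU D P1 P2).
    move=> _ [[z [zx zy] <-]|[z [zx zy] <-]]; exists z => //; split=> //;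
      move: zy y01 y12; clear; lra.
  have y02 := lt_trans y01 y12.
  rewrite !(rint_split (ltW y01) (ltW y12)); first (apply: eq_ler; ring).
    by apply: cv => //; move: ax0 x01 x1b; clear; lra.
  by apply: cv => //; move: ax0 x01 x1b; clear; lra.
move=> x y xI yI; set w := b - a; set h := d - c.
have w0 : 0 < w by rewrite subr_gt0.
have h0 : 0 < h by rewrite subr_gt0.
pose N := w + h; have N0 : 0 < N by rewrite addr_gt0.
(* The error [e * (l * N)] is [eta * (l * w) / 8]; it occurs at two ends and is doubled in [logmod],
   which makes [eta / 2] per unit area. *)
pose e := eta * w / (8 * N).
have e0 : 0 < e by rewrite divr_gt0 ?mulr_gt0.
have [g0 [s s0 Hs]] := Hg x y xI yI.
have [|k Hk] := Hs (cplx x y); first by rewrite subrr cabs0.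
have [r r0 Hr] := ln_cabs_dif g0 Hk e0.
set z0 := cplx x y in Hk Hr g0 Hs; set q := k / g z0 in Hr.
set al := complex.Re q.
have upper l x0 y0 : 0 < l -> l * N < r -> a <= x0 -> x0 <= x -> x <= x0 + l * w -> x0 + l * w <= b ->
    c <= y0 -> y0 <= y -> y <= y0 + l * h -> y0 + l * h <= d ->
    rint y0 (y0 + l * h) (logmod g (x0 + l * w)) - rint y0 (y0 + l * h) (logmod g x0)
      <= (2 * al - 1 + eta / 2) * (l * w) * (l * h).
  move=> l0 lr ax0 x0x xx1 x1b cy0 y0y yy1 y1d.
  have lw0 : 0 < l * w by rewrite mulr_gt0.
  have lh0 : 0 < l * h by rewrite mulr_gt0.
  have c1 : rcont y0 (y0 + l * h) (logmod g (x0 + l * w)).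
    by apply: cv => //; move: ax0 lw0 x1b; clear; lra.
  have c0 : rcont y0 (y0 + l * h) (logmod g x0).
    by apply: cv => //; move: ax0 lw0 x1b; clear; lra.
  rewrite -rintB//; set K := (2 * al - 1 + eta / 2) * (l * w).
  have := @rint_cst R y0 (y0 + l * h) K.
  rewrite addrAC subrr add0r => <-; last by rewrite lerDl ltW.
  apply: rint_le; [exact: rcontB|exact: rcont_cst|] => t /andP[t0 t1].
  have E x' : x0 <= x' <= x0 + l * w ->
      `|ln (cabs (g (cplx x' t))) - ln (cabs (g z0)) - complex.Re (q * (cplx x' t - z0))|
        <= e * (l * N).
    move=> x'I; have D : cabs (cplx x' t - z0) <= l * N.
      apply: le_trans (cabs_leD _) _; rewrite cplxB cReE cImE mulrDr.
      by apply: lerD; rewrite ler_norml; move: x'I x0x xx1 t0 t1 y0y yy1; clear; lra.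
    apply: le_trans (Hr _ (le_lt_trans D lr)) _; rewrite ler_wpM2l// ltW//.
  have /ler_normlP[_ E1] := E (x0 + l * w) ltac:(by rewrite lexx lerDl ltW).
  have /ler_normlP[E2 _] := E x0 ltac:(by rewrite lexx lerDl ltW).
  have Eq : complex.Re (q * (cplx (x0 + l * w) t - z0)) - complex.Re (q * (cplx x0 t - z0)) = al * (l * w).
    by rewrite /z0 !(cReM q) !cplxB !cReE !cImE /al; ring.
  have Ee : e * (l * N) = eta * (l * w) / 8 by rewrite /e; field; rewrite gt_eqF.
  rewrite Ee in E1 E2; rewrite /logmod /K.
  by move: E1 E2 Eq; clear; lra.
(* If [2 * Re q <= 1], the claimed area is not positive; otherwise [Re q > 0] and [tilted_area]
   applies. *)
have [al1|al1] := leP (2 * al) 1.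
  exists (r / N); first by rewrite divr_gt0.
  move=> l x0 y0 l0; rewrite ltr_pdivlMr// => lr h1 h2 h3 h4 h5 h6 h7 h8.
  apply: area_ge_le0; rewrite subr_le0.
  apply: le_trans (upper l x0 y0 l0 lr h1 h2 h3 h4 h5 h6 h7 h8) _.
  have -> : eta * ((x0 + l * w - x0) * (y0 + l * h - y0)) = eta * (l * w) * (l * h) by ring.
  rewrite ler_pM2r ?mulr_gt0// ler_pM2r ?mulr_gt0//.
  by move: al1 eta0; clear; lra.
pose be := 2 * al - 1; have be0 : 0 < be by rewrite subr_gt0.
(* Shrinking costs at most [2 * kappa * be <= eta / 2], the half of [eta] that the linearisation
   leaves over. *)
pose kappa := Num.min (2^-1) (eta / (4 * be)).
have ka0 : 0 < kappa by rewrite lt_min invr_gt0 ltr0n divr_gt0 ?mulr_gt0.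
have ka1 : kappa < 1.
  by apply: (@le_lt_trans _ _ 2^-1); [rewrite ge_min lexx|clear; lra].
have kb : kappa * be <= eta / 4.
  have : kappa <= eta / (4 * be) by rewrite ge_min lexx orbT.
  rewrite ler_pdivlMr ?mulr_gt0//; clear; lra.
have al0 : 0 < complex.Re (k / g z0) by move: al1; rewrite /al /q; clear; lra.
have [r' r'0 Hr'] := @tilted_area R g z0 k s w h kappa s0 Hs g0 Hk al0 w0 h0 ka0 ka1.
exists (Num.min (r / N) r'); first by rewrite lt_min r'0 divr_gt0.
move=> l x0 y0 l0; rewrite lt_min ltr_pdivlMr// => /andP[lr lr'] h1 h2 h3 h4 h5 h6 h7 h8.
have := Hr' l x0 y0 l0 lr'; rewrite /z0 cReE cImE h2 h3 h6 h7 => /(_ isT isT).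
apply: area_geS => //; rewrite -/z0 -/q.
have := upper l x0 y0 l0 lr h1 h2 h3 h4 h5 h6 h7 h8.
set M := _ - _ => MU.
have -> : eta * ((x0 + l * w - x0) * (y0 + l * h - y0)) = eta * ((l * w) * (l * h)) by ring.
rewrite lerBlDr; apply: le_trans MU _.
rewrite [leRHS](_ : _ = ((1 - kappa) ^+ 2 * cabs q ^+ 2 + eta) * (l * w) * (l * h)); last by ring.
have lh0 : 0 < l * h by rewrite mulr_gt0.
have lw0 : 0 < l * w by rewrite mulr_gt0.
rewrite (ler_pM2r lh0) (ler_pM2r lw0).
have qa : be <= cabs q ^+ 2.
  rewrite sqr_cabs -/al; have := sqr_ge0 (complex.Im q); have := sqr_ge0 (al - 1).
  by rewrite /be sqrrB; clear; lra.
have : (1 - 2 * kappa) * be <= (1 - kappa) ^+ 2 * cabs q ^+ 2.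
  apply: le_trans (ler_wpM2l (sqr_ge0 _) qa); rewrite ler_pM2r//.
  by rewrite sqrrB expr1n mul1r; have := sqr_ge0 kappa; clear; lra.
by move: kb; rewrite /be; clear; lra.
Qed.

End AreaOfRectangleImages.

(** * The length-area inequality *)

Section LengthArea.
Variable R : realType.
Local Notation C := R[i].
Implicit Types (g : C -> C) (z : C).

Lemma cexp_inj z z' : `|complex.Im z - complex.Im z'| < pi *+ 2 -> cexp z = cexp z' -> z = z'.
Proof.
move=> zz E; have : cexp (z - z') = 1 by rewrite cexpB E mulfV// cexp_neq0.
have Er : expR (complex.Re z) = expR (complex.Re z') by rewrite -!cabs_cexp E.
have re : complex.Re z = complex.Re z' by apply: expR_inj.
move=> /(congr1 (@complex.Re R)); rewrite /cexp cReE cReB cImB re subrr expR0 mul1r /=.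
set d := complex.Im z - complex.Im z' in zz * => cd.
have [d0|d0] := eqVneq d 0.
  by apply/eqP; rewrite eq_complex re eqxx -subr_eq0 -/d d0 eqxx.
exfalso; have n0 : 0 < `|d| by rewrite normr_gt0.
have : 0 < sin (`|d| / 2).
  by apply: sin_gt0_pi; move: zz n0; rewrite mulr2n; clear; lra.
have : cos (`|d| / 2 *+ 2) = 1 by rewrite -mulr_natr mulfVK// cos_norm.
rewrite cos_mulr2n; have := cos2Dsin2 (`|d| / 2); clear => h1 h2 h3.
have : 0 < sin (`|d| / 2) ^+ 2 by rewrite exprn_gt0.
by move: h1 h2; rewrite mulr2n; clear; lra.
Qed.

Definition strip_image (O1 O2 : set C) (g1 g2 : C -> C) (x0 x1 s t : R) : set C :=
  (g1 @` [set z | O1 z /\ orect x0 x1 s t z]) `|` (g2 @` [set z | O2 z /\ orect x0 x1 s t z]).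

(* An exceptional height in the interior of an interval counts twice and one at an
   end counts once, which makes the count additive under subdivision. *)
Definition endpoint_count (ys : seq R) (s t : R) : R :=
  \sum_(y <- ys) ((s < y <= t)%R%:R + (s <= y < t)%R%:R).

Lemma endpoint_count_ge0 ys s t : 0 <= endpoint_count ys s t.
Proof. by apply: sumr_ge0 => y _; rewrite addr_ge0. Qed.

Lemma endpoint_count_le ys s t : endpoint_count ys s t <= 2 * (size ys)%:R.
Proof.
rewrite /endpoint_count; elim: ys => [|y ys IH]; first by rewrite big_nil mulr0.
rewrite big_cons [size _]/= -(natr1 (size ys)) mulrDr mulr1 addrC lerD//.
have b (p : bool) : p%:R <= 1 :> R by case: p.
by have := b (s < y <= t); have := b (s <= y < t); clear; lra.
Qed.

Lemma endpoint_countD ys s m t : s < m -> m < t ->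
  endpoint_count ys s t = endpoint_count ys s m + endpoint_count ys m t.
Proof.
move=> sm mt; rewrite /endpoint_count -big_split; apply: eq_bigr => y _ /=.
case: (ltgtP y m) => [ym|ym|->].
- by rewrite (lt_trans ym mt) (ltW (lt_trans ym mt)) /= ?andbT ?addr0.
- by rewrite (lt_trans sm ym) (ltW (lt_trans sm ym)) /= ?andbF ?addr0 ?add0r.
- by rewrite sm mt (ltW sm) (ltW mt) /= ?addr0 ?add0r addrC.
Qed.

Lemma endpoint_count_ge1 (ys : seq R) s t y : y \in ys -> s <= y -> y <= t -> s < t ->
  1 <= endpoint_count ys s t.
Proof.
move=> yy sy yt st; rewrite /endpoint_count (big_rem y)//= -[leLHS]addr0; apply: lerD; last exact: endpoint_count_ge0.
rewrite sy yt andbT /=; have [_|ys'] := ltP s y; first by rewrite lerDl.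
by rewrite (_ : y = s) ?st ?add0r//; apply/eqP; rewrite eq_le ys' sy.
Qed.

(** Subdivision acts on the heights only. Near a height with cuts [a <= b] the two pieces are
    estimated by [rect_area]; near an exceptional height the claimed area is made negative by
    [endpoint_count], whose total is bounded by the number of such heights. *)
Lemma length_area (O1 O2 : set C) g1 g2 (x0 x1 m M v0 v1 eta : R) (ys : seq R) :
  x0 < x1 -> m <= M ->
  (forall z, O1 z -> exists2 r, 0 < r & forall u, cabs (u - z) < r -> O1 u) ->
  (forall z, O2 z -> exists2 r, 0 < r & forall u, cabs (u - z) < r -> O2 u) ->
  (forall x x' y, O1 (cplx x y) -> x' <= x -> O1 (cplx x' y)) ->
  (forall x x' y, O2 (cplx x y) -> x <= x' -> O2 (cplx x' y)) ->
  (forall z, O1 z -> g1 z != 0 /\ exists2 s, 0 < s & hol g1 z s) ->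
  (forall z, O2 z -> g2 z != 0 /\ exists2 s, 0 < s & hol g2 z s) ->
  (forall z z', O1 z -> O1 z' -> g1 z = g1 z' -> cexp z = cexp z') ->
  (forall z z', O2 z -> O2 z' -> g2 z = g2 z' -> cexp z = cexp z') ->
  (forall z z', O1 z -> O2 z' -> g1 z = g2 z' -> cexp z = cexp z') ->
  (forall z, O1 z -> x0 < complex.Re z -> complex.Re z < x1 -> m <= ln (cabs (g1 z)) <= M) ->
  (forall z, O2 z -> x0 < complex.Re z -> complex.Re z < x1 -> m <= ln (cabs (g2 z)) <= M) ->
  (forall y, ln (cabs (g1 (cplx x0 y))) <= v0) ->
  (forall y, v1 <= ln (cabs (g2 (cplx x1 y)))) ->
  (forall y, 0 <= y <= pi *+ 2 -> y \notin ys -> exists a b,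
    [/\ x0 < a /\ b < x1, a <= b, O1 (cplx a y), O2 (cplx b y) &
      ln (cabs (g2 (cplx b y))) - eta <= ln (cabs (g1 (cplx a y)))]) ->
  2 * (v1 - v0) - (x1 - x0) - 2 * eta <= M - m.
Proof.
move=> x01 mM op1 op2 cl1 cl2 H1 H2 I1 I2 I12 B1 B2 E1 E2 Hy.
set B := 2 * (v1 - v0) - (x1 - x0) - 2 * eta.
set L := pi *+ 2 : R; have L0 : 0 < L by rewrite pmulrn_rgt0// pi_gt0.
have inj z z' : 0 < complex.Im z < L -> 0 < complex.Im z' < L -> cexp z = cexp z' -> z = z'.
  move=> /andP[h1 h2] /andP[h3 h4]; apply: cexp_inj; rewrite -/L.
  by rewrite ltr_norml; move: h1 h2 h3 h4; clear; lra.
suff S (e : R) : 0 < e ->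
    area_ge (strip_image O1 O2 g1 g2 x0 x1 0 L) (B * (L - 0) - e * (L - 0) - e * endpoint_count ys 0 L).
  rewrite -(ler_pM2r L0); apply/ler_addgt0Pr => e e0.
  pose N := L + 2 * (size ys)%:R; have N0 : 0 < N by rewrite ltr_pwDl// mulr_ge0.
  have eN : 0 < e / N by rewrite divr_gt0.
  have := area_ge_bound mM (S _ eN) _; rewrite -/L => Q.
  have {}Q := Q _; rewrite -lerBlDr; apply: le_trans (Q _).
    have he : e / N * L + e / N * (2 * (size ys)%:R) = e by rewrite -mulrDr -/N mulfVK// gt_eqF.
    have := ler_wpM2l (ltW eN) (endpoint_count_le ys 0 L); rewrite subr0.
    by move: he; set c := endpoint_count _ _ _; set n := (size ys)%:R; clear; lra.
  move=> _ [[z [Oz [/andP[zx zx'] _]] <-]|[z [Oz [/andP[zx zx'] _]] <-]]; [exact: B1|exact: B2].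
move=> e0; apply: (@itv_induction _ (fun s t => area_ge (strip_image O1 O2 g1 g2 x0 x1 s t)
  (B * (t - s) - e * (t - s) - e * endpoint_count ys s t))) => //.
  move=> s y t s0 sy yt tL P1 P2.
  have D : strip_image O1 O2 g1 g2 x0 x1 s y `&` strip_image O1 O2 g1 g2 x0 x1 y t = set0.
    (* A common image point determines [cexp], and hence, within one period, the height. *)
    have Q z z' : orect x0 x1 s y z -> orect x0 x1 y t z' -> cexp z = cexp z' -> False.
      move=> [_ h1] [_ h2] /inj E; have : z = z'.
        by apply: E; move: h1 h2 s0 sy yt tL; clear; lra.
      by move=> zz; move: h1 h2; rewrite zz; clear; lra.
    apply/seteqP; split=> // w [[[z [Oz zr] <-]|[z [Oz zr] <-]] [[z' [Oz' zr'] E]|[z' [Oz' zr'] E]]].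
    - exact: Q zr zr' (I1 _ _ Oz Oz' (esym E)).
    - exact: Q zr zr' (I12 _ _ Oz Oz' (esym E)).
    - exact: Q zr zr' (esym (I12 _ _ Oz' Oz E)).
    - exact: Q zr zr' (I2 _ _ Oz Oz' (esym E)).
  apply: area_geS (area_geU D P1 P2); last first.
    by rewrite (endpoint_countD _ sy yt); apply: eq_ler; ring.
  have W1 z : orect x0 x1 s y z -> orect x0 x1 s t z.
    by move=> [h1 h2]; split => //; move: h2 yt; clear; lra.
  have W2 z : orect x0 x1 y t z -> orect x0 x1 s t z.
    by move=> [h1 h2]; split => //; move: h2 sy; clear; lra.
  move=> w [[[z [Oz /W1 zr] <-]|[z [Oz /W1 zr] <-]]|[[z [Oz /W2 zr] <-]|[z [Oz /W2 zr] <-]]];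
    by [left; exists z|right; exists z].
move=> y yI; have [yys|yys] := boolP (y \in ys).
  have Bn : 0 < `|B| + 1 by rewrite ltr_wpDl.
  exists (e / (`|B| + 1)); first by rewrite divr_gt0.
  move=> s t s0 sy yt tL st; rewrite ltr_pdivlMr// => tse.
  apply: area_ge_le0; have c1 := endpoint_count_ge1 yys sy yt st.
  have : B * (t - s) <= e.
    apply: le_trans (ltW tse); rewrite mulrC ler_pM2l ?subr_gt0//.
    by have := ler_norm B; clear; lra.
  have : 0 <= e * (t - s) by rewrite mulr_ge0 ?subr_ge0 ?ltW.
  have : e * 1 <= e * endpoint_count ys s t by rewrite ler_pM2l.
  by clear; lra.
have [a [b [[x0a bx1] ab Oa Ob Hab]]] := Hy y yI yys.
have [ga [sa sa0 Hsa]] := H1 _ Oa; have [gb [sb sb0 Hsb]] := H2 _ Ob.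
have e8 : 0 < e / 8 by rewrite divr_gt0.
have [r1 r10 R1] := op1 _ Oa; have [r2 r20 R2] := op2 _ Ob.
have [r3 r30 R3] := ln_cabs_cont ga (ex_intro2 _ _ sa sa0 Hsa) e8.
have [r4 r40 R4] := ln_cabs_cont gb (ex_intro2 _ _ sb sb0 Hsb) e8.
exists (Num.min (Num.min r1 r2) (Num.min r3 r4)); first by rewrite !lt_min r10 r20 r30.
move=> s t s0 sy yt tL st; rewrite !lt_min => /andP[/andP[ts1 ts2] /andP[ts3 ts4]].
have near u x r : s <= u -> u <= t -> t - s < r -> cabs (cplx x u - cplx x y) < r.
  move=> su ut; apply: le_lt_trans.
  rewrite cplxB subrr cabsE /= expr0n add0r sqrtr_sqr ler_norml.
  by move: su ut sy yt; clear; lra.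
(* The cuts found at height [y] serve all heights from [s] to [t], because the domains are open and
   closed under moving left and right respectively. *)
have Q1 x u : x <= a -> s <= u -> u <= t -> O1 (cplx x u).
  by move=> xa su ut; apply: cl1 xa; apply: R1; exact: near.
have Q2 x u : b <= x -> s <= u -> u <= t -> O2 (cplx x u).
  by move=> xa su ut; apply: cl2 xa; apply: R2; exact: near.
(* The two area errors use at most [e / 2] per unit of height; the oscillations [e / 8] at the two
   cuts, doubled, use the rest. *)
pose et := e / (4 * (x1 - x0)).
have x10 : 0 < x1 - x0 by rewrite subr_gt0.
have et0 : 0 < et by rewrite divr_gt0// mulr_gt0.
have O1r z : orect x0 a s t z -> O1 z.
  by move=> [+ +]; case: z => p q /= /andP[? ?] /andP[? ?]; apply: Q1; exact: ltW.
have O2r z : orect b x1 s t z -> O2 z.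
  by move=> [+ +]; case: z => p q /= /andP[? ?] /andP[? ?]; apply: Q2; exact: ltW.
have A1 : area_ge (g1 @` orect x0 a s t)
    (rint s t (logmod g1 a) - rint s t (logmod g1 x0) - et * ((a - x0) * (t - s))).
  apply: rect_area => //.
    by move=> x u /andP[_ xa] /andP[su ut]; apply: H1; exact: Q1.
  move=> z z' [zx zy] [zx' zy'] E; apply: inj.
  - by move: zy s0 tL; clear; lra.
  - by move: zy' s0 tL; clear; lra.
  - by apply: I1 E; apply: O1r; split.
have A2 : area_ge (g2 @` orect b x1 s t)
    (rint s t (logmod g2 x1) - rint s t (logmod g2 b) - et * ((x1 - b) * (t - s))).
  apply: rect_area => //.
    by move=> x u /andP[bx _] /andP[su ut]; apply: H2; exact: Q2.
  move=> z z' [zx zy] [zx' zy'] E; apply: inj.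
  - by move: zy s0 tL; clear; lra.
  - by move: zy' s0 tL; clear; lra.
  - by apply: I2 E; apply: O2r; split.
(* A common image point would have one real part both below [a] and above [b]. *)
have D : (g1 @` orect x0 a s t) `&` (g2 @` orect b x1 s t) = set0.
  apply/seteqP; split => // w [[z zr <-] [z' zr' E]].
  have := I12 _ _ (O1r _ zr) (O2r _ zr') (esym E) => /(congr1 (@cabs R)).
  rewrite !cabs_cexp => /expR_inj zz; case: zr zr' => [zx _] [zx' _].
  by move: zx zx' ab; rewrite zz; clear; lra.
apply: area_geS (area_geU D A1 A2).
  move=> w [[z zr <-]|[z zr <-]]; [left|right]; exists z => //; split.
  - exact: O1r.
  - by case: zr => h1 h2; split => //; move: h1 ab bx1; clear; lra.
  - exact: O2r.
  - by case: zr => h1 h2; split => //; move: h1 ab x0a; clear; lra.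
have lm1 x : x <= a -> rcont s t (logmod g1 x).
  by move=> xa; apply: logmod_cont => u /andP[su ut]; apply: H1; exact: Q1.
have lm2 x : b <= x -> rcont s t (logmod g2 x).
  by move=> xa; apply: logmod_cont => u /andP[su ut]; apply: H2; exact: Q2.
have ts0 : 0 < t - s by rewrite subr_gt0.
set va := ln (cabs (g1 (cplx a y))) in Hab R3; set vb := ln (cabs (g2 (cplx b y))) in Hab R4.
have i1 : (2 * (va - e / 8) - a) * (t - s) <= rint s t (logmod g1 a).
  rewrite -rint_cst ?(ltW st)//; apply: rint_le; [exact: rcont_cst|exact: lm1|].
  move=> u /andP[su ut]; have /ltr_normlP[h _] := R3 _ (near u a r3 su ut ts3).
  by rewrite /logmod; move: h; clear; lra.
have i2 : rint s t (logmod g1 x0) <= (2 * v0 - x0) * (t - s).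
  rewrite -rint_cst ?(ltW st)//; apply: rint_le; [exact: lm1 (ltW x0a)|exact: rcont_cst|].
  by move=> u _; have := E1 u; rewrite /logmod; clear; lra.
have i3 : (2 * v1 - x1) * (t - s) <= rint s t (logmod g2 x1).
  rewrite -rint_cst ?(ltW st)//; apply: rint_le; [exact: rcont_cst|exact: lm2 (ltW bx1)|].
  by move=> u _; have := E2 u; rewrite /logmod; clear; lra.
have i4 : rint s t (logmod g2 b) <= (2 * (vb + e / 8) - b) * (t - s).
  rewrite -rint_cst ?(ltW st)//; apply: rint_le; [exact: lm2|exact: rcont_cst|].
  move=> u /andP[su ut]; have /ltr_normlP[_ h] := R4 _ (near u b r4 su ut ts4).
  by rewrite /logmod; move: h; clear; lra.
have i5 : et * ((a - x0) * (t - s)) <= e / 4 * (t - s).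
  rewrite mulrA ler_pM2r// /et mulrAC ler_pdivrMr ?mulr_gt0//.
  have -> : e / 4 * (4 * (x1 - x0)) = e * (x1 - x0) by field.
  by rewrite ler_pM2l//; move: ab bx1; clear; lra.
have i6 : et * ((x1 - b) * (t - s)) <= e / 4 * (t - s).
  rewrite mulrA ler_pM2r// /et mulrAC ler_pdivrMr ?mulr_gt0//.
  have -> : e / 4 * (4 * (x1 - x0)) = e * (x1 - x0) by field.
  by rewrite ler_pM2l//; move: ab x0a; clear; lra.
have i7 : 0 <= e * endpoint_count ys s t by rewrite mulr_ge0 ?endpoint_count_ge0 ?ltW.
have i8 : 0 <= (va - vb + eta) * (t - s).
  by rewrite mulr_ge0 ?(ltW ts0)//; move: Hab; clear; lra.
have i9 : 0 <= (b - a) * (t - s) by rewrite mulr_ge0 ?(ltW ts0)// subr_ge0.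
have i10 : 0 <= e * (t - s) by rewrite mulr_ge0 ?(ltW ts0)// ltW.
rewrite /B; move: i1 i2 i3 i4 i5 i6 i7 i8 i9 i10.
set c := endpoint_count _ _ _; set T := t - s; clear; lra.
Qed.

End LengthArea.

(** * Lifts of the exponential *)

Section Lifting.
Variable R : realType.
Local Notation C := R[i].
Implicit Types (F f g : C -> C) (z w a : C).

Lemma dif_lower_bound F z d (c r : R) : 0 < r -> dif F z d ->
  (forall u, cabs (u - z) < r -> c * cabs (u - z) <= cabs (F u - F z)) -> c <= cabs d.
Proof.
move=> r0 Hd H; apply/ler_addgt0Pr => e e0.
have [s s0 Hs] := Hd e e0.
have m0 : 0 < Num.min r s by rewrite lt_min r0.
pose t := Num.min r s / 2; have t0 : 0 < t by rewrite divr_gt0.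
have tm : t < Num.min r s by rewrite /t ltr_pdivrMr// ltr_pMr// ltr1n.
have ct : cabs (z + t%:C%C - z) = t by rewrite addrAC subrr add0r cabsR gtr0_norm.
move: tm; rewrite lt_min => /andP[tr ts].
have := H (z + t%:C%C); have := Hs (z + t%:C%C); rewrite ct => /(_ ts) h1 /(_ tr) h2.
rewrite -(ler_pM2r t0); apply: le_trans h2 _.
have := ler_cabsD (F (z + t%:C%C) - F z - d * (z + t%:C%C - z)) (d * (z + t%:C%C - z)).
rewrite subrK cabsM ct => h3; apply: le_trans h3 _; rewrite mulrDl addrC lerD2l.
exact: h1.
Qed.

(** [local_inverse] with a chosen section. Its lower Lipschitz bound also keeps the derivative
    nonzero near [a]. *)
Lemma local_section F a d (s : R) : 0 < s -> hol F a s -> dif F a d -> d != 0 ->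
  exists r e (tau : C -> C), [/\ 0 < r /\ r < s, 0 < e,
    forall w, cabs (w - F a) < e -> cabs (tau w - a) < r /\ F (tau w) = w,
    forall z z', cabs (z - a) < r -> cabs (z' - a) < r -> F z = F z' -> z = z' &
    (forall z, cabs (z - a) < r -> exists2 k, k != 0 & dif F z k) /\
    forall w w', cabs (w - F a) < e -> cabs (w' - F a) < e ->
      cabs d / 2 * cabs (tau w - tau w') <= cabs (w - w')].
Proof.
move=> s0 Hs Hd d0; have [r [e [r0 rs e0 lb sur]]] := local_inverse s0 Hs Hd d0.
have D0 : 0 < cabs d / 2 by rewrite divr_gt0// cabs_gt0.
have ch w : exists z, cabs (w - F a) < e -> cabs (z - a) < r /\ F z = w.
  have [we|we] := pselect (cabs (w - F a) < e); last by exists 0.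
  by have [z zr zw] := sur w we; exists z.
have [tau Ht] := choice ch.
exists r, e, tau; split=> //.
  move=> z z' zr z'r E; have := lb z z' zr z'r; rewrite E subrr cabs0 => h.
  apply/cabs_sub_eq0/eqP; rewrite eq_le cabs_ge0 andbT -(ler_pM2l D0) mulr0//.
split.
  move=> z zr; have [k Hk] := Hs z (lt_trans zr rs); exists k => //.
  rewrite -cabs_gt0; apply: lt_le_trans D0 _.
  apply: (@dif_lower_bound F z k _ (r - cabs (z - a))) => //; first by rewrite subr_gt0.
  move=> u uz; apply: lb => //; have := cabs_triangle u z a; move: uz; clear; lra.
move=> w w' we w'e; have [h1 h2] := Ht w we; have [h3 h4] := Ht w' w'e.
by have := lb _ _ h1 h3; rewrite h2 h4.
Qed.

Lemma section_dif F G (tau : C -> C) z k d : ccont tau z ->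
  (exists2 r : R, 0 < r & forall u, cabs (u - z) < r -> F (tau u) = G u) ->
  dif F (tau z) d -> d != 0 -> dif G z k -> dif tau z (k / d).
Proof.
move=> ct [r r0 Hr] Hd d0 Hk; have D0 : 0 < cabs d by rewrite cabs_gt0.
have FG u : cabs (u - z) < r -> F (tau u) = G u := Hr u.
have FGz : F (tau z) = G z by apply: Hr; rewrite subrr cabs0.
(* a first, crude, Lipschitz bound for [tau], then the exact derivative *)
have [r1 r10 H1] := Hd (cabs d / 2) ltac:(by rewrite divr_gt0).
have [r2 r20 H2] := ct r1 r10.
have [r3 r30 H3] := dif_lip Hk.
pose L := 2 * (cabs k + 1) / cabs d.
have lip u : cabs (u - z) < r -> cabs (u - z) < r2 -> cabs (u - z) < r3 ->
    cabs (tau u - tau z) <= L * cabs (u - z).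
  move=> ur u2 u3; have := H1 (tau u) (H2 u u2); rewrite FG// FGz => h1.
  have h3 := H3 u u3.
  have := ler_cabsB (G u - G z) (G u - G z - d * (tau u - tau z)).
  rewrite (_ : _ - _ - (_ - _) = d * (tau u - tau z)); last by ring.
  rewrite cabsM => h4.
  rewrite /L mulrAC ler_pdivlMr//; move: h1 h3 h4; clear.
  set t := cabs (tau u - tau z); lra.
have L0 : 0 <= L by rewrite divr_ge0 ?mulr_ge0 ?addr_ge0 ?cabs_ge0.
apply: (@dif_weak _ _ _ _ ((L + 1) / cabs d)); first by rewrite divr_gt0// ltr_wpDl.
move=> e e0; have [s1 s10 K1] := Hd e e0; have [s2 s20 K2] := ct s1 s10.
have [s3 s30 K3] := Hk e e0.
exists (Num.min (Num.min r s2) (Num.min s3 (Num.min r2 r3))).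
  by rewrite !lt_min r0 s20 s30 r20.
move=> u; rewrite !lt_min => /andP[/andP[ur u2] /andP[u3 /andP[ur2 ur3]]].
have := K1 (tau u) (K2 u u2); rewrite FG// FGz => h1.
have h3 := K3 u u3; have hl := lip u ur ur2 ur3.
have -> : tau u - tau z - k / d * (u - z) =
  ((G u - G z - k * (u - z)) - (G u - G z - d * (tau u - tau z))) / d by field.
rewrite cabsM cabsV ler_pdivrMr//; apply: le_trans (ler_cabsB _ _) _.
apply: le_trans (lerD h3 h1) _.
have : e * cabs (tau u - tau z) <= e * (L * cabs (u - z)) by rewrite ler_wpM2l// ltW.
have -> : (L + 1) / cabs d * e * cabs (u - z) * cabs d = (L + 1) * e * cabs (u - z).
  by field; rewrite gt_eqF.
clear; lra.
Qed.

(* At a pole the inverse of [F] is to vanish, so that [F] itself takes there the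
   junk value [0^-1 = 0]. *)
Definition mero F := forall z, cabs z < 1 ->
  (exists2 s : R, 0 < s & hol F z s) \/ (exists2 s : R, 0 < s & hol (fun u => (F u)^-1) z s).

(** The points through which a lift of [cexp] can pass. The condition [F z != 0] excludes the poles
    as well, by their junk value. *)
Definition regular F z := [/\ cabs z < 1, F z != 0 & exists2 d, d != 0 & dif F z d].

Lemma mero_hol F z : mero F -> cabs z < 1 -> F z != 0 -> exists2 s : R, 0 < s & hol F z s.
Proof.
move=> mF zU Fz; have [//|[s s0 Hs]] := mF z zU.
have [|k /dif_cont ck] := Hs z; first by rewrite subrr cabs0.
have F0 : 0 < cabs (F z)^-1 by rewrite cabs_gt0 invr_eq0.
have [r r0 Hr] := ck _ F0.
exists (Num.min r s); first by rewrite lt_min r0.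
move=> u; rewrite lt_min => /andP[/Hr h /Hs[k' Hk']].
have Fu : (F u)^-1 != 0.
  by apply/eqP => E; move: h; rewrite E sub0r cabsN ltxx.
have D := @difV _ (fun u => (F u)^-1) u k' Fu Hk'.
by eexists; apply: dif_local ltr01 _ D => v _; rewrite invrK.
Qed.

Lemma regular_near F z : mero F -> regular F z -> exists r e (tau : C -> C),
  [/\ 0 < r, 0 < e,
    forall w, cabs (w - F z) < e -> [/\ cabs (tau w - z) < r, F (tau w) = w & regular F (tau w)],
    forall u v, cabs (u - z) < r -> cabs (v - z) < r -> F u = F v -> u = v &
    forall w, cabs (w - F z) < e -> ccont tau w].
Proof.
move=> mF [zU Fz [d d0 Hd]]; have [s s0 Hs] := mero_hol mF zU Fz.
pose s' := Num.min s (1 - cabs z).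
have s'0 : 0 < s' by rewrite lt_min s0 subr_gt0.
have Hs' : hol F z s' by move=> u; rewrite lt_min => /andP[/Hs].
have [r [e [tau [[r0 rs] e0 Ht inj [Hreg lip]]]]] := local_section s'0 Hs' Hd d0.
have D0 : 0 < cabs d / 2 by rewrite divr_gt0// cabs_gt0.
pose e' := Num.min e (cabs (F z)).
have e'0 : 0 < e' by rewrite lt_min e0 cabs_gt0.
exists r, e', tau; split => //.
  move=> w; rewrite lt_min => /andP[we wF]; have [h1 h2] := Ht w we; split=> //.
  split; last exact: Hreg.
    have : cabs (tau w - z) < s' by exact: lt_trans rs.
    rewrite lt_min => /andP[_]; have := ler_sub_cabs (tau w) z; clear; lra.
  by rewrite h2; apply/eqP => w0; move: wF; rewrite w0 sub0r cabsN ltxx.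
move=> w; rewrite lt_min => /andP[we _] q q0.
exists (Num.min (e - cabs (w - F z)) (q * (cabs d / 2))).
  by rewrite lt_min subr_gt0 we mulr_gt0.
move=> w'; rewrite lt_min => /andP[w1 w2].
have w'e : cabs (w' - F z) < e.
  by have := cabs_triangle w' w (F z); move: w1; clear; lra.
have := lip _ _ w'e we; rewrite mulrC => h.
by rewrite -(ltr_pM2r D0); apply: le_lt_trans h _.
Qed.

(* A lift on a half-strip unbounded to the left, so that agreement with the local
   inverse [sigma0] far to the left makes it unique. *)
Definition lift_on F (e0 : R) (sigma0 : C -> C) z (tau : C -> C) (e : R) :=
  0 < e /\ forall u, complex.Re u < complex.Re z + e -> `|complex.Im u - complex.Im z| < e ->
    [/\ regular F (tau u), F (tau u) = cexp u, ccont tau u &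
        expR (complex.Re u) < e0 -> tau u = sigma0 (cexp u)].

(** Along the line to the left of [z], agreement is an open condition by local injectivity of [F] at
    regular points, disagreement by continuity, and far to the left both lifts are [sigma0] of
    [cexp]. *)
Lemma lift_uniq F e0 sigma0 z tau tau' e e' : mero F -> 0 < e0 ->
  lift_on F e0 sigma0 z tau e -> lift_on F e0 sigma0 z tau' e' -> tau z = tau' z.
Proof.
move=> mF e00 [p0 H] [p'0 H']; set x := complex.Re z; set y := complex.Im z.
have zE : z = cplx x y by rewrite /x /y; case: (z).
have K s : s <= x -> [/\ regular F (tau (cplx s y)), F (tau (cplx s y)) = cexp (cplx s y),
    ccont tau (cplx s y) & expR s < e0 -> tau (cplx s y) = sigma0 (cexp (cplx s y))].
  move=> sx; apply: H; rewrite ?cReE ?cImE -/x -/y ?subrr ?normr0//.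
  by apply: le_lt_trans sx _; rewrite ltrDl.
have K' s : s <= x -> [/\ regular F (tau' (cplx s y)), F (tau' (cplx s y)) = cexp (cplx s y),
    ccont tau' (cplx s y) & expR s < e0 -> tau' (cplx s y) = sigma0 (cexp (cplx s y))].
  move=> sx; apply: H'; rewrite ?cReE ?cImE -/x -/y ?subrr ?normr0//.
  by apply: le_lt_trans sx _; rewrite ltrDl.
pose A := Num.min (x - 1) (ln (e0 / 2)).
have Ax : A < x by rewrite gt_min gtrBl ltr01.
have Ae : expR A < e0.
  apply: (@le_lt_trans _ _ (e0 / 2)); last by rewrite ltr_pdivrMr// ltr_pMr// ltr1n.
  by rewrite -[leRHS]lnK ?posrE ?divr_gt0// ler_expR ge_min lexx orbT.
pose E s := tau (cplx s y) = tau' (cplx s y).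
suff : E A <-> E x.
  rewrite /E -zE => -[+ _]; apply.
  have [_ _ _ ->//] := K A (ltW Ax); by have [_ _ _ ->] := K' A (ltW Ax).
apply: (@itv_induction _ (fun s t => E s <-> E t)) => //.
  by move=> p q r _ _ _ _ [h1 h2] [h3 h4]; split; [move/h1/h3|move/h4/h2].
move=> s /andP[_ sx]; have [rs Fs cs _] := K s sx; have [rs' Fs' cs' _] := K' s sx.
have dist t : cabs (cplx t y - cplx s y) = `|t - s|.
  by rewrite cplxB subrr cabsE /= expr0n addr0 sqrtr_sqr.
have [Es|Es] := pselect (E s).
  have [r [_ [_ [r0 _ _ inj _]]]] := regular_near mF rs.
  have [d d0 Hd] := cs r r0; have [d' d'0 Hd'] := cs' r r0.
  have near t : `|t - s| < Num.min d d' -> t <= x -> E t.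
    rewrite lt_min -dist => /andP[/Hd h1 /Hd' h2] tx; rewrite /E.
    have [_ Ft _ _] := K t tx; have [_ Ft' _ _] := K' t tx.
    by apply: inj; rewrite ?Ft ?Ft'// [X in cabs (_ - X)]Es.
  exists (Num.min d d'); first by rewrite lt_min d0.
  move=> p q _ ps sq qx pq h; split=> _; apply: near => //.
  - by apply: le_lt_trans h; rewrite ger0_norm ?subr_ge0// lerD2l lerN2.
  - by apply: le_lt_trans h; rewrite distrC ger0_norm ?subr_ge0// lerD2r.
  - exact: le_trans sx.
pose D := cabs (tau (cplx s y) - tau' (cplx s y)).
have D0 : 0 < D / 2.
  by rewrite divr_gt0// cabs_gt0 subr_eq0; apply/eqP.
have [d d0 Hd] := cs _ D0; have [d' d'0 Hd'] := cs' _ D0.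
have near t : `|t - s| < Num.min d d' -> ~ E t.
  rewrite lt_min -dist => /andP[/Hd h1 /Hd' h2] Et.
  have h3 : cabs (tau (cplx s y) - tau (cplx t y)) < D / 2 by rewrite cabsB.
  have : D <= cabs (tau (cplx s y) - tau (cplx t y)) + cabs (tau' (cplx t y) - tau' (cplx s y)).
    by rewrite -[tau' (cplx t y)]Et; exact: cabs_triangle.
  by move: h2 h3; clear; lra.
exists (Num.min d d'); first by rewrite lt_min d0.
move=> p q _ ps sq qx pq h; split => Ex; exfalso; move: Ex; apply: near.
- by apply: le_lt_trans h; rewrite distrC ger0_norm ?subr_ge0// lerD2r.
- by apply: le_lt_trans h; rewrite ger0_norm ?subr_ge0// lerD2l lerN2.
Qed.

End Lifting.

(** * Maximal lifts *)

Section MaximalLift.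
Variable R : realType.
Local Notation C := R[i].
Implicit Types (F f g : C -> C) (z w u p : C).

(** Maximality is [ml_extend]: the domain contains an end point [cplx X y] as soon as the lift
    accumulates, along the horizontal line, at a regular point with the right value. Convergence is
    not demanded. *)
Record max_lift F (z1 : C) (O : set C) (sigma sigma0 : C -> C) (e0 : R) : Prop := MaxLift {
  ml_e0 : 0 < e0;
  ml_base0 : sigma0 0 = z1;
  ml_base : forall w, cabs w < e0 -> [/\ cabs (sigma0 w) < 1, F (sigma0 w) = w,
    exists2 k, k != 0 & dif F (sigma0 w) k & ccont sigma0 w];
  ml_open : forall z, O z -> exists2 r, 0 < r & forall u, cabs (u - z) < r -> O u;
  ml_left : forall x x' y, O (cplx x y) -> x' <= x -> O (cplx x' y);
  ml_sigma : forall z, O z -> [/\ regular F (sigma z), F (sigma z) = cexp z, ccont sigma z &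
    expR (complex.Re z) < e0 -> sigma z = sigma0 (cexp z)];
  ml_near : forall z, expR (complex.Re z) < e0 -> O z;
  ml_extend : forall X y p, (forall x, x < X -> O (cplx x y)) -> regular F p ->
    F p = cexp (cplx X y) ->
    (forall d, 0 < d -> exists2 x, X - d < x < X & cabs (sigma (cplx x y) - p) < d) ->
    O (cplx X y)
}.

Lemma ccont_local f g z (r : R) : 0 < r -> (forall u, cabs (u - z) < r -> f u = g u) ->
  ccont f z -> ccont g z.
Proof.
move=> r0 fg cf e e0; have [s s0 Hs] := cf e e0.
exists (Num.min r s); first by rewrite lt_min r0.
move=> u; rewrite lt_min => /andP[ur /Hs]; rewrite (fg u ur) (fg z)//.
by rewrite subrr cabs0.
Qed.

Lemma ccont_comp f g z : ccont g z -> ccont f (g z) -> ccont (fun u => f (g u)) z.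
Proof.
move=> cg cf e e0; have [r r0 Hr] := cf e e0; have [s s0 Hs] := cg r r0.
by exists s => // u /Hs /Hr.
Qed.

Lemma ccont_cexp z : ccont (@cexp R) z.
Proof. exact: dif_cont (dif_cexp z). Qed.

Lemma Re_lt_of_cabs u z (e : R) : cabs (u - z) < e -> complex.Re u < complex.Re z + e.
Proof.
by move=> h; have := le_lt_trans (ler_Re_cabs _) h; rewrite cReB => /ltr_normlP[_]; lra.
Qed.

Lemma Im_lt_of_cabs u z (e : R) : cabs (u - z) < e -> `|complex.Im u - complex.Im z| < e.
Proof. by move=> h; have := le_lt_trans (ler_Im_cabs _) h; rewrite cImB. Qed.

(** The domain is the union of all half-strips that carry a lift; by [lift_uniq] their values
    agree. *)
Lemma max_lift_exists F z1 d1 (s : R) : mero F -> cabs z1 < 1 -> F z1 = 0 ->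
  0 < s -> hol F z1 s -> dif F z1 d1 -> d1 != 0 ->
  exists O sigma sigma0 e0, max_lift F z1 O sigma sigma0 e0.
Proof.
move=> mF z1U F0 s0 Hs Hd d0.
pose s' := Num.min s (1 - cabs z1).
have s'0 : 0 < s' by rewrite lt_min s0 subr_gt0.
have Hs' : hol F z1 s' by move=> u; rewrite lt_min => /andP[/Hs].
have [r [ee [s0' [[r0 rs] ee0 Ht inj0 [Hreg lip]]]]] := local_section s'0 Hs' Hd d0.
rewrite F0 in Ht lip.
have D0 : 0 < cabs d1 / 2 by rewrite divr_gt0// cabs_gt0.
have base w : cabs w < ee -> [/\ cabs (s0' w) < 1, F (s0' w) = w,
    exists2 k, k != 0 & dif F (s0' w) k & ccont s0' w].
  move=> we; have [h1 h2] := Ht w ltac:(by rewrite subr0); split=> //.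
  - have : cabs (s0' w - z1) < s' by exact: lt_trans rs.
    rewrite lt_min => /andP[_]; have := ler_sub_cabs (s0' w) z1; clear; lra.
  - exact: Hreg.
  move=> q q0; exists (Num.min (ee - cabs w) (q * (cabs d1 / 2))).
    by rewrite lt_min subr_gt0 we mulr_gt0.
  move=> w'; rewrite lt_min => /andP[w1 w2].
  have w'e : cabs w' < ee.
    by have := ler_sub_cabs w' w; move: w1; clear; lra.
  have := @lip w' w; rewrite !subr0 => /(_ w'e we); rewrite mulrC => h.
  by rewrite -(ltr_pM2r D0); apply: le_lt_trans h _.
(* Agreement with [s0'] is imposed only below [e1]. A genuine extension takes place where
   [ee <= expR X], so its new part can be kept right of [ln e1], free of that condition. *)
pose e1 := ee / 2.
have e10 : 0 < e1 by rewrite divr_gt0.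
have e1e : e1 < ee by rewrite /e1 ltr_pdivrMr// ltr_pMr// ltr1n.
pose lift := lift_on F e1 s0'.
pose O : set C := [set z | exists tau e, lift z tau e].
pose sigma z := xget 0 [set p | exists tau e, lift z tau e /\ p = tau z].
have sE z tau e : lift z tau e -> sigma z = tau z.
  move=> L; rewrite /sigma; case: xgetP => [p _ [tau' [e' [L' ->]]]|N].
    exact: lift_uniq mF e10 L' L.
  by exfalso; apply: (N (tau z)); exists tau, e.
have sub z tau e u : lift z tau e -> complex.Re u < complex.Re z + e ->
    `|complex.Im u - complex.Im z| < e -> exists e', lift u tau e'.
  move=> [e0 L] h1 h2.
  exists (Num.min (complex.Re z + e - complex.Re u) (e - `|complex.Im u - complex.Im z|)).
  split; first by rewrite lt_min !subr_gt0 h1 h2.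
  move=> v; rewrite -ltrBlDl !lt_min => /andP[v1 _] /andP[_ v2]; apply: L.
    by move: v1; clear; lra.
  have := ler_normD (complex.Im v - complex.Im u) (complex.Im u - complex.Im z).
  by rewrite addrA subrK; move: v2; clear; lra.
have Lball z tau e u : lift z tau e -> cabs (u - z) < e -> exists e', lift u tau e'.
  by move=> L ue; apply: (sub z tau e) => //; [exact: Re_lt_of_cabs|exact: Im_lt_of_cabs].
have Onear z : expR (complex.Re z) < ee -> O z.
  move=> ze; exists (fun u => s0' (cexp u)), (ln ee - complex.Re z).
  have lne : complex.Re z < ln ee by rewrite -ltr_expR lnK.
  split; first by rewrite subr_gt0.
  move=> u; rewrite subrKC => ue _.
  have ce : cabs (cexp u) < ee by rewrite cabs_cexp -[ltRHS]lnK// ltr_expR.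
  have [b1 b2 b3 b4] := base _ ce; split=> //.
    by split=> //; rewrite b2 cexp_neq0.
  exact: ccont_comp (ccont_cexp u) b4.
exists O, sigma, s0', e1; split=> //.
- apply: inj0; rewrite ?subrr ?cabs0//; have [h1 h2] := Ht 0 ltac:(by rewrite subrr cabs0) => //.
  by rewrite h2.
- by move=> w we; apply: base; exact: lt_trans e1e.
- move=> z [tau [e L]]; exists e; first by case: L.
  by move=> u /(Lball _ _ _ _ L)[e' L']; exists tau, e'.
- move=> x x' y [tau [e L]] xx.
  have [||e' L'] := @sub (cplx x y) tau e (cplx x' y) L.
  + by rewrite !cReE; apply: le_lt_trans xx _; case: L => e0 _; rewrite ltrDl.
  + by rewrite !cImE subrr normr0; case: L.
  by exists tau, e'.
- move=> z [tau [e L]]; rewrite (sE _ _ _ L); have [e0 H] := L.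
  have [||h1 h2 h3 h4] := H z; [by rewrite ltrDl|by rewrite subrr normr0|split=> //].
  apply: (@ccont_local tau sigma z e) => // u ue.
  by have [e' L'] := Lball _ _ _ _ L ue; rewrite (sE _ _ _ L').
- by move=> z ze; apply: Onear; exact: lt_trans e1e.
move=> X y p HO rp Fp acc; set Z := cplx X y.
have [Xe|Xe] := ltP (expR X) ee; first exact: Onear.
have [rr [er [tp [rr0 er0 Htp injp ctp]]]] := regular_near mF rp.
have [dl1 dl10 Hdl1] := @ccont_cexp Z er er0; rewrite -Fp in Hdl1.
pose dd := Num.min (dl1 / 2) (Num.min rr (X - ln e1)).
have lnX : ln e1 < X.
  by rewrite -ltr_expR lnK//; apply: lt_le_trans Xe.
have dd0 : 0 < dd by rewrite !lt_min rr0 subr_gt0 lnX divr_gt0.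
have [x /andP[xX1 xX2] xp] := acc dd dd0.
have ddl : dd <= dl1 / 2 by rewrite ge_min lexx.
have ddr : dd <= rr by rewrite !ge_min lexx orbT.
have xe1 : ln e1 < x.
  have : dd <= X - ln e1 by rewrite !ge_min lexx !orbT.
  by move: xX1; clear; lra.
set zn := cplx x y in xp; have [tau [e L]] := HO x xX2.
rewrite (sE _ _ _ L) in xp; have [e0 H] := L.
have [||_ Fn cn _] := H zn; [by rewrite cReE ltrDl|by rewrite cImE subrr normr0|].
have znZ : cabs (zn - Z) = X - x.
  by rewrite cplxB subrr cabsE /= expr0n addr0 sqrtr_sqr distrC ger0_norm// subr_ge0 ltW.
have znd : cabs (zn - Z) < dl1 / 2 by rewrite znZ; move: xX1 ddl; clear; lra.
pose q := rr - cabs (tau zn - p).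
have q0 : 0 < q by rewrite subr_gt0; apply: lt_le_trans ddr.
have [dl2 dl20 Hdl2] := cn q q0.
pose dl3 := Num.min dl2 (Num.min e (dl1 / 2)).
have dl30 : 0 < dl3 by rewrite !lt_min dl20 e0 divr_gt0.
have agree u : cabs (u - zn) < dl3 -> tau u = tp (cexp u).
  rewrite !lt_min => /andP[/Hdl2 h1 /andP[h2 h3]].
  have uZ : cabs (u - Z) < dl1.
    by have := cabs_triangle u zn Z; move: h3 znd; clear; lra.
  have [k1 k2 _] := Htp _ (Hdl1 u uZ).
  have [||_ Fu _ _] := H u; [exact: Re_lt_of_cabs|exact: Im_lt_of_cabs|].
  apply: injp => //; last by rewrite k2.
  by have := cabs_triangle (tau u) (tau zn) p; move: h1; rewrite /q; clear; lra.
(* The old lift is glued along [Re u = x] to the local inverse at [p]; by local injectivity they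
   agree near [zn]. *)
pose tau' u := if complex.Re u <= x then tau u else tp (cexp u).
pose e' := Num.min e (Num.min (dl1 / 4) dl3).
have e'0 : 0 < e' by rewrite lt_min e0 lt_min dl30 andbT divr_gt0.
exists tau', e'; split=> // u; rewrite /Z cReE cImE => u1 u2.
have e'e : e' <= e by rewrite ge_min lexx.
have e'd : e' <= dl1 / 4 by rewrite !ge_min lexx orbT.
have e'3 : e' <= dl3 by rewrite /e' ge_min [X in _ || X]ge_min lexx !orbT.
have ue : `|complex.Im u - y| < e by exact: lt_le_trans e'e.
have right v : x <= complex.Re v -> complex.Re v < X + e' -> `|complex.Im v - y| < e' ->
    [/\ cabs (tp (cexp v) - p) < rr, F (tp (cexp v)) = cexp v, regular F (tp (cexp v)) &
      ccont (fun u => tp (cexp u)) v].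
  move=> v1 v2 v3; have vZ : cabs (v - Z) < dl1.
    apply: le_lt_trans (cabs_leD _) _; rewrite cReB cImB.
    have : `|complex.Re v - X| <= dl1 / 2.
      by rewrite ler_norml; move: v1 v2 xX1 ddl e'd dl10; clear; lra.
    by move: v3 e'd dl10; rewrite cImE cReE; clear; lra.
  have [k1 k2 k3] := Htp _ (Hdl1 v vZ); split=> //.
  by apply: ccont_comp (ccont_cexp v) _; exact: ctp (Hdl1 v vZ).
have [ux|ux] := leP (complex.Re u) x.
  have [||h1 h2 h3 h4] := H u.
  - by rewrite cReE; apply: le_lt_trans ux _; rewrite ltrDl.
  - by [].
  rewrite /tau' ux; split=> //.
  move: ux; rewrite le_eqVlt => /orP[/eqP ux|ux].
    have un : cabs (u - zn) < dl3.
      apply: le_lt_trans (cabs_leD _) _; rewrite cReB cImB cReE cImE ux subrr normr0 add0r.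
      exact: lt_le_trans e'3.
    apply: (@ccont_local tau tau' u (dl3 - cabs (u - zn))) => //; first by rewrite subr_gt0.
    move=> v vu; rewrite /tau'; case: ifP => // _; apply: agree.
    by have := cabs_triangle v u zn; move: vu; clear; lra.
  apply: (@ccont_local tau tau' u (x - complex.Re u)) => //; first by rewrite subr_gt0.
  by move=> v /Re_lt_of_cabs; rewrite subrKC /tau' => /ltW ->.
have [h1 h2 h3 h4] := right u (ltW ux) u1 u2.
have tE : tau' u = tp (cexp u) by rewrite /tau' leNgt ux.
rewrite tE; split=> //.
  apply: (@ccont_local (fun v => tp (cexp v)) tau' u (complex.Re u - x)) => //.
    by rewrite subr_gt0.
  move=> v; rewrite cabsB => /Re_lt_of_cabs uv; rewrite /tau' leNgt.
  by have -> : x < complex.Re v by move: uv; clear; lra.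
move=> ue1; exfalso; have := lt_trans xe1 ux.
by rewrite ltNge -ler_expR lnK// (ltW ue1).
Qed.

End MaximalLift.

(** * Critical points and the ends of lifts *)

Section CriticalPoints.
Variable R : realType.
Local Notation C := R[i].
Implicit Types (F f g : C -> C) (z w u p q : C).

Definition critical F p := [/\ cabs p < 1, F p != 0 & ~ regular F p].

Definition locally_cst F p := exists2 r : R, 0 < r & forall u, cabs (u - p) < r -> F u = F p.

Lemma locally_cst_dif0 F p : locally_cst F p -> dif F p 0.
Proof.
move=> [r r0 Hr]; apply: dif_local r0 _ (dif_cst (F p) p) => u ur; by rewrite Hr.
Qed.

Lemma locally_cstV F p : locally_cst (fun u => (F u)^-1) p -> locally_cst F p.
Proof. by move=> [r r0 Hr]; exists r => // u /Hr /invr_inj. Qed.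

Lemma criticalV F p : critical F p -> critical (fun u => (F u)^-1) p.
Proof.
move=> [pU Fp nr]; split=> //; first by rewrite invr_eq0.
move=> [_ Ep [d d0 Hd]]; apply: nr; split=> //.
have H := @difV _ (fun u => (F u)^-1) _ _ Ep Hd; exists (- (F p)^-1 ^- 2 * d).
  by rewrite mulf_neq0// oppr_eq0 invr_eq0 expf_neq0.
by apply: dif_local ltr01 _ H => u _; rewrite invrK.
Qed.

(** Points of both kinds are zeros of the derivative, so [critical_cluster] applies. *)
Lemma locally_cst_hol F p (s : R) : 0 < s -> hol F p s ->
  (forall e : R, 0 < e -> exists2 q, q != p /\ cabs (q - p) < e &
     critical F q \/ locally_cst F q) ->
  locally_cst F p.
Proof.
move=> s0 Hs acc.
have ch u : exists k, cabs (u - p) < s -> dif F u k.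
  have [us|us] := pselect (cabs (u - p) < s); last by exists 0.
  by have [k Hk] := Hs u us; exists k.
have [k Hk] := choice ch.
apply: (@critical_cluster _ F k p s s0 Hk) => e e0.
have m0 : 0 < Num.min e s by rewrite lt_min e0.
have [q [qp]] := acc _ m0; rewrite lt_min => /andP[qe qs] crit.
exists q; split=> //; apply/eqP; apply: contrapT => /negP kq.
case: crit => [[qU Fq nr]|/locally_cst_dif0 H].
  by apply: nr; split=> //; exists (k q) => //; exact: Hk.
by move: kq; rewrite (dif_unique (Hk q qs) H) eqxx.
Qed.

Lemma locally_cst_closed F p : mero F -> cabs p < 1 ->
  (forall e : R, 0 < e -> exists2 q, q != p /\ cabs (q - p) < e &
     critical F q \/ locally_cst F q) ->
  locally_cst F p.
Proof.
move=> mF pU acc; have [[s s0 Hs]|[s s0 Hs]] := mF p pU; first exact: locally_cst_hol Hs acc.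
apply/locally_cstV/(locally_cst_hol s0 Hs) => e /acc[q qp [cq|[r r0 Hr]]]; exists q => //.
  by left; exact: criticalV.
by right; exists r => // u /Hr ->.
Qed.

(* Otherwise [F] is constant near [p], and hence near every point of the segment
   from [p] to [z1], where its derivative does not vanish. *)
Lemma critical_isolated F z1 d1 : mero F -> cabs z1 < 1 -> dif F z1 d1 -> d1 != 0 ->
  forall p, cabs p < 1 -> exists2 r : R, 0 < r &
    forall q, q != p -> cabs (q - p) < r -> ~ critical F q.
Proof.
move=> mF z1U Hd d0 p pU; apply: contrapT => N.
have Ap : locally_cst F p.
  apply: locally_cst_closed => // e e0; apply: contrapT => N2; apply: N; exists e => //.
  by move=> q qp qe cq; apply: N2; exists q => //; left.
pose path t := p + t%:C%C * (z1 - p).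
have pathU t : 0 <= t <= 1 -> cabs (path t) < 1.
  move=> /andP[t0 t1]; have -> : path t = (1 - t)%:C%C * p + t%:C%C * z1.
    by rewrite /path rmorphB rmorph1; ring.
  apply: le_lt_trans (ler_cabsD _ _) _; rewrite !cabsM !cabsR !ger0_norm ?subr_ge0//.
  have h1 : (1 - t) * cabs p <= (1 - t) * Num.max (cabs p) (cabs z1).
    by rewrite ler_wpM2l ?subr_ge0// le_max lexx.
  have h2 : t * cabs z1 <= t * Num.max (cabs p) (cabs z1).
    by rewrite ler_wpM2l// le_max lexx orbT.
  have : Num.max (cabs p) (cabs z1) < 1 by rewrite gt_max pU.
  by move: h1 h2; clear; lra.
have L0 : 0 < cabs (z1 - p) + 1 by rewrite ltr_wpDl// cabs_ge0.
have near s t e : `|t - s| < e / (cabs (z1 - p) + 1) -> cabs (path t - path s) < e.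
  have -> : path t - path s = (t - s)%:C%C * (z1 - p) by rewrite /path rmorphB; ring.
  rewrite ltr_pdivlMr// cabsM cabsR => h; apply: le_lt_trans h.
  by rewrite ler_wpM2l// lerDl.
suff : locally_cst F (path 0) <-> locally_cst F (path 1).
  rewrite /path mul0r addr0 mul1r subrKC => -[/(_ Ap) + _] => /locally_cst_dif0 H.
  by move: d0; rewrite (dif_unique Hd H) eqxx.
apply: (@itv_induction _ (fun s t => locally_cst F (path s) <-> locally_cst F (path t))) => //.
  by move=> x y z _ _ _ _ [h1 h2] [h3 h4]; split; [move/h1/h3|move/h4/h2].
move=> x xI.
have [e e0 He] : exists2 e : R, 0 < e & forall t, cabs (path t - path x) < e ->
    (locally_cst F (path t) <-> locally_cst F (path x)).
  have [[r r0 Hr]|nA] := pselect (locally_cst F (path x)).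
    exists r => // t tr; split=> _; first by exists r.
    exists (r - cabs (path t - path x)); first by rewrite subr_gt0.
    move=> u ur; rewrite !Hr//; have := cabs_triangle u (path t) (path x); move: ur; clear; lra.
  have [e e0 He] : exists2 e : R, 0 < e & forall q, q != path x -> cabs (q - path x) < e ->
      ~ locally_cst F q.
    apply: contrapT => N2; apply: nA; apply: locally_cst_closed => //; first exact: pathU.
    move=> e e0; apply: contrapT => N3; apply: N2; exists e => // q qx qe lq.
    by apply: N3; exists q => //; right.
  exists e => // t te; have [->//|tx] := eqVneq (path t) (path x).
  by split => // /(He _ tx te).
exists (e / (cabs (z1 - p) + 1)); first by rewrite divr_gt0.
move=> s t _ sx xt _ st ts.
have h1 : locally_cst F (path s) <-> locally_cst F (path x).
  by apply/He/near; rewrite distrC ger0_norm ?subr_ge0//; move: ts xt; clear; lra.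
have h2 : locally_cst F (path t) <-> locally_cst F (path x).
  by apply/He/near; rewrite ger0_norm ?subr_ge0//; move: ts sx; clear; lra.
by split=> [/h1/h2|/h2/h1].
Qed.

Lemma critical_finite F z1 d1 (r : R) : mero F -> cabs z1 < 1 -> dif F z1 d1 -> d1 != 0 ->
  0 <= r -> r < 1 -> exists ps : seq C, forall p, cabs p <= r -> critical F p -> p \in ps.
Proof.
move=> mF z1U Hd d0 r0 r1.
have [| | |ps Hps] := @closed_disc_induction R (fun S => exists ps : seq C,
  forall p, S p -> critical F p -> p \in ps) 0 r r0.
- by move=> A B AB [ps H]; exists ps => p /AB; exact: H.
- move=> A B [ps H] [qs K]; exists (ps ++ qs) => p [/H h|/K h] /h; rewrite mem_cat => -> //.
  by rewrite orbT.
- move=> p; rewrite subr0 => pr; have [e e0 He] := critical_isolated mF z1U Hd d0 (le_lt_trans pr r1).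
  exists e => //; exists [:: p] => q qe cq; rewrite inE; apply/negPn/negP => qp.
  exact: He qp qe cq.
by exists ps => p pr; apply: Hps; rewrite /= subr0.
Qed.

(* A limit point of the lift inside the disk would be regular, and [ml_extend]
   would continue the lift past [X]. *)
Lemma lift_end F z1 O sigma sigma0 e0 (X y r A : R) : mero F ->
  max_lift F z1 O sigma sigma0 e0 -> (forall x, x < X -> O (cplx x y)) ->
  ~ O (cplx X y) -> 0 <= r -> r < 1 -> A < X ->
  (forall p, cabs p <= r -> critical F p -> F p <> cexp (cplx X y)) ->
  exists2 x, A < x < X & r < cabs (sigma (cplx x y)).
Proof.
move=> mF ML HO nO r0 r1 AX Hc; apply: contrapT => N.
have small x : A < x < X -> cabs (sigma (cplx x y)) <= r.
  by move=> xI; rewrite leNgt; apply/negP => h; apply: N; exists x.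
(* The induction is on sets that the lift eventually avoids as [x] tends to [X]: if every point of
   the closed disc has such a neighbourhood, the lift leaves the disc. *)
have [| | |A' A'X HA'] := @closed_disc_induction R (fun S => exists2 A', A' < X &
  forall x, A' < x < X -> ~ S (sigma (cplx x y))) 0 r r0.
- by move=> S T ST [A' h H]; exists A' => // x /H k /ST.
- move=> S T [A1 h1 H1] [A2 h2 H2]; exists (Num.max A1 A2); first by rewrite gt_max h1.
  move=> x /andP[]; rewrite gt_max => /andP[k1 k2] k3.
  by move=> [|]; [apply: H1|apply: H2]; rewrite ?k1 ?k2.
- move=> p; rewrite subr0 => pr; have pU := le_lt_trans pr r1.
  have [[d dp0 Hd]|acc] := pselect (exists2 d, 0 < d & forall x, X - d < x < X ->
      ~ cabs (sigma (cplx x y) - p) < d).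
    by exists d => //; exists (X - d); rewrite ?gtrBl.
  exfalso; apply: nO.
  have {}acc d : 0 < d -> exists2 x, X - d < x < X & cabs (sigma (cplx x y) - p) < d.
    move=> dp0; apply: contrapT => N2; apply: acc; exists d => // x xI xd.
    by apply: N2; exists x.
  (* Stated for a general pair because at [p] either [F] or its inverse is holomorphic. *)
  have lim (G : C -> C) (E : C -> C) (s : R) : 0 < s -> hol G p s -> ccont E (cplx X y) ->
      (forall x, x < X -> G (sigma (cplx x y)) = E (cplx x y)) -> G p = E (cplx X y).
    move=> s0 Hs cE GE; have [|k /dif_cont cG] := Hs p; first by rewrite subrr cabs0.
    apply/cabs_sub_eq0/eqP; rewrite eq_le cabs_ge0 andbT.
    apply/ler_addgt0Pl => e ep; rewrite addr0; have e2 : 0 < e / 2 by rewrite divr_gt0.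
    have [a a0 Ha] := cG _ e2; have [b b0 Hb] := cE _ e2.
    have [|x /andP[x1 x2] xp] := acc (Num.min a b); first by rewrite lt_min a0.
    have h1 := Ha _ (lt_le_trans xp (_ : Num.min a b <= a)).
    have {}h1 := h1 ltac:(by rewrite ge_min lexx).
    have h2 : cabs (E (cplx x y) - E (cplx X y)) < e / 2.
      apply: Hb; rewrite cplxB subrr cabsE /= expr0n addr0 sqrtr_sqr.
      have mb : Num.min a b <= b by rewrite ge_min lexx orbT.
      rewrite ltr_norml; move: x1 x2 mb b0; set m := Num.min a b; clearbody m; clear => *; apply/andP; split; lra.
    rewrite GE// in h1; have := cabs_triangle (G p) (E (cplx x y)) (E (cplx X y)).
    by rewrite (cabsB (G p) (E (cplx x y))); move: h1 h2; clear; lra.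
  have Fs x : x < X -> F (sigma (cplx x y)) = cexp (cplx x y).
    by move=> /HO /(ml_sigma ML)[].
  have Fp : F p = cexp (cplx X y).
    have [[s s0 Hs]|[s s0 Hs]] := mF p pU; first exact: (lim F (@cexp R) s s0 Hs (ccont_cexp _) Fs).
    apply: invr_inj; apply: (lim (fun u => (F u)^-1) (fun u => (cexp u)^-1) s s0 Hs).
      exact: dif_cont (difV (cexp_neq0 _) (dif_cexp _)).
    by move=> x xX; rewrite Fs.
  apply: (ml_extend ML HO _ Fp acc).
  apply: contrapT => nr; apply: (Hc p pr _ Fp); split=> //.
  by rewrite Fp cexp_neq0.
pose x := (Num.max A A' + X) / 2.
have AA : Num.max A A' < X by rewrite gt_max AX.
have xI : Num.max A A' < x < X by rewrite /x; move: AA; clear => ?; apply/andP; split; lra.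
move: xI; rewrite gt_max => /andP[/andP[xA xA'] xX].
have := HA' x; rewrite xA' xX => /(_ isT); apply; rewrite /= subr0.
by apply: small; rewrite xA xX.
Qed.

End CriticalPoints.

(** * The inequality in the disk *)

Section BlaschkeQuotient.
Variable R : realType.
Local Notation C := R[i].
Implicit Types (a b z u : C).

Definition blaschke a z : C := (z - a) / (1 - a^*%C * z).

Lemma cabs_conj z : cabs z^*%C = cabs z.
Proof. by rewrite !cabsE; case: z => x y /=; rewrite sqrrN. Qed.

Lemma mulcJ z : z * z^*%C = ((cabs z ^+ 2)%:C)%C.
Proof.
rewrite sqr_cabs; case: z => x y; apply/eqP; rewrite eq_complex /=.
by apply/andP; split; apply/eqP; ring.
Qed.

Lemma one_sub_sqr z : ((1 - cabs z ^+ 2)%:C)%C = 1 - z * z^*%C.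
Proof. by rewrite mulcJ raddfB. Qed.

Lemma blaschke_den a z : cabs a < 1 -> cabs z < 1 -> 1 - a^*%C * z != 0.
Proof.
move=> aU zU; rewrite -cabs_gt0; have := ler_sub_cabs 1 (a^*%C * z).
apply: lt_le_trans; rewrite cabs1 cabsM cabs_conj subr_gt0.
by have := cabs_ge0 a; have := cabs_ge0 z; move: aU zU; clear; nra.
Qed.

Lemma blaschke_normE a z : 1 - a^*%C * z != 0 ->
  1 - cabs (blaschke a z) ^+ 2 =
  (1 - cabs a ^+ 2) * (1 - cabs z ^+ 2) / cabs (1 - a^*%C * z) ^+ 2.
Proof.
move=> d0; have D0 : cabs (1 - a^*%C * z) ^+ 2 != 0 by rewrite expf_neq0// cabs_eq0.
rewrite /blaschke cabsM cabsV expr_div_n; apply: (mulIf D0).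
rewrite mulfVK// mulrBl mul1r mulfVK//.
rewrite !sqr_cabs !cReB !cImB !cReM !cImM; case: a {d0 D0} => p q; case: z => x y /=; ring.
Qed.

Lemma blaschke_lt1 a z : cabs a < 1 -> cabs z < 1 -> cabs (blaschke a z) < 1.
Proof.
move=> aU zU; have d0 := blaschke_den aU zU; have := blaschke_normE d0.
have sq (x : R) : 0 <= x -> x < 1 -> 0 < 1 - x ^+ 2.
  by move=> x0 x1; rewrite subr_gt0 expr_lt1.
have p : 0 < (1 - cabs a ^+ 2) * (1 - cabs z ^+ 2) / cabs (1 - a^*%C * z) ^+ 2.
  by rewrite divr_gt0 ?mulr_gt0 ?sq ?cabs_ge0 ?exprn_gt0 ?cabs_gt0.
move=> E; rewrite -E subr_gt0 in p.
by move: p; rewrite expr_lt1// cabs_ge0.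
Qed.

Lemma blaschke_eq0 a z : cabs a < 1 -> cabs z < 1 -> (blaschke a z == 0) = (z == a).
Proof.
move=> aU zU; rewrite /blaschke mulf_eq0 invr_eq0 (negbTE (blaschke_den aU zU)) orbF.
by rewrite subr_eq0.
Qed.

Lemma blaschke_dif a z : cabs a < 1 -> cabs z < 1 ->
  dif (blaschke a) z (((1 - cabs a ^+ 2)%:C)%C / (1 - a^*%C * z) ^+ 2).
Proof.
move=> aU zU; have d0 := blaschke_den aU zU.
have H1 : dif (fun u => u - a) z (1 - 0) by apply: difB (dif_id _) (dif_cst _ _).
have H2 : dif (fun u => 1 - a^*%C * u) z (0 - a^*%C * 1).
  by apply: difB (dif_cst _ _) _; apply: difZ; exact: dif_id.
have := difM H1 (@difV _ (fun u => 1 - a^*%C * u) _ _ d0 H2).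
rewrite one_sub_sqr; congr dif; field; exact: d0.
Qed.

Lemma blaschke_inj a z u : cabs a < 1 -> cabs z < 1 -> cabs u < 1 ->
  blaschke a z = blaschke a u -> z = u.
Proof.
move=> aU zU uU; have d0 := blaschke_den aU zU; have d1 := blaschke_den aU uU.
move=> /eqP; rewrite /blaschke eqr_div// => /eqP E.
have : (z - u) * (1 - a * a^*%C) = 0.
  have -> : (z - u) * (1 - a * a^*%C) = (z - a) * (1 - a^*%C * u) - (u - a) * (1 - a^*%C * z) by ring.
  by rewrite E subrr.
move=> /eqP; rewrite mulf_eq0 subr_eq0 => /orP[/eqP//|/eqP/(congr1 (@cabs R))].
have := blaschke_den aU aU; rewrite [a^*%C * a]mulrC => h h2.
by move: h; rewrite -cabs_eq0 h2 cabs0 eqxx.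
Qed.

Definition bq a b z := blaschke a z / blaschke b z.

Lemma bqV a b z : (bq a b z)^-1 = bq b a z.
Proof. by rewrite /bq invfM invrK mulrC. Qed.

Lemma bq_neq0 a b z : cabs a < 1 -> cabs b < 1 -> cabs z < 1 -> z != a -> z != b -> bq a b z != 0.
Proof. by move=> aU bU zU za zb; rewrite /bq mulf_neq0 ?invr_eq0 ?blaschke_eq0. Qed.

Lemma bq_dif a b z : cabs a < 1 -> cabs b < 1 -> cabs z < 1 -> z != b ->
  exists k, dif (bq a b) z k.
Proof.
move=> aU bU zU zb; have B0 : blaschke b z != 0 by rewrite blaschke_eq0.
by eexists; exact: difM (blaschke_dif aU zU) (difV B0 (blaschke_dif bU zU)).
Qed.

Lemma bq_dif_base a b : cabs a < 1 -> cabs b < 1 -> a != b -> exists2 k, dif (bq a b) a k &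
  cabs k = ((1 - cabs a ^+ 2) * cabs (blaschke a b))^-1.
Proof.
move=> aU bU ab; have B0 : blaschke b a != 0 by rewrite blaschke_eq0.
have := difM (blaschke_dif aU aU) (difV B0 (blaschke_dif bU aU)).
have -> : blaschke a a = 0 by rewrite /blaschke subrr mul0r.
rewrite mul0r addr0 => H; eexists; first exact: H.
have d0 := blaschke_den aU aU.
have dE : 1 - a^*%C * a = ((1 - cabs a ^+ 2)%:C)%C by rewrite one_sub_sqr mulrC.
have s0 : 0 < 1 - cabs a ^+ 2 by rewrite subr_gt0 expr_lt1// cabs_ge0.
have Bs : cabs (blaschke b a) = cabs (blaschke a b).
  rewrite /blaschke !cabsM !cabsV cabsB; congr (_ / _).
  by rewrite -cabs_conj rmorphB rmorph1 rmorphM /= conjcK mulrC.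
move: (blaschke b a) (blaschke a b) Bs B0 {H} => p q Bs; rewrite -cabs_gt0 Bs => q0.
rewrite !cabsM !cabsV dE !cabsX cabsR gtr0_norm// Bs; field.
by rewrite !gt_eqF.
Qed.

(** Besides [u = u'], the equation in the coordinate [u] leaves only
    [|u'| * |u - c| = |1 - c^*%C * u|], which is impossible as [|u'| < 1] and
    [|blaschke c u| < 1]. *)
Lemma bq_inj a b z z' : cabs a < 1 -> cabs b < 1 -> a != b -> cabs z < 1 -> cabs z' < 1 ->
  z != b -> z' != b -> bq a b z = bq a b z' -> z = z'.
Proof.
move=> aU bU ab zU z'U zb z'b E.
set u := blaschke a z; set u' := blaschke a z'; set c := blaschke a b.
have uU : cabs u < 1 by exact: blaschke_lt1.
have u'U : cabs u' < 1 by exact: blaschke_lt1.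
have cU : cabs c < 1 by exact: blaschke_lt1.
have c0 : c != 0 by rewrite blaschke_eq0// eq_sym.
(* in the coordinate [u = blaschke a z], up to a constant factor, [blaschke b] is [blaschke c] *)
have [l l0 Bl] : exists2 l, l != 0 & forall w, cabs w < 1 -> blaschke b w = l * blaschke c (blaschke a w).
  exists ((1 - a^*%C * b) / (1 - b^*%C * a)).
    by rewrite mulf_neq0 ?invr_eq0 ?blaschke_den.
  move=> w wU.
  have d1 := blaschke_den aU bU; have d2 := blaschke_den bU aU.
  have d3 := blaschke_den aU wU; have d4 := blaschke_den bU wU; have d5 := blaschke_den aU aU.
  have h1 : blaschke a w - c = (w - b) * (1 - a^*%C * a) / ((1 - a^*%C * w) * (1 - a^*%C * b)).
    by rewrite /c /blaschke; field; rewrite d1 d3.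
  have h2 : 1 - c^*%C * blaschke a w = (1 - a^*%C * a) * (1 - b^*%C * w) / ((1 - b^*%C * a) * (1 - a^*%C * w)).
    have -> : c^*%C = (b^*%C - a^*%C) / (1 - b^*%C * a).
      rewrite /c /blaschke rmorphM /= conjc_inv !rmorphB rmorph1 rmorphM /= conjcK.
      by rewrite [a * _]mulrC.
    by rewrite /blaschke; field; rewrite d2 d3.
  rewrite {2}/blaschke h1 h2 {1}/blaschke; field.
  by rewrite d1 d2 d3 d4 d5.
have B1 : blaschke c u != 0.
  have : blaschke b z != 0 by rewrite blaschke_eq0.
  by rewrite Bl// mulf_eq0 negb_or => /andP[].
have B2 : blaschke c u' != 0.
  have : blaschke b z' != 0 by rewrite blaschke_eq0.
  by rewrite Bl// mulf_eq0 negb_or => /andP[].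
have E2 : u * blaschke c u' = u' * blaschke c u.
  move: E; rewrite /bq (Bl z zU) (Bl z' z'U) -/u -/u' => /eqP.
  rewrite (eqr_div _ _ (mulf_neq0 l0 B1) (mulf_neq0 l0 B2)) => /eqP h.
  by apply: (mulfI l0); rewrite mulrCA h mulrCA.
have e1 := blaschke_den cU uU; have e2 := blaschke_den cU u'U.
have E3 : (u - u') * (c^*%C * (u' * (u - c)) + (c - c * c^*%C * u)) = 0.
  have h : u * (u' - c) * (1 - c^*%C * u) = u' * (u - c) * (1 - c^*%C * u').
    have -> : u * (u' - c) * (1 - c^*%C * u) =
      u * blaschke c u' * ((1 - c^*%C * u') * (1 - c^*%C * u)).
      by rewrite /blaschke; field; exact: e2.
    by rewrite E2 /blaschke; field; exact: e1.
  have -> : (u - u') * (c^*%C * (u' * (u - c)) + (c - c * c^*%C * u)) =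
    u' * (u - c) * (1 - c^*%C * u') - u * (u' - c) * (1 - c^*%C * u) by ring.
  by rewrite -h subrr.
move/eqP: E3; rewrite mulf_eq0 subr_eq0 => /orP[/eqP uu|/eqP E4].
  exact: blaschke_inj uu.
exfalso; have : cabs (c^*%C * (u' * (u - c))) = cabs (c * (1 - c^*%C * u)).
  rewrite -cabsN; congr cabs; apply/eqP; rewrite -subr_eq0; apply/eqP.
  by rewrite -[RHS]oppr0 -E4; ring.
have cc0 : cabs c != 0 by rewrite cabs_eq0.
rewrite !(cabsM c) (cabsM c^*%C) cabs_conj cabsM => /(mulfI cc0) E5.
have := blaschke_lt1 cU uU; rewrite /blaschke cabsM cabsV ltr_pdivrMr ?cabs_gt0// mul1r -E5.
by rewrite ltNge => /negP; apply; rewrite ler_piMl ?cabs_ge0// ltW.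
Qed.

Lemma blaschke_boundary a (e : R) : cabs a < 1 -> 0 < e -> exists2 r : R, 0 <= r < 1 &
  forall z, r < cabs z -> cabs z < 1 -> `|ln (cabs (blaschke a z))| < e.
Proof.
move=> aU e0; have a1 : 0 < 1 - cabs a by rewrite subr_gt0.
(* By [blaschke_normE] and [|1 - a^*%C * z| >= 1 - |a|], this gives
   [1 - |blaschke a z| ^+ 2 <= (1 - |z|) * K]. *)
pose K := 2 / (1 - cabs a) ^+ 2.
have K0 : 0 < K by rewrite divr_gt0// exprn_gt0.
pose q := expR (- (e * 2)).
have q0 : 0 < q by exact: expR_gt0.
have q1 : 0 < 1 - q by rewrite subr_gt0 /q expR_lt1 oppr_lt0 mulr_gt0.
pose r := Num.max 0 (1 - (1 - q) / K).
exists r; first by rewrite le_max lexx gt_max ltr01 gtrBl divr_gt0.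
move=> z; rewrite gt_max => /andP[_ rz] zU; have d0 := blaschke_den aU zU.
set B := cabs (blaschke a z).
have zK : (1 - cabs z) * K < 1 - q by rewrite -ltr_pdivlMr// ltrBlDr -ltrBlDl.
have Bq : q < B ^+ 2.
  have : 1 - B ^+ 2 <= (1 - cabs z) * K.
    rewrite blaschke_normE// /K mulrA; apply: ler_pM.
    - rewrite mulr_ge0// subr_ge0 expr_le1 ?cabs_ge0 ?ltW//.
    - by rewrite invr_ge0 sqr_ge0.
    - have h : (1 - cabs z ^+ 2) = (1 - cabs z) * (1 + cabs z) by ring.
      have : (1 - cabs z) * (1 + cabs z) <= (1 - cabs z) * 2.
        by rewrite ler_wpM2l ?subr_ge0 ?(ltW zU)//; move: zU; clear; lra.
      rewrite h; apply: le_trans; rewrite ler_piMl//.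
        by rewrite mulr_ge0 ?subr_ge0 ?(ltW zU)// addr_ge0// cabs_ge0.
      by rewrite gerBl sqr_ge0.
    rewrite lef_pV2 ?posrE ?exprn_gt0 ?cabs_gt0// lerXn2r// ?nnegrE ?cabs_ge0 ?(ltW a1)//.
    have := ler_sub_cabs 1 (a^*%C * z); rewrite cabs1 cabsM cabs_conj; apply: le_trans.
    by rewrite lerD2l lerN2 ler_piMr ?cabs_ge0// ltW.
  by move: zK; clear; lra.
have B0 : 0 < B.
  rewrite lt_neqAle cabs_ge0 andbT; apply/negP => /eqP h.
  by move: Bq; rewrite -h expr0n ltNge (ltW q0).
have B1 : B < 1 by exact: blaschke_lt1.
have l0 : ln B < 0 by rewrite ln_lt0// B0.
have : - (e * 2) < ln (B ^+ 2) by rewrite -[X in X < _]expRK ltr_ln ?posrE// exprn_gt0.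
by rewrite lnXn// mulr2n ltr0_norm//; clear; lra.
Qed.

Lemma bq_boundary a b (e : R) : cabs a < 1 -> cabs b < 1 -> 0 < e -> exists2 r : R, 0 <= r < 1 &
  forall z, r < cabs z -> cabs z < 1 -> z != a -> z != b -> `|ln (cabs (bq a b z))| < e.
Proof.
move=> aU bU e0; have e2 : 0 < e / 2 by rewrite divr_gt0.
have [r /andP[r0 r1] Hr] := blaschke_boundary aU e2.
have [s /andP[s0 s1] Hs] := blaschke_boundary bU e2.
exists (Num.max r s); first by rewrite le_max r0 gt_max r1.
move=> z; rewrite gt_max => /andP[/Hr h1 /Hs h2] zU za zb.
have := h1 zU; have := h2 zU => /ltr_normlP[k1 k2] /ltr_normlP[k3 k4].
rewrite /bq cabsM cabsV ln_div ?posrE ?cabs_gt0 ?blaschke_eq0//.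
by apply/ltr_normlP; split; move: k1 k2 k3 k4; clear; lra.
Qed.

End BlaschkeQuotient.

(** * Asymptotics of the Blaschke quotient along a lift *)

Section DiscInequality.
Variable R : realType.
Local Notation C := R[i].
Implicit Types (F f g K : C -> C) (z w u p a b : C).

Lemma ln_asymptotic K (k : C) (e : R) : dif K 0 k -> K 0 = 0 -> k != 0 -> 0 < e ->
  exists2 r : R, 0 < r & forall w, w != 0 -> cabs w < r ->
    `|ln (cabs (K w)) - ln (cabs w) - ln (cabs k)| <= e.
Proof.
move=> Hk K0 k0 e0; have kk : 0 < cabs k by rewrite cabs_gt0.
pose e1 := Num.min 6^-1 (e / 3).
have e10 : 0 < e1 by rewrite lt_min; apply/andP; split; lra.
have [r r0 Hr] := Hk (e1 * cabs k) (mulr_gt0 e10 kk).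
exists r => // w w0 wr; have ww : 0 < cabs w by rewrite cabs_gt0.
pose t := (K w - k * w) / (k * w).
have te : cabs t <= e1.
  rewrite /t cabsM cabsV [cabs (k * w)]cabsM ler_pdivrMr ?mulr_gt0// mulrA.
  by have := Hr w; rewrite subr0 K0 subr0 => /(_ wr).
have t6 : cabs t <= 6^-1 by apply: le_trans te _; rewrite ge_min lexx.
have t3 : cabs t <= e / 3 by apply: le_trans te _; rewrite ge_min lexx orbT.
have KE : K w = k * w * (1 + t) by rewrite /t; field; rewrite k0 w0.
have t1 : 0 < cabs (1 + t).
  have := ler_sub_cabs 1 (- t); rewrite cabsN cabs1 opprK; move: t6; clear; lra.
rewrite KE !cabsM lnM ?posrE ?mulr_gt0// lnM ?posrE//.
have := ln_cabs_near1 t6; have := ler_Re_cabs t; have := cabs_ge0 t.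
move=> c0 /ler_normlP[h1 h2] /ler_normlP[h3 h4].
have c2 : cabs t ^+ 2 <= 6^-1 * cabs t by rewrite expr2 ler_wpM2r.
rewrite ler_norml; move: c0 h1 h2 h3 h4 c2 t3; clear.
set L := ln (cabs (1 + t)); set A := ln (cabs k); set B := ln (cabs w).
by move=> *; apply/andP; split; lra.
Qed.

(** [affine_hits] solves [K w = T] near [c = T / k]; a disc of radius [d * (1 - q)] about [c] is
    available because [|c| < d * q]. *)
Lemma hol_covers K (k : C) (e s : R) : 0 < s -> hol K 0 s -> dif K 0 k -> K 0 = 0 -> k != 0 ->
  0 < e -> exists2 r : R, 0 < r & forall d T, 0 < d -> d < r -> cabs T < d * cabs k * expR (- e) ->
    exists2 w, cabs w < d & K w = T.
Proof.
move=> s0 Hs Hk K0 k0 e0; have kk : 0 < cabs k by rewrite cabs_gt0.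
pose q := expR (- e); have q0 : 0 < q by exact: expR_gt0.
have q1 : 0 < 1 - q by rewrite subr_gt0 /q expR_lt1 oppr_lt0.
pose e1 := cabs k * (1 - q) / 4.
have e10 : 0 < e1 by rewrite divr_gt0// mulr_gt0.
have [r r0 Hr] := Hk e1 e10.
exists (Num.min r s); first by rewrite lt_min r0.
move=> d T d0; rewrite lt_min => /andP[dr ds]; rewrite -/q => Td.
pose c := T / k; have cd : cabs c < d * q.
  by rewrite /c cabsM cabsV ltr_pdivrMr// mulrAC.
pose rho := d * (1 - q); have rho0 : 0 < rho by rewrite mulr_gt0.
have near u : cabs (u - c) <= rho -> cabs u < d.
  have := cabs_triangle u c 0; rewrite !subr0 /rho mulrBr mulr1; move: cd; clear; lra.
have [||||w wr <-] := @affine_hits R K c k T rho (s - cabs c) (e1 * d) rho0.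
- by rewrite ltrBrDr; move: cd ds; rewrite /rho mulrBr mulr1; clear; lra.
- move=> u uc; apply: Hs; rewrite subr0; have := ler_sub_cabs u c; move: uc; clear; lra.
- move=> u /near ud; have := Hr u; rewrite subr0 K0 subr0 => /(_ (lt_trans ud dr)) h.
  have -> : K u - T - k * (u - c) = K u - k * u by rewrite /c; field.
  by apply: le_trans h _; rewrite ler_wpM2l ?(ltW e10)// ltW.
- rewrite /e1 /rho; have : 0 < cabs k * (1 - q) * d by rewrite !mulr_gt0.
  by clear; lra.
by exists w => //; apply: near; exact: ltW.
Qed.

Lemma section_dif_at F (G tau : C -> C) z k (r : R) : 0 < r -> ccont tau z ->
  (forall u, cabs (u - z) < r -> F (tau u) = G u) ->
  (exists2 d, d != 0 & dif F (tau z) d) -> dif G z k -> exists m, dif tau z m.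
Proof.
move=> r0 ct FG [d d0 Hd] Hk; exists (k / d).
by apply: section_dif ct _ Hd d0 Hk; exists r.
Qed.

Lemma lift_hol F a (G : C -> C) O sigma sigma0 e0 : max_lift F a O sigma sigma0 e0 ->
  (forall z, cabs z < 1 -> F z != 0 -> exists k, dif G z k) ->
  forall z, O z -> exists2 s : R, 0 < s & hol (fun u => G (sigma u)) z s.
Proof.
move=> ML HG z Oz; have [r r0 Hr] := ml_open ML Oz; exists r => // u ur.
have Ou := Hr u ur; have [[sU Fs Hd] _ cs _] := ml_sigma ML Ou.
have [s s0 Hs] := ml_open ML Ou.
have [m Hm] := @section_dif_at F (@cexp R) sigma u _ s s0 cs
  (fun v vs => let: And4 _ h _ _ := ml_sigma ML (Hs v vs) in h) Hd (dif_cexp u).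
have [k Hk] := HG _ sU Fs.
by eexists; exact: dif_comp Hm Hk.
Qed.

(** [K] is the Blaschke quotient in the coordinate [w = cexp zeta] of the lift; the logarithm of
    [|k|] is the additive constant in the asymptotics. *)
Lemma lift_chart F a b d O sigma sigma0 e0 : max_lift F a O sigma sigma0 e0 ->
  cabs a < 1 -> cabs b < 1 -> a != b -> F b = 0 -> dif F a d -> d != 0 ->
  let K w := bq a b (sigma0 w) in
  [/\ hol K 0 e0, K 0 = 0 & exists2 k, k != 0 & dif K 0 k /\
    cabs k = ((1 - cabs a ^+ 2) * cabs (blaschke a b) * cabs d)^-1].
Proof.
move=> ML aU bU ab Fb Hd d0 K; have e00 := ml_e0 ML.
have sb w : cabs w < e0 -> sigma0 w != b.
  move=> we; apply/eqP => sw; have [_ Fw _ _] := ml_base ML we.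
  have w0 : w = 0 by rewrite -Fw sw Fb.
  by move: ab; rewrite -sw w0 (ml_base0 ML) eqxx.
have sd w : cabs w < e0 -> exists m, dif sigma0 w m.
  move=> we; have [_ _ Hk cw] := ml_base ML we.
  apply: (@section_dif_at F id sigma0 w 1 (e0 - cabs w)) => //.
  - by rewrite subr_gt0.
  - move=> u uw; have ue : cabs u < e0.
      by have := ler_sub_cabs u w; move: uw; clear; lra.
    by have [] := ml_base ML ue.
  - exact: dif_id.
have c0 : cabs (0 : C) < e0 by rewrite cabs0.
split.
- move=> w; rewrite subr0 => we; have [m Hm] := sd w we; have [sU _ _ _] := ml_base ML we.
  have [k Hk] := bq_dif aU bU sU (sb w we).
  by eexists; exact: dif_comp Hm Hk.
- by rewrite /K (ml_base0 ML) /bq /blaschke subrr !mul0r.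
have [k Hk kE] := bq_dif_base aU bU ab.
have s0 : 0 < 1 - cabs a ^+ 2 by rewrite subr_gt0 expr_lt1// cabs_ge0.
have B0 : 0 < cabs (blaschke a b) by rewrite cabs_gt0 blaschke_eq0// eq_sym.
have kn : k != 0 by rewrite -cabs_gt0 kE invr_gt0 mulr_gt0.
have [_ _ _ cw] := ml_base ML c0.
have Hs : dif sigma0 0 (1 / d).
  apply: (@section_dif _ F id) cw _ _ d0 (dif_id 0); last by rewrite (ml_base0 ML).
  by exists e0 => // u; rewrite subr0 => /(ml_base ML)[].
exists (k * (1 / d)); first by rewrite mulf_neq0// mul1r invr_eq0.
split; first by apply: dif_comp Hs _; rewrite (ml_base0 ML).
by rewrite cabsM kE mul1r cabsV -invfM.
Qed.

(** The second part confines the lifts to an annulus: a smaller value of [bq a b] would be taken, by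
    [hol_covers], at some [sigma0 w] with [|w| < expR x], hence by injectivity at [z] itself,
    against [expR x <= |F z|]. *)
Lemma lift_bounds F a b d O sigma sigma0 e0 : mero F -> max_lift F a O sigma sigma0 e0 ->
  cabs a < 1 -> cabs b < 1 -> a != b -> F a = 0 -> F b = 0 -> dif F a d -> d != 0 ->
  let c := - ln ((1 - cabs a ^+ 2) * cabs (blaschke a b) * cabs d) in
  forall e : R, 0 < e -> exists X : R, forall x, x < X ->
    (forall z, complex.Re z <= x -> O z /\ `|ln (cabs (bq a b (sigma z))) - complex.Re z - c| <= e) /\
    (forall z, cabs z < 1 -> z != a -> z != b -> expR x <= cabs (F z) ->
       x + c - e <= ln (cabs (bq a b z))).
Proof.
move=> mF ML aU bU ab Fa Fb Hd d0 c e ep.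
have [HK K0 [k kn [Hk kE]]] := lift_chart ML aU bU ab Fb Hd d0.
set K := (fun w => bq a b (sigma0 w)) in HK K0 Hk.
have cE : ln (cabs k) = c.
  have bab : 0 < cabs (blaschke a b) by rewrite cabs_gt0 blaschke_eq0// eq_sym.
  have dd : 0 < cabs d by rewrite cabs_gt0.
  have s0 : 0 < 1 - cabs a ^+ 2 by rewrite subr_gt0 expr_lt1// cabs_ge0.
  by rewrite kE lnV// posrE !mulr_gt0.
have e00 := ml_e0 ML.
have [r1 r10 H1] := ln_asymptotic Hk K0 kn ep.
have [r2 r20 H2] := hol_covers e00 HK Hk K0 kn ep.
pose m := Num.min e0 (Num.min r1 r2).
have m0 : 0 < m by rewrite /m !lt_min e00 r10.
exists (ln m) => x xm.
have ex : expR x < m by rewrite -[ltRHS]lnK// ltr_expR.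
move: ex; rewrite !lt_min => /and3P[xe xr1 xr2]; split.
  move=> z zx; have ez : expR (complex.Re z) < e0 by apply: le_lt_trans xe; rewrite ler_expR.
  have Oz := ml_near ML ez; split=> //; have [_ _ _ /(_ ez) ->] := ml_sigma ML Oz.
  have := H1 (cexp z) (cexp_neq0 _); rewrite cabs_cexp expRK cE; apply.
  by apply: le_lt_trans xr1; rewrite ler_expR.
move=> z zU za zb Fx; have q0 := bq_neq0 aU bU zU za zb.
rewrite leNgt; apply/negP => h.
have [|||w wx Kw] := H2 (expR x) (bq a b z); [exact: expR_gt0|exact: xr2| |].
  have Q : 0 < cabs (bq a b z) by rewrite cabs_gt0.
  have kk : 0 < cabs k by rewrite cabs_gt0.
  by rewrite -(lnK Q) -(lnK kk) cE -!expRD ltr_expR.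
have we : cabs w < e0 by exact: lt_trans xe.
have [sU Fw _ _] := ml_base ML we.
have sb : sigma0 w != b.
  apply/eqP => sw; have w0 : w = 0 by rewrite -Fw sw Fb.
  by move: ab; rewrite -sw w0 (ml_base0 ML) eqxx.
have zE : sigma0 w = z by apply: (bq_inj aU bU ab sU zU sb zb).
by move: Fx; rewrite -zE Fw leNgt wx.
Qed.

(** The slice of the domain at height [y] is an open half-line, and [lift_end] applies at its
    supremum. *)
Lemma lift_slice F a O sigma sigma0 e0 (A B y r : R) : mero F ->
  max_lift F a O sigma sigma0 e0 -> O (cplx A y) -> ~ O (cplx B y) -> 0 <= r -> r < 1 ->
  (forall p X, cabs p <= r -> critical F p -> F p <> cexp (cplx X y)) ->
  exists2 x, A < x & O (cplx x y) /\ r < cabs (sigma (cplx x y)).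
Proof.
move=> mF ML OA OB r0 r1 Hc; pose S := [set x | O (cplx x y)].
have ubB : ubound S B.
  by move=> x /= Ox; rewrite leNgt; apply/negP => Bx; apply: OB; apply: ml_left ML _ _ _ Ox (ltW Bx).
have hs : has_sup S by split; [exists A|exists B].
have op x : S x -> exists2 d, 0 < d & S (x + d).
  move=> /= /(ml_open ML)[d d0 Hd]; exists (d / 2); first by rewrite divr_gt0.
  apply: Hd; rewrite cplxB subrr addrAC subrr add0r cabsE /= expr0n addr0 sqrtr_sqr.
  by rewrite gtr0_norm ?divr_gt0// ltr_pdivrMr// ltr_pMr// ltr1n.
have nX : ~ S (sup S).
  move=> /op[d d0 Sd]; have := sup_upper_bound hs Sd.
  by rewrite leNgt ltrDl d0.
have AX : A < sup S.
  rewrite lt_neqAle; apply/andP; split; last exact: sup_upper_bound.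
  by apply/eqP => AE; apply: nX; rewrite -AE.
have HO x : x < sup S -> O (cplx x y).
  move=> xs; have [x' Sx' xx'] := sup_gt (ex_intro _ A OA) xs.
  exact: ml_left ML _ _ _ Sx' (ltW xx').
have [x /andP[Ax xX] rx] := lift_end mF ML HO nX r0 r1 AX (fun p pr cp => Hc p _ pr cp).
by exists x => //; split=> //; exact: HO.
Qed.

Lemma sin_neq0_period (y : R) : 0 <= y <= pi *+ 2 -> y \notin [:: 0; pi; pi *+ 2] -> sin y != 0.
Proof.
rewrite !inE !negb_or => /andP[y0 y2] /and3P[yn0 ynp yn2].
have p0 : 0 < y by rewrite lt_neqAle eq_sym yn0.
have p2 : y < pi *+ 2 by rewrite lt_neqAle yn2.
case: (ltgtP y pi) ynp => // yp _.
  by rewrite gt_eqF// sin_gt0_pi// p0.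
have : 0 < sin (y - pi).
  by apply: sin_gt0_pi; move: yp p2; rewrite mulr2n; clear; lra.
by move=> h; rewrite -(subrK pi y) sinDpi oppr_eq0 gt_eqF.
Qed.

End DiscInequality.

(** * The inequality for a function with a zero and a pole *)

Section DiscTheorem.
Variable R : realType.
Local Notation C := R[i].
Implicit Types (F f g K : C -> C) (z w u p a b : C).

Lemma meroV F : mero F -> mero (fun u => (F u)^-1).
Proof.
move=> mF z zU; have [[s s0 Hs]|[s s0 Hs]] := mF z zU; [right|left]; exists s => //.
move=> u /Hs[k Hk]; exists k; apply: dif_local ltr01 _ Hk => v _; by rewrite invrK.
Qed.

Lemma cabs_opp_ball z u (r : R) : cabs (u - z) < r -> cabs (- u - - z) < r.
Proof. by rewrite -opprD cabsN. Qed.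

Lemma cplxN (x y : R) : - cplx x y = cplx (- x) (- y). Proof. by []. Qed.

Lemma hol_opp f z (s : R) : hol f (- z) s -> hol (fun u => f (- u)) z s.
Proof.
move=> H u us; have [k Hk] := H (- u) (cabs_opp_ball us).
by exists (k * - 1); apply: dif_comp (difN (dif_id u)) Hk.
Qed.

(** [c1 + c2] is minus the logarithm of the left side. The second lift belongs to the inverse of [F]
    and is read at [- z], so that along both lifts [F] equals [cexp z]. *)
Lemma disc_inequality F a b d d' O1 s1 t1 e1 O2 s2 t2 e2 : mero F ->
  max_lift F a O1 s1 t1 e1 -> max_lift (fun u => (F u)^-1) b O2 s2 t2 e2 ->
  cabs a < 1 -> cabs b < 1 -> a != b -> F a = 0 -> F b = 0 ->
  dif F a d -> d != 0 -> dif (fun u => (F u)^-1) b d' -> d' != 0 ->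
  (forall z, sin (complex.Im z) != 0 -> O1 z -> O2 (- z) -> s1 z = s2 (- z)) ->
  (1 - cabs a ^+ 2) * (1 - cabs b ^+ 2) * cabs (blaschke a b) ^+ 2 * cabs d * cabs d' <= 1.
Proof.
move=> mF M1 M2 aU bU ab Fa Fb Hd d0 Hd' d'0 agree.
have mE := meroV mF.
have Ea : (F a)^-1 = 0 by rewrite Fa invr0.
have Eb : (F b)^-1 = 0 by rewrite Fb invr0.
have ba : b != a by rewrite eq_sym.
pose c1 := - ln ((1 - cabs a ^+ 2) * cabs (blaschke a b) * cabs d).
pose c2 := - ln ((1 - cabs b ^+ 2) * cabs (blaschke b a) * cabs d').
have sa0 : 0 < 1 - cabs a ^+ 2 by rewrite subr_gt0 expr_lt1// cabs_ge0.
have sb0 : 0 < 1 - cabs b ^+ 2 by rewrite subr_gt0 expr_lt1// cabs_ge0.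
have Bab : 0 < cabs (blaschke a b) by rewrite cabs_gt0 blaschke_eq0.
have Bba : 0 < cabs (blaschke b a) by rewrite cabs_gt0 blaschke_eq0.
have Bs : cabs (blaschke b a) = cabs (blaschke a b).
  rewrite /blaschke !cabsM !cabsV cabsB; congr (_ / _).
  by rewrite -cabs_conj rmorphB rmorph1 rmorphM /= conjcK mulrC.
have dd : 0 < cabs d by rewrite cabs_gt0.
have dd' : 0 < cabs d' by rewrite cabs_gt0.
suff c12 : 0 <= c1 + c2.
  have : ln ((1 - cabs a ^+ 2) * (1 - cabs b ^+ 2) * cabs (blaschke a b) ^+ 2 * cabs d * cabs d') <= ln 1.
    have -> : (1 - cabs a ^+ 2) * (1 - cabs b ^+ 2) * cabs (blaschke a b) ^+ 2 * cabs d * cabs d' =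
      ((1 - cabs a ^+ 2) * cabs (blaschke a b) * cabs d) * ((1 - cabs b ^+ 2) * cabs (blaschke b a) * cabs d').
      by rewrite Bs; ring.
    rewrite lnM ?posrE ?mulr_gt0// ln1; move: c12; rewrite /c1 /c2; clear; lra.
  by rewrite ler_ln ?posrE ?mulr_gt0 ?exprn_gt0.
suff S (e : R) : 0 < e -> - (8 * e) <= c1 + c2.
  apply/ler_addgt0Pr => e e0; have e8 : 0 < e / 8 by rewrite divr_gt0.
  by have := S _ e8; clear; lra.
move=> e0.
have [X1 HX1] := lift_bounds mF M1 aU bU ab Fa Fb Hd d0 e0; rewrite -/c1 in HX1.
have [X2 HX2] := lift_bounds mE M2 bU aU ba Eb Ea Hd' d'0 e0; rewrite -/c2 in HX2.
(* The slack [2^-1] beyond each end allows cuts strictly between [x0] and [x1] where the lifts are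
   still known to exist. *)
pose x0 := Num.min (X1 - 1) (-1); pose x1 := Num.max (- X2 + 1) 1.
have x0X : x0 + 2^-1 < X1.
  have : x0 <= X1 - 1 by rewrite ge_min lexx.
  by clear; lra.
have x1X : - x1 + 2^-1 < X2.
  have : - X2 + 1 <= x1 by rewrite le_max lexx.
  by clear; lra.
have x01 : x0 + 2 <= x1.
  have : x0 <= -1 by rewrite ge_min lexx orbT.
  have : 1 <= x1 by rewrite le_max lexx orbT.
  by clear; lra.
have [N1 L1] := HX1 x0 ltac:(move: x0X; clear; lra).
have [N2 L2] := HX2 (- x1) ltac:(move: x1X; clear; lra).
have [N1' _] := HX1 (x0 + 2^-1) x0X.
have [N2' _] := HX2 (- x1 + 2^-1) x1X.
have na z : F z != 0 -> z != a /\ z != b.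
  by move=> Fz; split; apply/eqP => E; move: Fz; rewrite E ?Fa ?Fb eqxx.
have S1 z : O1 z -> [/\ cabs (s1 z) < 1, s1 z != a, s1 z != b & F (s1 z) = cexp z].
  by move=> /(ml_sigma M1)[[zU /na[h1 h2] _] h _ _].
have S2 z : O2 (- z) -> [/\ cabs (s2 (- z)) < 1, s2 (- z) != a, s2 (- z) != b & F (s2 (- z)) = cexp z].
  move=> /(ml_sigma M2)[[zU Fz _] h _ _]; have [h1 h2] := na _ (ltac:(by rewrite -invr_eq0) : F (s2 (- z)) != 0).
  by split=> //; rewrite -[LHS]invrK h cexpN invrK.
pose g1 z := bq a b (s1 z); pose g2 z := bq a b (s2 (- z)).
have bound z w : cabs w < 1 -> w != a -> w != b -> F w = cexp z ->
    x0 < complex.Re z -> complex.Re z < x1 -> x0 + c1 - e <= ln (cabs (bq a b w)) <= x1 - c2 + e.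
  move=> wU wa wb Fw zx0 zx1; apply/andP; split.
    by apply: L1 => //; rewrite Fw cabs_cexp ler_expR ltW.
  have := L2 w wU wb wa; rewrite Fw cabsV cabs_cexp -expRN ler_expR lerN2 => /(_ (ltW zx1)).
  rewrite -(bqV a b w) cabsV lnV ?posrE ?cabs_gt0 ?bq_neq0//.
  by clear; lra.
have gb w : ln (cabs (bq b a w)) = - ln (cabs (bq a b w)) \/ bq a b w = 0.
  have [->|q0] := eqVneq (bq a b w) 0; [by right|left].
  by rewrite -(bqV a b w) cabsV lnV// posrE cabs_gt0.
have e20 : 0 < e / 2 by rewrite divr_gt0.
have [r /andP[r0 r1] Hr] := bq_boundary aU bU e20.
have [ps Hps] := critical_finite mF aU Hd d0 r0 r1.
have [lg Hlg] : exists lg : C -> C, forall p, p != 0 -> cexp (lg p) = p /\ 0 <= complex.Im (lg p) < pi *+ 2.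
  have ch p : exists w, p != 0 -> cexp w = p /\ 0 <= complex.Im w < pi *+ 2.
    have [->|p0] := eqVneq p 0; first by exists 0 => /eqP.
    by have [w h1 h2] := clog_exists p0; exists w.
  by have [lg H] := choice ch; exists lg.
(* At zeros of [sin] the hypothesis [agree] is silent; at the arguments of critical values a lift
   may end inside the disc. *)
pose ys := [:: 0; pi; pi *+ 2] ++ [seq complex.Im (lg (F p)) | p <- ps].
have crit y p X : 0 <= y <= pi *+ 2 -> y \notin ys -> cabs p <= r -> critical F p -> F p <> cexp (cplx X y).
  move=> yI yn pr cp Fp; have pps := Hps p pr cp.
  have [_ Fp0 _] := cp; have [h1 /andP[h2 h3]] := Hlg _ Fp0.
  move: yn; rewrite mem_cat negb_or !inE !negb_or => /andP[/and3P[y0 _ y2] /negP[]].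
  apply/mapP; exists p => //.
  suff -> : lg (F p) = cplx X y by [].
  apply: cexp_inj; last by rewrite h1.
  rewrite cImE; move: yI => /andP[k1 k2].
  have k3 : 0 < y by rewrite lt_neqAle eq_sym y0.
  have k4 : y < pi *+ 2 by rewrite lt_neqAle y2.
  by rewrite ltr_norml; apply/andP; split; move: h2 h3 k3 k4; clear; lra.
have critV y p X : 0 <= y <= pi *+ 2 -> y \notin ys -> cabs p <= r ->
    critical (fun u => (F u)^-1) p -> (F p)^-1 <> cexp (cplx X (- y)).
  move=> yI yn pr /criticalV cp Fp; apply: (crit y p (- X) yI yn pr).
    by move: cp; congr critical; apply/funext => u; rewrite invrK.
  by rewrite -[LHS]invrK Fp -cexpN cplxN opprK.
(* The left side loses [6 * e] and the right side gains [2 * e], which accounts for the factor 8. *)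
suff : 2 * ((x1 - c2 - e) - (x0 + c1 + e)) - (x1 - x0) - 2 * e <= (x1 - c2 + e) - (x0 + c1 - e).
  by clear; lra.
have mM : x0 + c1 - e <= x1 - c2 + e.
  have zz : complex.Re (cplx (x0 + 2^-1) 0) <= x0 + 2^-1 by rewrite cReE.
  have [Oz _] := N1' _ zz; have [h1 h2 h3 h4] := S1 _ Oz.
  have /andP[k1 k2] := bound _ _ h1 h2 h3 h4 ltac:(rewrite cReE; clear; lra) ltac:(rewrite cReE; move: x01; clear; lra).
  exact: le_trans k2.
apply: (@length_area R O1 [set z | O2 (- z)] g1 g2 x0 x1 _ _ _ _ e ys) => //.
- by move: x01; clear; lra.
- exact: ml_open M1.
- move=> z /= /(ml_open M2)[q q0 Hq]; exists q => // u uz; apply: Hq; exact: cabs_opp_ball.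
- exact: ml_left M1.
- move=> x x' y /=; rewrite !cplxN => Ox xx; apply: (ml_left M2) Ox _; by rewrite lerN2.
- move=> z Oz; have [h1 h2 h3 h4] := S1 z Oz; split; first exact: bq_neq0.
  apply: (lift_hol (G := bq a b) M1) Oz => u uU Fu; have [u1 u2] := na u Fu.
  exact: bq_dif.
- move=> z Oz; have [h1 h2 h3 h4] := S2 z Oz; split; first exact: bq_neq0.
  have [s s0 Hs] := @lift_hol R (fun u => (F u)^-1) b (bq a b) O2 s2 t2 e2 M2
    ltac:(move=> u uU Fu; rewrite invr_eq0 in Fu; have [u1 u2] := na u Fu; exact: bq_dif) _ Oz.
  by exists s => //; apply: (@hol_opp (fun u => bq a b (s2 u))).
- move=> z z' /S1[h1 h2 h3 <-] /S1[k1 k2 k3 <-] E; congr F.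
  exact: (bq_inj aU bU ab h1 k1 h3 k3).
- move=> z z' /S2[h1 h2 h3 <-] /S2[k1 k2 k3 <-] E; congr F.
  exact: (bq_inj aU bU ab h1 k1 h3 k3).
- move=> z z' /S1[h1 h2 h3 <-] /S2[k1 k2 k3 <-] E; congr F.
  exact: (bq_inj aU bU ab h1 k1 h3 k3).
- by move=> z /S1[h1 h2 h3 h4]; exact: bound h4.
- by move=> z /S2[h1 h2 h3 h4]; exact: bound h4.
- move=> y; have [_ /ler_normlP[_]] := N1 (cplx x0 y) (lexx _); rewrite cReE /g1; clear; lra.
- move=> y; rewrite /g2 cplxN; have [Oz /ler_normlP[_]] := N2 (cplx (- x1) (- y)) (lexx _).
  have [h1 h2 h3 h4] := S2 (cplx x1 y) Oz; rewrite cplxN in h1 h2 h3 h4.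
  have [->|q0] := gb (s2 (cplx (- x1) (- y))); first by rewrite cReE; clear; lra.
  by have := bq_neq0 aU bU h1 h2 h3; rewrite q0 eqxx.
move=> y yI yn.
have siny : sin y != 0.
  by apply: sin_neq0_period => //; move: yn; rewrite mem_cat negb_or => /andP[].
have Oleft x : x <= x0 + 2^-1 -> O1 (cplx x y).
  by move=> xx; have [] := N1' (cplx x y) xx.
have Oright x : x1 - 2^-1 <= x -> O2 (- cplx x y).
  by move=> xx; rewrite cplxN; have [] := N2' (cplx (- x) (- y)) ltac:(rewrite cReE; move: xx; clear; lra).
(* Where both lifts are defined they coincide, and one common cut suffices, after moving it strictly
   between [x0] and [x1] if necessary. *)
have [[x [Ox Ox']]|nx] := pselect (exists x, O1 (cplx x y) /\ O2 (- cplx x y)).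
  have right x' x'' : O2 (- cplx x' y) -> x' <= x'' -> O2 (- cplx x'' y).
    by rewrite !cplxN => O' xx; apply: (ml_left M2) O' _; rewrite lerN2.
  have [x' [x'0 x'1 O1x' O2x']] : exists x', [/\ x0 < x', x' < x1, O1 (cplx x' y) & O2 (- cplx x' y)].
    have [h|h] := leP x x0.
      exists (x0 + 2^-1); split; [clear; lra|move: x01; clear; lra|exact: Oleft|].
      by apply: right Ox' _; move: h; clear; lra.
    have [k|k] := leP x1 x; last by exists x.
    exists (x1 - 2^-1); split; [move: x01; clear; lra|clear; lra| |exact: Oright].
    by apply: (ml_left M1) Ox _; move: k; clear; lra.
  exists x', x'; split=> //; rewrite /g1 /g2 -agree ?cImE//.
  by rewrite gerBl ltW.
(* Otherwise each lift ends before the far side, so it has points outside radius [r], where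
   [|ln |bq a b|| < e / 2]. The cuts are in the right order because the domains do not overlap on
   this line. *)
have nO1 : ~ O1 (cplx x1 y).
  by move=> Ox; apply: nx; exists x1; split=> //; apply: Oright; clear; lra.
have nO2 : ~ O2 (cplx (- x0) (- y)).
  move=> Ox; apply: nx; exists x0; split; first by apply: Oleft; clear; lra.
  by rewrite cplxN.
have [xa xa0 [Oa ra]] := lift_slice mF M1 (Oleft x0 ltac:(clear; lra)) nO1 r0 r1
  (fun p X => @crit y p X yI yn).
have O2x1 : O2 (cplx (- x1) (- y)) by rewrite -cplxN; apply: Oright; clear; lra.
have [xb xb0 [Ob rb]] := lift_slice mE M2 O2x1 nO2 r0 r1 (fun p X => @critV y p X yI yn).
have Ob' : O2 (- cplx (- xb) y) by rewrite cplxN opprK.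
exists xa, (- xb); split => //.
- by split => //; move: xb0; clear; lra.
- rewrite leNgt; apply/negP => h; apply: nx; exists xa; split=> //.
  by rewrite cplxN; apply: (ml_left M2) Ob _; move: h; clear; lra.
have [h1 h2 h3 _] := S1 _ Oa; have [k1 k2 k3 _] := S2 _ Ob'.
rewrite /g1 /g2 cplxN opprK in k1 k2 k3 *.
have /ltr_normlP[A1 A2] := Hr _ ra h1 h2 h3; have /ltr_normlP[A3 A4] := Hr _ rb k1 k2 k3.
by move: A1 A4; clear; lra.
Qed.

End DiscTheorem.

(** * Lifts on the Riemann surface *)

Section Conversion.
Variable R : realType.
Local Notation C := (Cplane R).
Implicit Types (z w u : C) (g : C -> sphere R).

Lemma normC_cabs z : `|z| = (cabs z)%:C%C.
Proof. by []. Qed.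

Lemma nbhs_cabs z (A : set C) : nbhs z A <->
  exists2 r : R, 0 < r & forall u, cabs (u - z) < r -> A u.
Proof.
split.
  move=> /nbhs_ballP[e /= e0 He]; exists (complex.Re e).
    by move: e0; rewrite ltcE => /andP[].
  move=> u ur; apply: He; rewrite /ball/= distrC normC_cabs.
  by move: e0; rewrite !ltcE /= => /andP[/eqP <- _]; rewrite eqxx.
move=> [r r0 Hr]; apply/nbhs_ballP; exists (r%:C%C); first by rewrite /= ltcR.
by move=> u; rewrite /ball/= distrC normC_cabs ltcR => /Hr.
Qed.

Lemma derivable_dif (h : C -> C) z : derivable h z 1 -> dif h z (derive1 h z).
Proof.
move=> dv e e0; have := dv; rewrite /derivable => /cvg_ex[l Hl].
have ld : l = derive1 h z by rewrite derive1E; symmetry; apply/cvg_lim.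
move: Hl; rewrite ld => /cvgrPdist_le /(_ (e%:C%C)); rewrite ltcR => /(_ e0).
rewrite near_withinE => /nbhs_cabs[r /= r0 Hr]; exists r => // u ur.
have [->|h0] := eqVneq u z; first by rewrite !subrr mulr0 subrr cabs0 mulr0.
have := Hr (u - z); rewrite subr0 subr_eq0 => /(_ ur h0).
rewrite distrC normC_cabs lecR /GRing.scale/= mulr1 subrK => H.
have -> : h u - h z - derive1 h z * (u - z) =
  ((u - z)^-1 * (h u - h z) - derive1 h z) * (u - z).
  by field; rewrite subr_eq0.
by rewrite cabsM ler_wpM2r ?cabs_ge0.
Qed.

Lemma sphere_near_finite g z w : {for z, continuous g} -> g z = Some w ->
  forall e : R, 0 < e -> exists2 r : R, 0 < r &
    forall u, cabs (u - z) < r -> exists2 w', g u = Some w' & cabs (w' - w) < e.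
Proof.
move=> cg gz e e0; pose B := [set p : sphere R | exists2 w', p = Some w' & cabs (w' - w) < e].
have : nbhs (g z) B.
  rewrite gz; have : nbhs w [set w' | cabs (w' - w) < e] by apply/nbhs_cabs; exists e.
  by apply: filterS => w' /= ?; exists w'.
by move=> /cg /nbhs_cabs.
Qed.

Lemma sphere_near_inf g z (p : C) : {for z, continuous g} -> g z = None ->
  exists2 r : R, 0 < r & forall u, cabs (u - z) < r -> g u <> Some p.
Proof.
move=> cg gz.
have : nbhs (g z) [set q | q <> Some p].
  rewrite gz; exists [set p]; first split.
  - exact: compact_set1.
  - by apply: accessible_closed_set1; apply: hausdorff_accessible; exact: norm_hausdorff.
  - by move=> q [[w /= wp <- [/wp]]|-> ].
by move=> /cg /nbhs_cabs.
Qed.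

(* The pole [Some w2] is sent to [0] since [x / 0 = 0], which makes [mobV] hold
   everywhere. *)
Definition mob (w1 w2 : C) (p : sphere R) : C :=
  if p is Some w then (w - w1) / (w - w2) else 1.

Lemma mobV w1 w2 p : (mob w1 w2 p)^-1 = mob w2 w1 p.
Proof. by case: p => [w|] /=; rewrite ?invr1// invf_div. Qed.

Lemma mob_inj w1 w2 p q : w1 <> w2 -> p <> Some w2 -> q <> Some w2 ->
  mob w1 w2 p = mob w1 w2 q -> p = q.
Proof.
move=> /eqP w12; have D : w1 - w2 != 0 by rewrite subr_eq0.
have mE w : Some w <> Some w2 -> w - w2 != 0 /\ (w - w1) / (w - w2) = 1 - (w1 - w2) / (w - w2).
  move=> ww; have h : w - w2 != 0 by rewrite subr_eq0; apply/eqP => e; apply: ww; rewrite e.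
  by split=> //; field.
case: p q => [p|] [q|] //=; first 1 last.
- move=> /mE[p2 ->] _ /eqP; rewrite subr_eq -subr_eq0 opprD addNKr oppr_eq0.
  by rewrite mulf_eq0 invr_eq0 (negbTE D) (negbTE p2).
- move=> _ /mE[p2 ->] /eqP; rewrite eq_sym subr_eq -subr_eq0 opprD addNKr oppr_eq0.
  by rewrite mulf_eq0 invr_eq0 (negbTE D) (negbTE p2).
move=> /mE[p2 ->] /mE[q2 ->] /addrI/oppr_inj/(mulfI D)/invr_inj/addIr ->//.
Qed.

Lemma mob_near g z w2 : {for z, continuous g} -> g z <> Some w2 ->
  exists2 r : R, 0 < r & forall u, cabs (u - z) < r -> g u <> Some w2.
Proof.
case E : (g z) => [w|] cg; last by move=> _; exact: sphere_near_inf.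
move=> ww; have h : 0 < cabs (w2 - w).
  by rewrite cabs_gt0 subr_eq0; apply/eqP => e; apply: ww; rewrite e.
have [r r0 Hr] := sphere_near_finite cg E h; exists r => // u /Hr[w' -> h'] [e].
by move: h'; rewrite e ltxx.
Qed.

Lemma mob_dif_fin g z w w1 w2 d : {for z, continuous g} -> g z = Some w -> w <> w2 ->
  dif (fun u => affine_part (g u)) z d ->
  dif (fun u => mob w1 w2 (g u)) z ((w1 - w2) / (w - w2) ^+ 2 * d).
Proof.
move=> cg gz /eqP ww Hd.
have D : w - w2 != 0 by rewrite subr_eq0.
have gw : affine_part (g z) = w by rewrite gz.
have [r r0 Hr] := sphere_near_finite cg gz ltr01.
have H1 := difB Hd (dif_cst w1 z); have H2 := difB Hd (dif_cst w2 z).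
have H3 := difM H1 (@difV _ (fun u => affine_part (g u) - w2) z _ ltac:(cbv beta; by rewrite gw) H2).
have -> : (w1 - w2) / (w - w2) ^+ 2 * d = (d - 0) * (w - w2)^-1 + (w - w1) * (- (w - w2) ^- 2 * (d - 0)).
  by field.
move: H3; cbv beta; rewrite gw; apply: dif_local r0 _.
by move=> u /Hr[w' /= -> _].
Qed.

Lemma mob_dif_inf g z w1 w2 d : {for z, continuous g} -> g z = None ->
  dif (fun u => affine_part (sphere_inv (g u))) z d ->
  exists k, dif (fun u => mob w1 w2 (g u)) z k.
Proof.
move=> cg gz Hd.
have [r1 r10 H1] := sphere_near_inf 0 cg gz; have [r2 r20 H2] := sphere_near_inf w2 cg gz.
have gw : affine_part (sphere_inv (g z)) = 0 by rewrite gz.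
(* At infinity the Moebius map is written as [(1 - w1 * v) / (1 - w2 * v)] with [v] the inverse of
   [g]. *)
have K1 := difB (dif_cst 1 z) (difZ w1 Hd); have K2 := difB (dif_cst 1 z) (difZ w2 Hd).
have K3 := difM K1 (@difV _ (fun u => 1 - w2 * affine_part (sphere_inv (g u))) z _
  ltac:(cbv beta; by rewrite gw mulr0 subr0 oner_eq0) K2).
eexists; apply: (@dif_local _ _ _ _ _ (Num.min r1 r2) _ _ K3); first by rewrite lt_min r10.
move=> u; rewrite lt_min => /andP[/H1 + /H2]; case: (g u) => [w|] /=.
  move=> h1 h2; case: eqP => [e|/eqP w0] /=; first by case: h1; rewrite e.
  have D : w - w2 != 0 by rewrite subr_eq0; apply/eqP => e; apply: h2; rewrite e.
  by field; rewrite w0 D.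
by rewrite !mulr0 !subr0 divr1.
Qed.

Lemma mob_hol g z w1 w2 : meromorphic_on_disk g -> unit_disk z -> g z <> Some w2 ->
  exists2 s : R, 0 < s & hol (fun u => mob w1 w2 (g u)) z s.
Proof.
move=> [mg _] zU gz; have [cg _ _] := mg z zU.
have [r r0 Hr] := mob_near cg gz.
exists (Num.min r (1 - cabs z)); first by rewrite lt_min r0 subr_gt0.
move=> u; rewrite lt_min => /andP[/Hr gu uz].
have uU : unit_disk u by change (cabs u < 1); have := ler_sub_cabs u z; move: uz; clear; lra.
have [cu d1 d2] := mg u uU; case E : (g u) => [w|].
  have ww : w <> w2 by move=> e; apply: gu; rewrite E e.
  have /derivable_dif D : derivable (fun u => affine_part (g u)) u 1 by apply: d1; rewrite E.
  by eexists; exact: (mob_dif_fin _ cu E ww D).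
have /derivable_dif D : derivable (fun u => affine_part (sphere_inv (g u))) u 1.
  by apply: d2; rewrite E.
exact: (mob_dif_inf _ _ cu E D).
Qed.

Lemma mob_mero g w1 w2 : meromorphic_on_disk g -> w1 <> w2 -> mero (fun u => mob w1 w2 (g u)).
Proof.
move=> mg w12 z zU; have [E|E] := pselect (g z = Some w2); last by left; exact: mob_hol.
right; have -> : (fun u => (mob w1 w2 (g u))^-1) = fun u => mob w2 w1 (g u).
  by apply/funext => u; exact: mobV.
by apply: mob_hol => //; rewrite E => -[/esym].
Qed.

End Conversion.

(** * Radial arcs and the circles under them *)

Section RadialCurves.
Variable R : realType.
Local Notation C := (Cplane R).
Implicit Types (F : C -> C) (z w u : C).

(** The lift of the segment from 0 to [cexp zeta], parametrised so that [F] takes the value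
    [t * cexp zeta]; the end [t = 0] corresponds to real part -oo. *)
Definition radial z1 (sigma : C -> C) (zeta : C) (t : R) : C :=
  if t <= 0 then z1 else sigma (cplx (complex.Re zeta + ln t) (complex.Im zeta)).

Lemma radial1 z1 sigma zeta : radial z1 sigma zeta 1 = sigma zeta.
Proof. by rewrite /radial ler10 ln1 addr0; case: zeta. Qed.

Lemma cexp_ln (zeta : C) (t : R) : 0 < t ->
  cexp (cplx (complex.Re zeta + ln t) (complex.Im zeta)) = t%:C%C * cexp zeta.
Proof.
move=> t0; rewrite /cexp cReE cImE expRD lnK ?posrE//.
by apply/eqP; rewrite eq_complex /=; apply/andP; split; apply/eqP; ring.
Qed.

Lemma radial_spec F z1 O sigma sigma0 (e0 : R) zeta (t : R) :
  max_lift F z1 O sigma sigma0 e0 -> O zeta -> 0 <= t <= 1 ->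
  [/\ cabs (radial z1 sigma zeta t) < 1,
      F (radial z1 sigma zeta t) = t%:C%C * cexp zeta &
      exists2 k, k != 0 & dif F (radial z1 sigma zeta t) k].
Proof.
move=> M Oz /andP[t0 t1]; rewrite /radial; case: (leP t 0) => [tn|tp].
  have -> : t = 0 by apply/eqP; rewrite eq_le tn.
  have [] := ml_base M (w := 0); first by rewrite cabs0 (ml_e0 M).
  by rewrite (ml_base0 M) mul0r.
have Ot : O (cplx (complex.Re zeta + ln t) (complex.Im zeta)).
  apply: (ml_left M (x := complex.Re zeta)); first by case: (zeta) Oz.
  by rewrite gerDl -ln1 ler_ln ?posrE.
by have [[h1 h2 h3] h4 _ _] := ml_sigma M Ot; rewrite h4 cexp_ln.
Qed.

Lemma radial_cont F z1 O sigma sigma0 (e0 : R) zeta (t : R) :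
  max_lift F z1 O sigma sigma0 e0 -> O zeta -> 0 <= t <= 1 ->
  forall e : R, 0 < e -> exists2 d : R, 0 < d & forall t', 0 <= t' <= 1 -> `|t' - t| < d ->
    cabs (radial z1 sigma zeta t' - radial z1 sigma zeta t) < e.
Proof.
move=> M Oz /andP[t0 t1] e ep; pose A := expR (complex.Re zeta).
have A0 : 0 < A by exact: expR_gt0.
(* Near [t = 0] the arc is [sigma0] on a segment, and its continuity does not involve [ln]. *)
have small s : 0 <= s -> s * A < e0 -> radial z1 sigma zeta s = sigma0 (s%:C%C * cexp zeta).
  move=> s0 sA; rewrite /radial; case: (leP s 0) => [sn|sp].
    have -> : s = 0 by apply/eqP; rewrite eq_le sn.
    by rewrite mul0r (ml_base0 M).
  have ex : expR (complex.Re (cplx (complex.Re zeta + ln s) (complex.Im zeta))) < e0.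
    by rewrite cReE expRD lnK ?posrE// mulrC.
  by have [_ _ _ ->] := ml_sigma M (ml_near M ex); rewrite ?cexp_ln.
have [tA|tA] := ltP (t * A) e0.
  have [|_ _ _ cs] := ml_base M (w := t%:C%C * cexp zeta).
    by rewrite cabsM cabsR cabs_cexp ger0_norm.
  have [r r0 Hr] := cs e ep.
  exists (Num.min (r / A) (e0 / A - t)).
    by rewrite lt_min divr_gt0//= subr_gt0 ltr_pdivlMr.
  move=> t' /andP[t'0 t'1]; rewrite lt_min ltr_pdivlMr// => /andP[h1 h2].
  rewrite !small//; last first.
    by rewrite -ltr_pdivlMr//; have := ler_norm (t' - t); move: h2; clear; lra.
  apply: Hr; rewrite -mulrBl cabsM cabs_cexp.
  by rewrite (_ : _ - _ = (t' - t)%:C%C) ?cabsR// rmorphB.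
have tp : 0 < t.
  rewrite lt_neqAle t0 andbT eq_sym; apply/eqP => tz; move: tA; rewrite tz mul0r leNgt.
  by rewrite (ml_e0 M).
pose l s : C := cplx (complex.Re zeta + ln s) (complex.Im zeta).
have Ot : O (l t).
  apply: (ml_left M (x := complex.Re zeta)); first by case: (zeta) Oz.
  by rewrite gerDl -ln1 ler_ln ?posrE.
have [_ _ cs _] := ml_sigma M Ot; have [r r0 Hr] := cs e ep.
have [d d0 Hd] : exists2 d : R, 0 < d & forall s, `|s - t| < d -> `|ln s - ln t| < r.
  have := continuous_ln tp => /cvgrPdist_lt /(_ r r0) /nbhs_ballP[d /= d0 Hd].
  by exists d => // s sd; rewrite distrC; apply: Hd; rewrite /ball/= distrC.
exists (Num.min d t); first by rewrite lt_min d0.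
move=> s _; rewrite lt_min => /andP[sd st].
have sp : 0 < s by have := ler_norm (t - s); rewrite distrC; move: st; clear; lra.
rewrite /radial !leNgt sp tp /=; apply: Hr; rewrite cplxB subrr addrAC opprD addrA subrr add0r.
rewrite (_ : cplx _ 0 = (- ln t + ln s)%:C%C)// cabsR addrC; exact: Hd.
Qed.

(** By the inscribed angle theorem, [(w - w1) / (w - w2)] has argument [y] modulo [pi] on a circle
    whose centre lies on the perpendicular bisector, at [|cot y|] half-chords from the midpoint. *)
Definition ray_center w1 w2 (y : R) : C :=
  (w1 + w2) / 2 + cplx 0 (cos y / sin y) * ((w1 - w2) / 2).

Definition ray_radius w1 w2 (y : R) : R :=
  cabs ((w1 - w2) / 2) * Num.sqrt (1 + (cos y / sin y) ^+ 2).

(* With [M] the common value, [(w - center) / ((w1 - w2) / 2)] is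
   [(1 + M) / (1 - M) - 'i * cot y]. *)
Lemma ray_circle w1 w2 w (tau : R) zeta : w != w2 -> w1 != w2 -> sin (complex.Im zeta) != 0 ->
  (w - w1) / (w - w2) = tau%:C%C * cexp zeta ->
  cabs (w - ray_center w1 w2 (complex.Im zeta)) = ray_radius w1 w2 (complex.Im zeta).
Proof.
move=> ww w12 s0 E; set y := complex.Im zeta in s0 *; set k := cos y / sin y.
pose M := tau%:C%C * cexp zeta.
have D : w1 - w2 != 0 by rewrite subr_eq0.
have D2 : w - w2 != 0 by rewrite subr_eq0.
have ME : 1 - M = (w1 - w2) / (w - w2) by rewrite /M -E; field.
have M1 : 1 - M != 0 by rewrite ME mulf_neq0// invr_neq0.
have -> : w - ray_center w1 w2 y = ((w1 - w2) / 2) * ((1 + M - cplx 0 k * (1 - M)) / (1 - M)).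
  have -> : 1 + M = 2 - (1 - M) by ring.
  rewrite ME /ray_center -/k; field.
  by rewrite D D2.
rewrite cabsM /ray_radius -/y -/k; congr (_ * _).
have c0 : 0 < cabs (1 - M) by rewrite cabs_gt0.
have Mre : complex.Re M = k * complex.Im M.
  rewrite /M /cexp /= -/y /k; set X := expR _; set c := cos y; set s := sin y in s0 *.
  by rewrite !mul0r; field.
rewrite cabsM cabsV; apply: (canLR (mulfK _)); first by rewrite gt_eqF.
have k0 : 0 <= 1 + k ^+ 2 by rewrite addr_ge0 ?sqr_ge0.
apply/eqP; rewrite -(@eqrXn2 _ 2) ?cabs_ge0 ?mulr_ge0 ?sqrtr_ge0//.
clearbody M; rewrite exprMn (sqr_sqrtr k0) !sqr_cabs !cReB !cReD !cImB !cImD !cReM !cImM !cReB !cImB !cReE !cImE.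
move: Mre => /=; set u := complex.Re M; set v := complex.Im M.
by move=> ->; apply/eqP; ring.
Qed.

End RadialCurves.

(** * Radial arcs on the surface *)

Section RadialLifts.
Variables (R : realType) (S : topologicalType) (pr : S -> sphere R) (f : Cplane R -> S).
Local Notation C := (Cplane R).
Implicit Types (z w u : C).
Hypothesis surf : maps_disk_onto_surface pr f.

Let disk_inj z z' : cabs z < 1 -> cabs z' < 1 -> f z = f z' -> z = z'.
Proof. by case: surf => -[_ inj _] _ _ _ zU z'U; apply: inj; rewrite in_setE. Qed.

Section OneRay.
Variables (w1 w2 z1 : C) (O : set C) (sigma sigma0 : C -> C) (e0 : R) (zeta : C).
Hypotheses (w12 : w1 <> w2) (gz1 : pr (f z1) = Some w1).
Hypothesis M : max_lift (fun u => mob w1 w2 (pr (f u))) z1 O sigma sigma0 e0.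
Hypotheses (Oz : O zeta) (s0 : sin (complex.Im zeta) != 0).
Local Notation p := (radial z1 sigma zeta).

(** [mob] also vanishes, by convention, at [w2]. On the arc it vanishes only at [t = 0], where the
    projection is [w1]. *)
Lemma radial_neq (t : R) : 0 <= t <= 1 -> pr (f (p t)) <> Some w2.
Proof.
move=> tI E; have [_ + _] := radial_spec M Oz tI; rewrite E /= subrr invr0 mulr0.
move=> /esym/eqP; rewrite mulf_eq0 (negbTE (cexp_neq0 _)) orbF => /eqP[t0].
by move: E; rewrite t0 /radial lexx gz1 => -[].
Qed.

(** Infinity, where [mob] is 1, could only occur on a ray along the real axis, which [sin y != 0]
    excludes. *)
Lemma radial_lift (t : R) : 0 <= t <= 1 ->
  exists w, [/\ pr (f (p t)) = Some w, w != w2 & (w - w1) / (w - w2) = t%:C%C * cexp zeta].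
Proof.
move=> tI; have := radial_neq tI; have [_ + _] := radial_spec M Oz tI.
case: (pr _) => [w|] /=.
  by move=> E ww; exists w; split=> //; apply/eqP => e; apply: ww; rewrite e.
move=> E _; exfalso.
have /eqP := congr1 (@complex.Im R) E; rewrite cImM /= mul0r addr0 eq_sym !mulf_eq0.
rewrite (negbTE s0) (gt_eqF (expR_gt0 _)) !orbF => /eqP t0.
by move: E => /eqP; rewrite t0 mul0r oner_eq0.
Qed.

Lemma radial_over : lies_over pr ((f \o p) @` `[0, 1])
  (circle (ray_center w1 w2 (complex.Im zeta)) (ray_radius w1 w2 (complex.Im zeta))).
Proof.
move=> _ [_ [t /= tI <-] <-]; rewrite in_itv /= in tI.
have [w [-> ww E]] := radial_lift tI; exists w => //.
by apply: ray_circle E => //; exact/eqP.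
Qed.

Lemma radial_jordan : jordan_curve R ((f \o p) @` `[0, 1]).
Proof.
have [_ cf _ _] := surf; exists (f \o p); split => //.
- apply/subspace_continuousP => t /=; rewrite in_itv /= => tI A.
  have [pU _ _] := radial_spec M Oz tI.
  move=> /(cf _ pU) /nbhs_cabs[r r0 Hr].
  have [d d0 Hd] := radial_cont M Oz tI r0.
  apply/nbhs_ballP; exists d => // t' tt' /=; rewrite in_itv /= => t'I.
  by apply: Hr; apply: Hd => //; rewrite distrC.
move=> s t s_0 st t1 E; exfalso.
have sI : 0 <= s <= 1 by rewrite s_0 (le_trans (ltW st)).
have tI : 0 <= t <= 1 by rewrite t1 (le_trans s_0)// ltW.
have [sU Fs _] := radial_spec M Oz sI; have [tU Ft _] := radial_spec M Oz tI.
have := disk_inj sU tU E => e; move: Fs; rewrite e Ft => /(mulIf (cexp_neq0 _)) [ts].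
by move: st; rewrite ts ltxx.
Qed.

(** The derivative of [mob] of the projection does not vanish along the arc, so the projection is
    locally injective there. *)
Lemma radial_unramified : ((f \o p) @` `[0, 1]) `&` ramification_points pr f = set0.
Proof.
have [_ _ _ mg] := surf.
apply/seteqP; split => // _ [[t /= + <-] [z' [z'U nl] E]]; rewrite in_itv /= => tI.
have [pU _ [k k0 Hk]] := radial_spec M Oz tI.
have {E} e := disk_inj z'U pU E; rewrite {}e in z'U nl; apply: nl.
have [s sp Hs] := mob_hol w1 mg pU (radial_neq tI).
have [r [e [_ [[r0 _] _ _ inj _]]]] := local_section sp Hs Hk k0.
exists [set u | cabs (u - p t) < r]; first by apply/nbhs_cabs; exists r.
by move=> u v; rewrite !in_setE => ur vr uv; apply: inj => //=; move: uv; rewrite /= => ->.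
Qed.

End OneRay.

(** If the arcs meet at parameters [t] and [t'], then [t' = t^-1] with both at most 1, so they meet
    at their ends. If they are disjoint, their ends are distinct points with the same projection,
    which one-sheetedness forbids. *)
Lemma radial_agree w1 w2 z1 z2 O1 sigma1 tau1 (e1 : R) O2 sigma2 tau2 e2 :
  disjoint_lifts_one_sheeted pr f z1 z2 w1 w2 ->
  w1 <> w2 -> pr (f z1) = Some w1 -> pr (f z2) = Some w2 ->
  max_lift (fun u => mob w1 w2 (pr (f u))) z1 O1 sigma1 tau1 e1 ->
  max_lift (fun u => mob w2 w1 (pr (f u))) z2 O2 sigma2 tau2 e2 ->
  forall zeta : C, sin (complex.Im zeta) != 0 -> O1 zeta -> O2 (- zeta) ->
  sigma1 zeta = sigma2 (- zeta).
Proof.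
move=> H w12 g1 g2 M1 M2 zeta s0 O1z O2z.
have w21 : w2 <> w1 by move=> /esym.
have s0' : sin (complex.Im (- zeta)) != 0 by rewrite raddfN /= sinN oppr_eq0.
pose p1 := radial z1 sigma1 zeta; pose p2 := radial z2 sigma2 (- zeta).
have i0 : 0 <= (0 : R) <= 1 by rewrite lexx ler01.
have i1 : 0 <= (1 : R) <= 1 by rewrite lexx ler01.
have [P1 P2] : p1 1 = sigma1 zeta /\ p2 1 = sigma2 (- zeta) by rewrite /p1 /p2 !radial1.
have [|/eqP/set0P] := pselect (((f \o p1) @` `[0, 1]) `&` ((f \o p2) @` `[0, 1]) = set0); last first.
  move=> [_ [[t /= + <-] [t' /= + E]]]; rewrite !in_itv /= => tI t'I.
  have [tU Ft _] := radial_spec M1 O1z tI; have [t'U Ft' _] := radial_spec M2 O2z t'I.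
  have e := disk_inj t'U tU E; rewrite -/p1 -/p2 in Ft Ft' e.
  have : (t%:C%C * cexp zeta)^-1 = t'%:C%C * (cexp zeta)^-1 by rewrite -cexpN -Ft' -Ft mobV e.
  rewrite invfM => /(mulIf (invr_neq0 (cexp_neq0 _))); rewrite -fmorphV /= => -[tt].
  (* Because [0^-1 = 0], [t = 0] forces [t' = 0], and the arcs would start at the same point,
     against [w1 <> w2]. *)
  have [t0|tn] := eqVneq t 0.
    move: tt; rewrite t0 invr0 => t'0; rewrite /p1 /p2 t0 -t'0 /radial lexx in e.
    by move: g2; rewrite e g1 => -[].
  have t1 : t = 1.
    have t0 : 0 < t by case/andP: tI => ? _; rewrite lt_neqAle eq_sym tn.
    apply/eqP; rewrite eq_le; case/andP: tI => _ -> /=.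
    by case/andP: t'I => _; rewrite -tt invf_le1.
  by move: e; rewrite -tt t1 invr1 P1 P2.
move=> disj.
have [v1 [E1 v1n V1]] := radial_lift w12 g1 M1 O1z s0 i1.
have [v2 [E2 v2n V2]] := radial_lift w21 g2 M2 O2z s0' i1.
have C1 := radial_over w12 g1 M1 O1z s0; have C2 := radial_over w21 g2 M2 O2z s0'.
have cE : ray_center w2 w1 (complex.Im (- zeta)) = ray_center w1 w2 (complex.Im zeta).
  rewrite /ray_center raddfN /= cosN sinN invrN mulrN [w2 + w1]addrC -[w2 - w1]opprB mulNr.
  by rewrite mulrN -mulNr; congr (_ + _ * _); rewrite /cplx; congr (_ +i* _)%C; ring.
have rE : ray_radius w2 w1 (complex.Im (- zeta)) = ray_radius w1 w2 (complex.Im zeta).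
  by rewrite /ray_radius raddfN /= cosN sinN invrN mulrN sqrrN -opprB mulNr cabsN.
rewrite cE rE in C2.
set G := circle _ _ in C1 C2.
have G1 : f (p1 0) = f z1 by rewrite /p1 /radial lexx.
have G2 : f (p2 0) = f z2 by rewrite /p2 /radial lexx.
have m1 (t : R) : 0 <= t <= 1 -> ((f \o p1) @` `[0, 1]) (f (p1 t)).
  by move=> tI; exists t => //=; rewrite in_itv.
have m2 (t : R) : 0 <= t <= 1 -> ((f \o p2) @` `[0, 1]) (f (p2 t)).
  by move=> tI; exists t => //=; rewrite in_itv.
have GG : circles_through w1 w2 G.
  exists (ray_center w1 w2 (complex.Im zeta)), (ray_radius w1 w2 (complex.Im zeta)); split => //.
  - rewrite /ray_radius mulr_gt0 ?sqrtr_gt0 ?ltr_pwDl ?sqr_ge0// cabs_gt0.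
    by rewrite mulf_neq0 ?invr_neq0 ?subr_eq0 ?pnatr_eq0//; exact/eqP.
  - have [w] := C1 _ (ex_intro2 _ _ _ (m1 0 i0) erefl); by rewrite G1 g1 => h [<-].
  - have [w] := C2 _ (ex_intro2 _ _ _ (m2 0 i0) erefl); by rewrite G2 g2 => h [<-].
have := H _ _ G (radial_jordan M1 O1z) (radial_jordan M2 O2z) disj.
move=> /(_ (radial_unramified w12 g1 M1 O1z) (radial_unramified w21 g2 M2 O2z) GG C1 C2).
rewrite -{1}G1 -{1}G2 => /(_ (m1 0 i0) (m2 0 i0)) /(_ (f (p1 1)) (f (p2 1))).
case.
- by left; exact: m1.
- by right; exact: m2.
- move=> E; suff : set0 (f (p1 1)) by [].
  by rewrite -disj; split; [exact: m1|rewrite E; exact: m2].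
apply: (mob_inj w12 (radial_neq w12 g1 M1 O1z i1)).
  rewrite E2 => -[e]; move: V2; rewrite e subrr mul0r => /esym/eqP.
  by rewrite mul1r (negbTE (cexp_neq0 _)).
by rewrite E1 E2 /= V1 -invf_div V2 !mul1r cexpN invrK.
Qed.

End RadialLifts.

(** For [mob w1 w2] of the projection at [z1], and for its inverse at [z2], the modulus of the
    derivative is that of [surface_deriv] divided by [|w1 - w2|]; [disc_inequality] is then
    multiplied by [|w1 - w2| ^+ 2]. *)
Lemma surface_inequality (R : realType) (S : topologicalType) (pr : S -> sphere R)
    (f : Cplane R -> S) (z1 z2 w1 w2 : Cplane R) :
  maps_disk_onto_surface pr f ->
  unit_disk z1 -> unit_disk z2 ->
  pr (f z1) = Some w1 -> pr (f z2) = Some w2 -> w1 <> w2 ->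
  surface_deriv pr f z1 <> 0 -> surface_deriv pr f z2 <> 0 ->
  disjoint_lifts_one_sheeted pr f z1 z2 w1 w2 ->
  cabs ((1 - cabs z1 ^+ 2)%:C%C * surface_deriv pr f z1
      * (1 - cabs z2 ^+ 2)%:C%C * surface_deriv pr f z2)
    * tanh (hyp_dist z1 z2) ^+ 2 <= cabs (w1 - w2) ^+ 2.
Proof.
have key (x y b d d' W : R) : 0 < W -> x * y * b ^+ 2 * (d / W) * (d' / W) <= 1 ->
    x * d * y * d' * b ^+ 2 <= W ^+ 2.
  move=> W0 h; rewrite -[leRHS]mul1r -ler_pdivrMr ?exprn_gt0//; apply: le_trans h.
  rewrite le_eqVlt; apply/orP; left; apply/eqP.
  by field; rewrite gt_eqF.
move=> surf z1U z2U g1 g2 w12 /eqP D1 /eqP D2 H.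
have [_ _ _ mg] := surf; have [mg' _] := mg.
have w21 : w2 <> w1 by move=> /esym.
have dif_at z w w' : unit_disk z -> pr (f z) = Some w -> w <> w' ->
    surface_deriv pr f z != 0 ->
    exists d, [/\ dif (fun u => mob w w' (pr (f u))) z d, d != 0 &
      cabs d = cabs (surface_deriv pr f z) / cabs (w - w')].
  move=> zU gz ww d0; have [cz dz _] := mg' z zU.
  have /derivable_dif Hd : derivable (fun u => affine_part (pr (f u))) z 1.
    by apply: dz; rewrite /= gz.
  have D : w - w' != 0 by rewrite subr_eq0; exact/eqP.
  eexists; split; first exact: (mob_dif_fin w cz gz ww Hd).
    by rewrite mulf_neq0// mulf_neq0// invr_neq0 ?expf_neq0.
  rewrite (_ : (w - w') / (w - w') ^+ 2 = (w - w')^-1); last by field.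
  by rewrite cabsM cabsV mulrC.
have [d1 [Hd1 d10 E1]] := dif_at z1 w1 w2 z1U g1 w12 D1.
have [d2 [Hd2 d20 E2]] := dif_at z2 w2 w1 z2U g2 w21 D2.
have F1 : mob w1 w2 (pr (f z1)) = 0 by rewrite g1 /= subrr mul0r.
have F2 : mob w2 w1 (pr (f z2)) = 0 by rewrite g2 /= subrr mul0r.
have [s1 s10 Hs1] : exists2 s : R, 0 < s & hol (fun u => mob w1 w2 (pr (f u))) z1 s.
  by apply: mob_hol mg z1U _; rewrite /= g1 => -[].
have [s2 s20 Hs2] : exists2 s : R, 0 < s & hol (fun u => mob w2 w1 (pr (f u))) z2 s.
  by apply: mob_hol mg z2U _; rewrite /= g2 => -[].
have m1 : mero (fun u => mob w1 w2 (pr (f u))) := mob_mero mg w12.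
have m2 : mero (fun u => mob w2 w1 (pr (f u))) := mob_mero mg w21.
have [U1 [sig1 [tau1 [e1 M1]]]] := max_lift_exists m1 z1U F1 s10 Hs1 Hd1 d10.
have [U2 [sig2 [tau2 [e2 M2]]]] := max_lift_exists m2 z2U F2 s20 Hs2 Hd2 d20.
have agree := radial_agree surf H w12 g1 g2 M1 M2.
have VE : (fun u => mob w2 w1 (pr (f u))) = (fun u => (mob w1 w2 (pr (f u)))^-1).
  by apply/funext => u; rewrite mobV.
rewrite VE in M2 Hd2.
have z12 : z1 != z2 by apply/eqP => e; apply: w12; move: g1; rewrite e g2 => -[].
have F2' : mob w1 w2 (pr (f z2)) = 0 by rewrite g2 /= subrr invr0 mulr0.
have := disc_inequality m1 M1 M2 z1U z2U z12 F1 F2' Hd1 d10 Hd2 d20 agree.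
rewrite E1 E2 -(cabsB w1 w2).
rewrite tanh_hyp_dist// /pseudo_hyp_dist.
have -> : cabs ((z1 - z2) / (1 - (z1 : R[i])^*%C * z2)) = cabs (blaschke z1 z2).
  by rewrite /blaschke !cabsM cabsB.
have W0 : 0 < cabs (w1 - w2) by rewrite cabs_gt0 subr_eq0; exact/eqP.
have sq0 (z : Cplane R) : unit_disk z -> 0 <= 1 - cabs z ^+ 2.
  by move=> zU; rewrite subr_ge0 expr_le1// ?cabs_ge0// ltW.
rewrite !cabsM !cabsR (ger0_norm (sq0 _ z1U)) (ger0_norm (sq0 _ z2U)).
exact: key W0.
Qed.

(** * The extremal function *)

Section Extremal.
Variable R : realType.
Local Notation C := (Cplane R).
Local Notation D := (@unit_disk R).
Implicit Types (z u : C).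

Lemma dif_derivable (h : C -> C) z (d : C) : dif h z d -> derivable h z 1 /\ derive1 h z = d.
Proof.
move=> Hd.
suff H : (fun t : C => t^-1 *: ((h \o shift z) (t *: 1) - h z)) @ 0^' --> d.
  by split; [apply/cvg_ex; exists d | rewrite derive1E; apply/cvg_lim].
apply/cvgrPdist_le => e e0.
have re : e = (complex.Re e)%:C%C.
  by move: e0; rewrite ltcE => /andP[/eqP + _]; case: (e) => a b /= ->.
have e0' : 0 < complex.Re e by move: e0; rewrite {1}re ltcR.
have [r r0 Hr] := Hd _ e0'; rewrite near_withinE; apply/nbhs_cabs; exists r => // t /=.
rewrite subr0 => tr t0; rewrite distrC normC_cabs re lecR /GRing.scale/= mulr1.
have := Hr (t + z); rewrite addrK => /(_ tr) h1.
have -> : t^-1 * (h (t + z) - h z) - d = (h (t + z) - h z - d * t) / t by field.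
by rewrite cabsM cabsV ler_pdivrMr ?cabs_gt0.
Qed.

(** The extremal function is univalent, so the disk itself serves as its surface, with the function
    as projection; every subset is then one-sheeted. *)
Definition disk_points : topologicalType := D.

Lemma disk0 : (0 : C) \in D.
Proof. by rewrite in_setE; change (cabs (0 : C) < 1); rewrite cabs0. Qed.

Definition into_disk z : disk_points := insubd (exist _ 0 disk0 : disk_points) z.

(** For [w1 = - 2 / 3] and [w2 = 2 / 3], the values at [- 1 / 2] and [1 / 2],
    [(quadr z - w1) / (quadr z - w2)] is exactly the Blaschke quotient of these two points, so
    nothing is lost in the estimates. *)
Definition quadr z : C := z / (1 - z ^+ 2).

Definition disk_proj (s : disk_points) : sphere R := Some (quadr (val s)).

Lemma val_into_disk z : D z -> val (into_disk z) = z.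
Proof. by rewrite -in_setE => zD; rewrite val_insubd zD. Qed.

Lemma val_disk (s : disk_points) : D (val s).
Proof. by rewrite -in_setE; exact: valP. Qed.

Lemma disk_sq_neq1 z u : D z -> D u -> 1 + z * u != 0.
Proof.
move=> zD uD; apply/eqP => E; have : cabs (z * u) = 1.
  by rewrite -(addrK 1 (z * u)) [_ + 1]addrC E sub0r cabsN -[1]/(1%:C%C) cabsR normr1.
rewrite cabsM; have : cabs z * cabs u < 1 by rewrite mulr_ilt1 ?cabs_ge0.
by move=> /[swap] ->; rewrite ltxx.
Qed.

Lemma quadr_den z : D z -> 1 - z ^+ 2 != 0.
Proof.
move=> zD; have : 1 + z * - z != 0 by apply: disk_sq_neq1 => //; change (cabs (- z) < 1); rewrite cabsN.
by rewrite mulrN expr2.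
Qed.

Lemma quadr_inj z u : D z -> D u -> quadr z = quadr u -> z = u.
Proof.
move=> zD uD; rewrite /quadr => /eqP.
rewrite eqr_div ?quadr_den// => /eqP E; apply/eqP; rewrite -subr_eq0.
have /eqP : (z - u) * (1 + z * u) = 0.
  rewrite (_ : _ * _ = z * (1 - u ^+ 2) - u * (1 - z ^+ 2)); last by ring.
  by rewrite E subrr.
by rewrite mulf_eq0 (negbTE (disk_sq_neq1 zD uD)) orbF.
Qed.

Lemma disk_proj_inj : injective disk_proj.
Proof.
by move=> s t [E]; apply: val_inj; apply: quadr_inj E; exact: val_disk.
Qed.

Lemma quadr_dif z : D z -> dif (fun u => affine_part (disk_proj (into_disk u))) z
  ((1 + z ^+ 2) / (1 - z ^+ 2) ^+ 2).
Proof.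
move=> zD; have q0 := quadr_den zD.
have H := difM (dif_id z) (@difV _ (fun u => 1 - u ^+ 2) z _ q0 (difB (dif_cst 1 z) (difM (dif_id z) (dif_id z)))).
have -> : (1 + z ^+ 2) / (1 - z ^+ 2) ^+ 2 =
  1 * (1 - z ^+ 2)^-1 + z * (- (1 - z ^+ 2) ^- 2 * (0 - (1 * z + z * 1))) by field.
apply: (dif_local (r := 1 - cabs z)) H; first by rewrite subr_gt0.
move=> u uz; rewrite /= val_into_disk//; change (cabs u < 1).
by have := ler_sub_cabs u z; move: uz; clear; lra.
Qed.

Lemma disk_surface : maps_disk_onto_surface disk_proj into_disk.
Proof.
split.
- split=> [//|z u|s _].
    by rewrite !in_setE => zD uD E; rewrite -(val_into_disk zD) -(val_into_disk uD) E.
  by exists (val s); [exact: val_disk | apply: val_inj; rewrite val_into_disk//; exact: val_disk].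
- move=> z zD B [A [[A' oA' <-] /= Az] AB].
  have : nbhs z A' by apply: open_nbhs_nbhs; split=> //; rewrite -(val_into_disk zD).
  move=> /nbhs_cabs[r r0 Hr]; apply/nbhs_cabs; exists (Num.min r (1 - cabs z)).
    by rewrite lt_min r0 subr_gt0.
  move=> u; rewrite lt_min => /andP[/Hr uA uz]; apply: AB.
  have uD : D u by change (cabs u < 1); have := ler_sub_cabs u z; move: uz; clear; lra.
  by rewrite -(val_into_disk uD) in uA.
- move=> A AD oA; exists A => //; apply/seteqP; split=> [s As|_ [z Az <-]].
    by exists (val s) => //; apply: val_inj; rewrite val_into_disk//; exact: val_disk.
  by have := Az; rewrite -{1}(val_into_disk (AD z Az)).
split.
  move=> z zD; have H := quadr_dif zD; split.
  - move=> B /= HB; have /nbhs_cabs[e e0 He] : nbhs (quadr (val (into_disk z))) (Some @^-1` B) by [].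
    have [r r0 Hr] := dif_cont H e0; apply/nbhs_cabs; exists r => // u /Hr h; exact: He.
  - by move=> _; case: (dif_derivable H).
  - rewrite /= => n0; have w0 : quadr (val (into_disk z)) != 0 by apply/eqP => e; apply: n0; rewrite /disk_proj e.
    have -> : (fun u => affine_part (sphere_inv (disk_proj (into_disk u)))) =
        fun u => (affine_part (disk_proj (into_disk u)))^-1.
      by apply/funext => u /=; case: eqP => //= ->; rewrite invr0.
    by have [] := dif_derivable (@difV _ (fun u => affine_part (disk_proj (into_disk u))) z _ w0 H).
have hD : D (2^-1 : R)%:C%C.
  by change (cabs (2^-1 : R)%:C%C < 1); rewrite cabsR ger0_norm// invf_lt1// ltr1n.
exists 0, (2^-1 : R)%:C%C; split=> //; first by rewrite -in_setE disk0.
move=> /disk_proj_inj E; have := val_into_disk hD; rewrite -E val_into_disk; last by rewrite -in_setE disk0.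
by move=> [] /esym/eqP; rewrite invr_eq0 pnatr_eq0.
Qed.

End Extremal.

Section ExtremalValues.
Variable R : realType.
Local Notation C := (Cplane R).
Implicit Types (x y : R).

Lemma quadr_real x : quadr (x%:C%C : C) = (x / (1 - x ^+ 2))%:C%C.
Proof. by rewrite /quadr fmorph_div rmorphB rmorph1 rmorphXn. Qed.

Lemma surface_deriv_real x : `|x| < 1 ->
  surface_deriv (@disk_proj R) (@into_disk R) x%:C%C = ((1 + x ^+ 2) / (1 - x ^+ 2) ^+ 2)%:C%C.
Proof.
move=> x1; have xD : unit_disk (x%:C%C : C) by change (cabs (x%:C%C) < 1); rewrite cabsR.
have [_ E] := dif_derivable (quadr_dif xD).
by rewrite /surface_deriv E fmorph_div !(rmorphXn, rmorphB, rmorph1) rmorphD !(rmorphXn, rmorph1).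
Qed.

Lemma pseudo_hyp_dist_real x y :
  pseudo_hyp_dist (x%:C%C : C) y%:C%C = `|(x - y) / (1 - x * y)|.
Proof.
rewrite /pseudo_hyp_dist conjc_real -cabsR fmorph_div; congr (cabs (_ / _)).
  by rewrite rmorphB.
by rewrite rmorphB rmorph1 rmorphM.
Qed.

Lemma surface_inequality_sharp :
  exists (S : topologicalType) (pr : S -> sphere R) (f : Cplane R -> S)
      (z1 z2 w1 w2 : Cplane R),
    maps_disk_onto_surface pr f /\
    unit_disk z1 /\ unit_disk z2 /\
    pr (f z1) = Some w1 /\ pr (f z2) = Some w2 /\ w1 <> w2 /\
    surface_deriv pr f z1 <> 0 /\ surface_deriv pr f z2 <> 0 /\
    disjoint_lifts_one_sheeted pr f z1 z2 w1 w2 /\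
    cabs ((1 - cabs z1 ^+ 2)%:C%C * surface_deriv pr f z1
        * (1 - cabs z2 ^+ 2)%:C%C * surface_deriv pr f z2)
      * tanh (hyp_dist z1 z2) ^+ 2
      = cabs (w1 - w2) ^+ 2.
Proof.
pose x : R := - 2^-1; pose y : R := 2^-1.
have x1 : `|x| < 1 by rewrite /x normrN ger0_norm// invf_lt1// ltr1n.
have y1 : `|y| < 1 by rewrite /y ger0_norm// invf_lt1// ltr1n.
have xD : unit_disk (x%:C%C : C) by change (cabs (x%:C%C) < 1); rewrite cabsR.
have yD : unit_disk (y%:C%C : C) by change (cabs (y%:C%C) < 1); rewrite cabsR.
have dx : (1 + x ^+ 2) / (1 - x ^+ 2) ^+ 2 = 20 / 9 by rewrite /x; field.
have dy : (1 + y ^+ 2) / (1 - y ^+ 2) ^+ 2 = 20 / 9 by rewrite /y; field.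
have qx : x / (1 - x ^+ 2) = - (2 / 3) by rewrite /x; field.
have qy : y / (1 - y ^+ 2) = 2 / 3 by rewrite /y; field.
have d0 : ((20 / 9 : R)%:C%C : C) <> 0 by move=> [] /eqP; rewrite mulf_eq0 invr_eq0 !pnatr_eq0.
exists (disk_points R), (@disk_proj R), (@into_disk R), x%:C%C, y%:C%C,
  (- (2 / 3) : R)%:C%C, (2 / 3 : R)%:C%C.
split; first exact: disk_surface.
split=> //; split=> //.
split; first by rewrite /disk_proj val_into_disk// quadr_real qx.
split; first by rewrite /disk_proj val_into_disk// quadr_real qy.
split; first by move=> /complexI E; suff : - (2 / 3) < 2 / 3 :> R by [rewrite E ltxx]; lra.
split; first by rewrite surface_deriv_real// dx.
split; first by rewrite surface_deriv_real// dy.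
split.
  by move=> g1 g2 G _ _ _ _ _ _ _ _ _ _ W W' _ _ WW E; exact/WW/disk_proj_inj.
(* Numerically, [(3 / 4 * (20 / 9)) ^+ 2 * (4 / 5) ^+ 2 = (4 / 3) ^+ 2]. *)
rewrite tanh_hyp_dist// pseudo_hyp_dist_real !surface_deriv_real// dx dy.
rewrite !cabsR -!rmorphM -rmorphB !cabsR /x /y normrN !real_normK ?num_real//.
by rewrite ger0_norm; [field | lra].
Qed.

End ExtremalValues.

Theorem theorem1 (R : realType) :
  (forall (S : topologicalType) (pr : S -> sphere R) (f : Cplane R -> S)
      (z1 z2 w1 w2 : Cplane R),
    maps_disk_onto_surface pr f ->
    unit_disk z1 -> unit_disk z2 ->
    pr (f z1) = Some w1 -> pr (f z2) = Some w2 -> w1 <> w2 ->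
    surface_deriv pr f z1 <> 0 -> surface_deriv pr f z2 <> 0 ->
    disjoint_lifts_one_sheeted pr f z1 z2 w1 w2 ->
    cabs ((1 - cabs z1 ^+ 2)%:C%C * surface_deriv pr f z1
        * (1 - cabs z2 ^+ 2)%:C%C * surface_deriv pr f z2)
      * tanh (hyp_dist z1 z2) ^+ 2
      <= cabs (w1 - w2) ^+ 2)
  /\
  (exists (S : topologicalType) (pr : S -> sphere R) (f : Cplane R -> S)
      (z1 z2 w1 w2 : Cplane R),
    maps_disk_onto_surface pr f /\
    unit_disk z1 /\ unit_disk z2 /\
    pr (f z1) = Some w1 /\ pr (f z2) = Some w2 /\ w1 <> w2 /\
    surface_deriv pr f z1 <> 0 /\ surface_deriv pr f z2 <> 0 /\
    disjoint_lifts_one_sheeted pr f z1 z2 w1 w2 /\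
    cabs ((1 - cabs z1 ^+ 2)%:C%C * surface_deriv pr f z1
        * (1 - cabs z2 ^+ 2)%:C%C * surface_deriv pr f z2)
      * tanh (hyp_dist z1 z2) ^+ 2
      = cabs (w1 - w2) ^+ 2).
Proof.
split; last exact: surface_inequality_sharp.
exact: surface_inequality.
Qed.
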